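(* Assume $n+1>3$. Let $(M^{n+1},g_+)$ be an asymptotically hyperbolic manifold satisfying $\mathrm{Ric}_{g_+}+n g_+\ge 0$. Let $r$ be any special defining function for $\Sigma=\partial M$, let $\hat g=(r^2g_+)|_{T\Sigma}$, and write $r^2g_+=dr^2+g_r$ near $\Sigma$ with $g_r=g_{(0)}+g_{(1)}r+g_{(2)}r^2+O(r^3)$, $g_{(0)}=\hat g$. Then $g_{(1)}=0$ and $g_{(2)}=-P_{\hat g}$ (that is, $g_+$ is weakly Poincaré--Einstein) if and only if $R_{g_+}+n(n+1)=o(r^2)$ as $r\to 0$.
   Context: Let $\overline M^{n+1}$ be a compact smooth manifold with nonempty boundary $\Sigma^n=\partial M$ and interior $M$. A defining function for $\Sigma$ is a function $r$ with $r>0$ in $M$, $r^{-1}(0)=\Sigma$ and $dr\neq 0$ on $\Sigma$. A complete metric $g_+$ on $M$ is conformally compact if $r^2g_+$ extends to a metric on $\overline M$ of class $C^{m,\alpha}$; throughout, $m\ge 3$ and $\alpha\in(0,1)$. It is asymptotically hyperbolic (AH) if moreover its sectional curvatures tend to $-1$ at $\Sigma$ (equivalently $|dr|^2_{r^2g_+}=1$ on $\Sigma$). A special defining function is a defining function $r$ with $|dr|^2_{r^2g_+}\equiv1$ in a collar neighborhood of $\Sigma$; the flow of $\nabla_{r^2g_+}r$ identifies a collar with $\Sigma\times[0,\epsilon_0)$, on which $r^2g_+=dr^2+g_r$ with $g_r$ a one-parameter family of metrics on $\Sigma$. $\mathrm{Ric}_{g_+}$ and $R_{g_+}$ are the Ricci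 and scalar curvatures of $g_+$. The Schouten tensor of $\hat g$ on $\Sigma^n$ ($n\ge3$) is $P_{\hat g}=\frac1{n-2}\left(\mathrm{Ric}_{\hat g}-\frac{R_{\hat g}}{2(n-1)}\hat g\right)$. An AH metric is weakly Poincaré--Einstein (WPE) if $g_r=\hat g-P_{\hat g}r^2+O(r^3)$ for special defining functions $r$. *)

(* Defs.v *)
From HB Require Import structures.
From mathcomp Require Import all_boot all_order all_algebra.
From mathcomp Require Import all_classical all_reals all_analysis.

Set Implicit Arguments.
Unset Strict Implicit.
Unset Printing Implicit Defensive.

Import Order.TTheory GRing.Theory Num.Theory.
Import numFieldNormedType.Exports.

Local Open Scope classical_set_scope.
Local Open Scope ring_scope.

(* Coordinate index ord0 is the direction normal to the boundary; the
   tangential directions are lift ord0 a, a : 'I_n. *)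
Definition halfspace (R : realType) (n : nat) : set 'rV[R]_n.+1 :=
  [set x | 0 <= x 0 ord0].
Arguments halfspace : clear implicits.

Definition hpt (R : realType) (n : nat) (t : R) (y : 'rV[R]_n) : 'rV[R]_n.+1 :=
  \row_a (if unlift ord0 a is Some b then y 0 b else t).

Definition tangential (R : realType) (n : nat) (A : 'M[R]_n.+1) : 'M[R]_n :=
  row' ord0 (col' ord0 A).

(* Partial derivatives relative to a set S.  S is always either setT or the
   half-space: at interior points of S these are the usual partial derivatives,
   and at a boundary point of the half-space the normal one is one-sided. *)
Definition pquot (R : realType) (k : nat) (S : set 'rV[R]_k) (a : 'I_k)
    (f : 'rV[R]_k -> R) (x : 'rV[R]_k) : set_system R :=
  h^-1 * (f (x + h *: delta_mx 0 a) - f x)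
    @[h --> within [set h | S (x + h *: delta_mx 0 a)] (0 : R)^'].

Definition partial (R : realType) (k : nat) (S : set 'rV[R]_k) (a : 'I_k)
    (f : 'rV[R]_k -> R) (x : 'rV[R]_k) : R := lim (pquot S a f x).

(* Class C^k, resp. C^{k,alpha} (locally), on a relatively open subset U of S,
   up to the points of U lying on the boundary of S. *)
Fixpoint Ck (R : realType) (d : nat) (S U : set 'rV[R]_d) (k : nat)
    (f : 'rV[R]_d -> R) : Prop :=
  {within U, continuous f} /\
  if k is k'.+1 then
    forall a, (forall x, U x -> cvg (pquot S a f x)) /\
              Ck S U k' (partial S a f)
  else True.

Definition locally_holder (R : realType) (d : nat) (U : set 'rV[R]_d)
    (alpha : R) (f : 'rV[R]_d -> R) : Prop :=
  forall x, U x -> exists C : R, exists2 V : set 'rV[R]_d, nbhs x V &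
    forall y z, (V `&` U) y -> (V `&` U) z ->
      `|f y - f z| <= C * `|y - z| `^ alpha.

Fixpoint Ckalpha (R : realType) (d : nat) (S U : set 'rV[R]_d) (k : nat)
    (alpha : R) (f : 'rV[R]_d -> R) : Prop :=
  {within U, continuous f} /\
  if k is k'.+1 then
    forall a, (forall x, U x -> cvg (pquot S a f x)) /\
              Ckalpha S U k' alpha (partial S a f)
  else locally_holder U alpha f.

(* Curvature of a metric given by its matrix g of components in coordinates.
   riemann S g x d c a b is R^d_{cab}, with R(e_a, e_b) e_c = R^d_{cab} e_d;
   with these signs the unit sphere has positive Ricci and sectional
   curvatures. *)
Definition christoffel (R : realType) (k : nat) (S : set 'rV[R]_k)
    (g : 'rV[R]_k -> 'M[R]_k) (x : 'rV[R]_k) (c a b : 'I_k) : R :=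
  2^-1 * \sum_d invmx (g x) c d *
    (partial S a (fun z => g z b d) x + partial S b (fun z => g z a d) x
     - partial S d (fun z => g z a b) x).

Definition riemann (R : realType) (k : nat) (S : set 'rV[R]_k)
    (g : 'rV[R]_k -> 'M[R]_k) (x : 'rV[R]_k) (d c a b : 'I_k) : R :=
  partial S a (fun z => christoffel S g z d b c) x
  - partial S b (fun z => christoffel S g z d a c) x
  + \sum_e (christoffel S g x d a e * christoffel S g x e b c
            - christoffel S g x d b e * christoffel S g x e a c).

Definition ricci (R : realType) (k : nat) (S : set 'rV[R]_k)
    (g : 'rV[R]_k -> 'M[R]_k) (x : 'rV[R]_k) : 'M[R]_k :=
  \matrix_(b, c) \sum_a riemann S g x a c a b.

Definition scalar_curvature (R : realType) (k : nat) (S : set 'rV[R]_k)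
    (g : 'rV[R]_k -> 'M[R]_k) (x : 'rV[R]_k) : R :=
  \tr (invmx (g x) *m ricci S g x).

Definition schouten (R : realType) (k : nat) (S : set 'rV[R]_k)
    (g : 'rV[R]_k -> 'M[R]_k) (x : 'rV[R]_k) : 'M[R]_k :=
  (k%:R - 2)^-1 *:
    (ricci S g x - (scalar_curvature S g x / (2 * (k%:R - 1))) *: g x).

Definition inner (R : realType) (k : nat) (A : 'M[R]_k) (v w : 'rV[R]_k) : R :=
  (v *m A *m w^T) 0 0.

(* g(R(v, w) w, v) / (|v|^2 |w|^2 - g(v, w)^2) *)
Definition sectional (R : realType) (k : nat) (S : set 'rV[R]_k)
    (g : 'rV[R]_k -> 'M[R]_k) (x v w : 'rV[R]_k) : R :=
  (\sum_a \sum_b \sum_c \sum_d \sum_e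
     v 0 a * w 0 b * w 0 c * riemann S g x d c a b * g x d e * v 0 e)
  / (inner (g x) v v * inner (g x) w w - inner (g x) v w ^+ 2).

(* A compact smooth manifold with boundary, of dimension n + 1, given by an
   atlas of charts phi i, with inverses psi i, onto relatively open subsets of
   the half-space (second countability follows from compactness). *)
Record bmanifold (R : realType) (n : nat) := BManifold {
  bm_space :> topologicalType;
  chart : Type;
  dom : chart -> set bm_space;
  phi : chart -> bm_space -> 'rV[R]_n.+1;
  psi : chart -> 'rV[R]_n.+1 -> bm_space;
  bm_compact : compact [set: bm_space];
  bm_hausdorff : hausdorff_space bm_space;
  bm_dom_open : forall i, open (dom i);
  bm_cover : forall p, exists i, dom i p;
  bm_image : forall i, exists2 O : set 'rV[R]_n.+1, open O &
    phi i @` dom i = O `&` halfspace R n;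
  bm_phiK : forall i p, dom i p -> psi i (phi i p) = p;
  bm_phi_continuous : forall i, {within dom i, continuous (phi i)};
  bm_psi_continuous : forall i, {within phi i @` dom i, continuous (psi i)};
  bm_transition : forall i j k a,
    Ck (halfspace R n) (phi i @` (dom i `&` dom j)) k
       (fun x => phi j (psi i x) 0 a)
}.
Arguments dom {R n} b.
Arguments phi {R n} b.
Arguments psi {R n} b.

Definition bdry (R : realType) (n : nat) (X : bmanifold R n) : set X :=
  [set p | exists2 i, dom X i p & phi X i p 0 ord0 = 0].

(* A covariant 2-tensor is the family of its component matrices: T i p is the
   matrix at p in the chart i, of significance when dom X i p. *)
Definition tensor2 (R : realType) (n : nat) (X : bmanifold R n) :=
  chart X -> X -> 'M[R]_n.+1.

Definition local_fun (R : realType) (n : nat) (X : bmanifold R n)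
    (f : X -> R) (i : chart X) : 'rV[R]_n.+1 -> R := fun x => f (psi X i x).

Definition local_tensor (R : realType) (n : nat) (X : bmanifold R n)
    (T : tensor2 X) (i : chart X) : 'rV[R]_n.+1 -> 'M[R]_n.+1 :=
  fun x => T i (psi X i x).

(* Entry (a, b) is d(phi j)^b / d(phi i)^a at p. *)
Definition jacobian (R : realType) (n : nat) (X : bmanifold R n)
    (i j : chart X) (p : X) : 'M[R]_n.+1 :=
  \matrix_(a, b)
    partial (halfspace R n) a (fun x => phi X j (psi X i x) 0 b) (phi X i p).

Definition is_metric (R : realType) (n : nat) (X : bmanifold R n) (A : set X)
    (g : tensor2 X) : Prop :=
  (forall i p, A p -> dom X i p ->
     (g i p)^T = g i p /\ (forall v, v != 0 -> 0 < inner (g i p) v v)) /\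
  (forall i j p, A p -> dom X i p -> dom X j p ->
     g i p = jacobian i j p *m g j p *m (jacobian i j p)^T).

Definition Ck_fun (R : realType) (n : nat) (X : bmanifold R n) (k : nat)
    (f : X -> R) : Prop :=
  forall i, Ck (halfspace R n) (phi X i @` dom X i) k (local_fun f i).

Definition Ck_tensor (R : realType) (n : nat) (X : bmanifold R n) (k : nat)
    (T : tensor2 X) : Prop :=
  forall i a b, Ck (halfspace R n) (phi X i @` dom X i) k
                   (fun x => local_tensor T i x a b).

Definition Ckalpha_tensor (R : realType) (n : nat) (X : bmanifold R n)
    (k : nat) (alpha : R) (T : tensor2 X) : Prop :=
  forall i a b, Ckalpha (halfspace R n) (phi X i @` dom X i) k alpha
                        (fun x => local_tensor T i x a b).

Definition differential (R : realType) (n : nat) (X : bmanifold R n)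
    (f : X -> R) (i : chart X) (p : X) : 'rV[R]_n.+1 :=
  \row_a partial (halfspace R n) a (local_fun f i) (phi X i p).

Definition gradient (R : realType) (n : nat) (X : bmanifold R n)
    (g : tensor2 X) (f : X -> R) (i : chart X) (p : X) : 'rV[R]_n.+1 :=
  differential f i p *m invmx (g i p).

Definition defining_function (R : realType) (n : nat) (X : bmanifold R n)
    (m : nat) (r : X -> R) : Prop :=
  [/\ Ck_fun m r,
      forall p, ~ bdry p -> 0 < r p,
      forall p, bdry p -> r p = 0 &
      forall i p, bdry p -> dom X i p -> differential r i p != 0].

Definition extends_compactification (R : realType) (n : nat)
    (X : bmanifold R n) (r : X -> R) (gp gb : tensor2 X) : Prop :=
  is_metric [set: X] gb /\
  (forall i p, ~ bdry p -> dom X i p -> gb i p = r p ^+ 2 *: gp i p).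

(* gam restricted to [0, 1] is a C^1 curve in the interior M, with speed s. *)
Definition C1_curve (R : realType) (n : nat) (X : bmanifold R n)
    (gp : tensor2 X) (gam : R -> X) (s : R -> R) : Prop :=
  (forall t, t \in `[0, 1] -> {for t, continuous gam} /\ ~ bdry (gam t)) /\
  (forall i,
     (forall t, t \in `[0, 1] -> dom X i (gam t) ->
        derivable (fun u : R => phi X i (gam u)) t 1 /\
        let v := derive1 (fun u : R => phi X i (gam u)) t in
        s t = Num.sqrt (inner (gp i (gam t)) v v)) /\
     {within [set t | t \in `[0, 1] /\ dom X i (gam t)],
        continuous (derive1 (fun u : R => phi X i (gam u)))}).

Definition joined_within (R : realType) (n : nat) (X : bmanifold R n)
    (gp : tensor2 X) (e : R) (p q : X) : Prop :=
  exists gam s, [/\ C1_curve gp gam s, gam 0 = p, gam 1 = q &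
    (\int[@lebesgue_measure R]_(t in `[0%R, 1%R]) (s t)%:E < e%:E)%E].

Definition complete_metric (R : realType) (n : nat) (X : bmanifold R n)
    (gp : tensor2 X) : Prop :=
  forall u : nat -> X, (forall k, ~ bdry (u k)) ->
    (forall e : R, 0 < e -> exists N, forall k l, (N <= k)%N -> (N <= l)%N ->
       joined_within gp e (u k) (u l)) ->
    exists2 p : X, ~ bdry p & u @ \oo --> p.

Definition conformally_compact (R : realType) (n : nat) (X : bmanifold R n)
    (m : nat) (alpha : R) (gp : tensor2 X) : Prop :=
  complete_metric gp /\
  exists rho gb, [/\ @defining_function R n X m rho,
    extends_compactification rho gp gb & Ckalpha_tensor m alpha gb].

Definition asymptotically_hyperbolic (R : realType) (n : nat)
    (X : bmanifold R n) (m : nat) (alpha : R) (gp : tensor2 X) : Prop :=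
  [/\ is_metric (~` @bdry R n X) gp,
      conformally_compact m alpha gp &
      forall e : R, 0 < e -> exists N : set X,
        [/\ open N, @bdry R n X `<=` N &
         forall i p v w, N p -> ~ bdry p -> dom X i p ->
           (forall a b : R, a *: v + b *: w = 0 -> a = 0 /\ b = 0) ->
           `|sectional (halfspace R n) (local_tensor gp i) (phi X i p) v w
             + 1| < e]].

Definition unit_gradient_on (R : realType) (n : nat) (X : bmanifold R n)
    (N : set X) (gb : tensor2 X) (r : X -> R) : Prop :=
  forall i p, N p -> dom X i p ->
    inner (invmx (gb i p)) (differential r i p) (differential r i p) = 1.

(* gb is the extension of r^2 g_+ to the closed manifold.  If some C^m defining
   function rho gives rho^2 g_+ of class C^{m,alpha}, then for any C^m defining
   function r the quotient r / rho, hence also r^2 g_+, is of class C^{m-1} up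
   to the boundary: the regularity of gb is not an additional restriction. *)
Definition special_defining_function (R : realType) (n : nat)
    (X : bmanifold R n) (m : nat) (gp gb : tensor2 X) (r : X -> R) : Prop :=
  [/\ defining_function m r,
      extends_compactification r gp gb,
      Ck_tensor m.-1 gb &
      exists N : set X,
        [/\ open N, @bdry R n X `<=` N & unit_gradient_on N gb r]].

(* Local expression of the collar map Phi in the half-space coordinates
   x = (t, y), with y boundary coordinates in the chart i. *)
Definition collar_coord (R : realType) (n : nat) (X : bmanifold R n)
    (Phi : X -> R -> X) (i j : chart X) (x : 'rV[R]_n.+1) : 'rV[R]_n.+1 :=
  phi X j (Phi (psi X i (hpt 0 (col' ord0 x))) (x 0 ord0)).

Definition collar_dom (R : realType) (n : nat) (X : bmanifold R n) (eps : R)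
    (Phi : X -> R -> X) (i j : chart X) : set 'rV[R]_n.+1 :=
  [set x : 'rV[R]_n.+1 | [/\ 0 <= x 0 ord0 < eps,
     (phi X i @` dom X i) (hpt 0 (col' ord0 x)) &
     dom X j (Phi (psi X i (hpt 0 (col' ord0 x))) (x 0 ord0))]].

(* Phi identifies Sigma x [0, eps) with a collar by the flow of the gradient of
   r with respect to gb = r^2 g_+. *)
Definition gradient_collar (R : realType) (n : nat) (X : bmanifold R n)
    (m : nat) (gb : tensor2 X) (r : X -> R) (eps : R)
    (Phi : X -> R -> X) : Prop :=
  let D := [set z : X * R | bdry z.1 /\ 0 <= z.2 < eps] in
  let F := fun z : X * R => Phi z.1 z.2 in
  [/\ 0 < eps,
      forall p, bdry p -> Phi p 0 = p,
      {within D, continuous F} /\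
        (forall i j c, Ck (halfspace R n) (collar_dom eps Phi i j) m.-1
                          (fun x => collar_coord Phi i j x 0 c)),
      [/\ set_inj D F, open (F @` D) & unit_gradient_on (F @` D) gb r] &
      forall i j p t c, bdry p -> 0 <= t < eps -> dom X i p ->
        dom X j (Phi p t) ->
        partial (halfspace R n) ord0 (fun x => collar_coord Phi i j x 0 c)
                (hpt t (col' ord0 (phi X i p)))
        = gradient gb r j (Phi p t) 0 c].

(* Components, at p in Sigma and in the boundary coordinates of the chart i, of
   g_t, the restriction to T Sigma of the pull-back of gb under Phi(-, t); the
   chart j around Phi p t is auxiliary. *)
Definition collar_metric (R : realType) (n : nat) (X : bmanifold R n)
    (gb : tensor2 X) (Phi : X -> R -> X) (i j : chart X) (t : R) (p : X)
    : 'M[R]_n :=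
  let J : 'M[R]_(n, n.+1) := \matrix_(a, c)
    partial (halfspace R n) (lift ord0 a)
            (fun x => collar_coord Phi i j x 0 c)
            (hpt t (col' ord0 (phi X i p))) in
  J *m gb j (Phi p t) *m J^T.

(* The components of \hat g = gb|_{T Sigma} in the boundary coordinates. *)
Definition bdry_metric (R : realType) (n : nat) (X : bmanifold R n)
    (gb : tensor2 X) (i : chart X) : 'rV[R]_n -> 'M[R]_n :=
  fun y => tangential (local_tensor gb i (hpt 0 y)).

Definition bdry_schouten (R : realType) (n : nat) (X : bmanifold R n)
    (gb : tensor2 X) (i : chart X) (p : X) : 'M[R]_n :=
  schouten [set: 'rV[R]_n] (bdry_metric gb i) (col' ord0 (phi X i p)).

(* g_t = \hat g + g1 t + g2 t^2 + O(t^3), uniformly on Sigma, the size of a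
   symmetric 2-tensor being measured with respect to \hat g. *)
Definition collar_expansion (R : realType) (n : nat) (X : bmanifold R n)
    (gb : tensor2 X) (eps : R) (Phi : X -> R -> X)
    (g1 g2 : chart X -> X -> 'M[R]_n) : Prop :=
  exists C d : R, [/\ 0 < d, d <= eps &
    forall i j p t (v : 'rV[R]_n), bdry p -> 0 <= t < d -> dom X i p ->
      dom X j (Phi p t) ->
      let gh := tangential (gb i p) in
      `|inner (collar_metric gb Phi i j t p
               - (gh + t *: g1 i p + t ^+ 2 *: g2 i p)) v v|
      <= C * t ^+ 3 * inner gh v v].

(* Main.v *)
Require Import Defs.
From HB Require Import structures.
From mathcomp Require Import all_boot all_order all_algebra.
From mathcomp Require Import all_classical all_reals all_analysis.
From mathcomp Require Import ring lra.
Set Implicit Arguments.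
Unset Strict Implicit.
Unset Printing Implicit Defensive.
Import Order.TTheory GRing.Theory Num.Theory.
Import numFieldNormedType.Exports.
Local Open Scope classical_set_scope.
Local Open Scope ring_scope.

(** Write gb = r^2 g_+ for the compactified metric, H for the Hessian of r with
respect to gb, and T = Ric_+ + n g_+. On the collar |dr| = 1, so the formula for
the Ricci tensor under a conformal change loses its terms in r^-2 (lemma
[conformal_ricci]):
  T = Ric_gb + r^-1 ((n - 1) H + (tr H) gb),   R_+ + n (n + 1) = r^2 tr_gb T.
Here H is of class C^1 up to the boundary. The equivalence is thus a statement
about the two leading terms of T at the boundary and about their traces.

Suppose T >= 0 and R_+ + n (n + 1) = o(r^2), that is, tr T -> 0. At the boundary
r T tends to (n - 1) H + (tr H) gb, a nonnegative form whose trace 2 n tr H is 0;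
so H is nonnegative with zero trace, and H = 0 on the boundary
([hess_vanishes]). Then H / r has a limit Q there, T has the limit
  T0 = Ric_gb + (n - 1) Q + (tr Q) gb,
and T0 is again nonnegative with zero trace, hence T0 = 0
([limit_tensor_vanishes]).

These tensors determine the expansion of g_r. The collar map is the flow of the
gradient of r, and the derivative of gb along this flow is 2 H ([lie_metric]).
Hence g_(1) is twice the tangential part of H ([metric_slope]) and, when H
vanishes on the boundary, g_(2) is the tangential part of Q ([metric_curve]).
The normal components of H are zero because |dr| is constant ([hess_gradient]),
so g_(1) = 0 is the same as H = 0 on the boundary ([hess_bdry_eq0]).

Finally T0 is computed when H = 0 on the boundary. The boundary is then totally
geodesic; the Gauss equation, together with the identity of Ricci for the third
derivatives of r, gives
  tangential part of T0 = Ric_h + (n - 2) Q + (tr Q) h,   h the boundary metric,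
([limit_tensor_tangential]), whose vanishing amounts to Q = - P_h
([schouten_equation]). The normal component of T0 is always 0, so tr T0 is the
trace of the tangential part ([limit_tensor_trace]). This proves that the
expansion is the asserted one if the curvature condition holds. Conversely
g_(1) = 0 and g_(2) = - P_h give tr T0 = 0, that is, R_+ + n (n + 1) = o(r^2) near
each boundary point, in one chart at a time; compactness of the manifold and the
invariance of the scalar curvature under changes of coordinates make this
uniform ([wpe_scalar]).

All computations take place in the charts of the manifold and not in the
coordinates of the collar: for m = 3 the collar map is only of class C^2, and
the metric it pulls back need not have a curvature up to the boundary. *)

(** * Partial derivatives in a half-space, up to its boundary *)

Section HalfspaceCalculus.
Context {R : realType} {n : nat}.
Local Notation V := 'rV[R]_n.+1.
Local Notation HS := (halfspace R n).
Local Notation D := (partial HS).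
Implicit Types (U : set V) (f g : V -> R) (x y z : V) (a b c : 'I_n.+1).

Local Notation axis a := (delta_mx 0 a : V).

(** Formulated with [near], this form of being relatively open in the half-space is
the one consumed by limits taken within the half-space. *)
Definition ropen U := U `<=` HS /\ forall x, U x -> \forall z \near x, HS z -> U z.

(** The filter of the definition of [partial]: at a boundary point it is one-sided
in the normal direction and two-sided in the tangential ones. Positive increments
are always admissible, so that the filter is proper at every point of the
half-space. *)
Definition steps a x : set_system R := within [set h | HS (x + h *: axis a)] (0 : R)^'.

(** Naming the value avoids [lim], which carries no information when the limit does
not exist; the rules of differentiation are proved in this form. *)
Definition has_partial a f x l :=
  h^-1 * (f (x + h *: axis a) - f x) @[h --> steps a x] --> (l : R).

Definition partially_diff a f x := cvg (pquot HS a f x).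

Lemma halfspace_step a x h : HS x -> 0 <= h -> HS (x + h *: axis a).
Proof.
by rewrite /halfspace /= !mxE => hx hh; rewrite addr_ge0 // mulr_ge0.
Qed.

Lemma steps_proper a x : HS x -> ProperFilter (steps a x).
Proof.
move=> hx; apply: Build_ProperFilter_ex => P [e /= e0 He].
exists (e / 2); apply: He => /=.
- by rewrite sub0r normrN gtr0_norm ?divr_gt0 // ltr_pdivrMr // mulr_natr mulr2n ltrDl.
- by rewrite gt_eqF // divr_gt0.
- by apply: halfspace_step => //; rewrite divr_ge0 // ltW.
Qed.

#[global] Instance steps_filter a x : Filter (steps a x).
Proof. exact: within_filter. Qed.

Lemma steps_cvg0 a x : (h @[h --> steps a x]) --> (0 : R).
Proof.
apply: cvg_trans (cvg_within _) _; apply: cvg_trans; last exact: nbhs_dnbhs.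
exact: cvg_id.
Qed.

Lemma step_cvg a x : x + h *: axis a @[h --> steps a x] --> x.
Proof.
rewrite -[X in _ --> X]addr0 -(scale0r (axis a)).
apply: cvgD; first exact: cvg_cst.
apply: cvgZr_tmp; exact: steps_cvg0.
Qed.

Lemma steps_in U a x : ropen U -> U x -> \forall h \near steps a x, U (x + h *: axis a).
Proof.
move=> [UH Uo] Ux; have := @step_cvg a x _ (Uo x Ux) => /= H.
have H2 : \forall h \near steps a x, HS (x + h *: axis a) by exact: withinT.
by apply: filterS2 H2 H => h /= hS; exact.
Qed.

Lemma steps_neq0 a x : \forall h \near steps a x, h != 0.
Proof.
apply: cvg_within; rewrite /dnbhs; apply: withinT.
Qed.

Lemma has_partialE a f x l : HS x -> has_partial a f x l -> D a f x = l.
Proof. by move=> hx /cvg_lim; apply => //; exact: steps_proper. Qed.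

Lemma has_partial_diff a f x l : has_partial a f x l -> partially_diff a f x.
Proof. by move=> H; apply/cvg_ex; exists l. Qed.

Lemma eq_has_partial U a f g x l : ropen U -> U x -> (forall z, U z -> f z = g z) ->
  has_partial a f x l -> has_partial a g x l.
Proof.
move=> Uo Ux fg; apply: cvg_trans; apply: near_eq_cvg.
apply: filterS (steps_in a Uo Ux) => h Uh /=.
by rewrite fg // (fg x).
Qed.

Lemma has_partial_cvg a f x l : has_partial a f x l ->
  f (x + h *: axis a) @[h --> steps a x] --> f x.
Proof.
rewrite /has_partial => H; pose proof (cvgM (@steps_cvg0 a x) H) as K.
pose proof (cvgD (cvg_cst (f x)) K) as K1; move: K1; rewrite mul0r addr0.
apply: cvg_trans; apply: near_eq_cvg.
apply: filterS (@steps_neq0 a x) => h h0 /=.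
by rewrite !fctE /= mulrA divff // mul1r addrC subrK.
Qed.

Lemma has_partial_cst a (k : R) x : has_partial a (fun=> k) x 0.
Proof.
rewrite /has_partial; under eq_fun do rewrite subrr mulr0.
exact: cvg_cst.
Qed.

Lemma has_partialD a f g x l m : has_partial a f x l -> has_partial a g x m ->
  has_partial a (fun z => f z + g z) x (l + m).
Proof.
move=> Hf Hg; pose proof (cvgD Hf Hg) as K; apply: cvg_trans K; apply: near_eq_cvg.
by apply: nearW => h; rewrite ?fctE /=; rewrite -mulrDr; congr (_ * _); ring.
Qed.

Lemma has_partialN a f x l : has_partial a f x l ->
  has_partial a (fun z => - f z) x (- l).
Proof.
move=> Hf; pose proof (cvgN Hf) as K; apply: cvg_trans K; apply: near_eq_cvg.
by apply: nearW => h; rewrite ?fctE /=; rewrite -mulrN; congr (_ * _); ring.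
Qed.

Lemma has_partialM a f g x l m : has_partial a f x l -> has_partial a g x m ->
  has_partial a (fun z => f z * g z) x (l * g x + f x * m).
Proof.
move=> Hf Hg; have Cg := has_partial_cvg Hg.
pose proof (cvgD (cvgM Hf Cg) (cvgM (cvg_cst (f x)) Hg)) as K.
apply: cvg_trans K; apply: near_eq_cvg.
by apply: nearW => h; rewrite ?fctE /=; ring.
Qed.

Lemma has_partialV a f x l : f x != 0 -> has_partial a f x l ->
  has_partial a (fun z => (f z)^-1) x (- (f x)^-2 * l).
Proof.
move=> f0 Hf; have Cf := has_partial_cvg Hf.
pose proof (cvgM (cvgN (cvgM (cvgV f0 Cf) (cvg_cst (f x)^-1))) Hf) as K; move: K.
rewrite -expr2 -exprVn; apply: cvg_trans; apply: near_eq_cvg.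
have : \forall h \near steps a x, f (x + h *: axis a) != 0.
  exact: (Cf _ (open_nbhs_nbhs (conj (@open_neq _ _) f0))).
apply: filterS2 (@steps_neq0 a x) => h h0 fh /=.
by rewrite ?fctE /=; field; rewrite h0 fh f0.
Qed.

Lemma has_partial_sum a (I : Type) (s : seq I) (P : pred I) (F : I -> V -> R) (l : I -> R) x :
  (forall i, P i -> has_partial a (F i) x (l i)) ->
  has_partial a (fun z => \sum_(i <- s | P i) F i z) x (\sum_(i <- s | P i) l i).
Proof.
move=> H; elim: s => [|i s IH].
  under eq_fun do rewrite big_nil.
  by rewrite big_nil; exact: has_partial_cst.
under eq_fun do rewrite big_cons.
rewrite big_cons; case: ifP => // Pi.
exact: has_partialD (H i Pi) IH.
Qed.

Local Notation CkU k U := (Ck HS U k).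

Lemma Ck_cvg k U f x : CkU k U f -> U x -> f z @[z --> within U (nbhs x)] --> f x.
Proof. by case: k => [[/subspace_continuousP H _]|k [/subspace_continuousP H _]]; apply: H. Qed.

Lemma Ck_has_partial k U a f x : CkU k.+1 U f -> U x -> has_partial a f x (D a f x).
Proof. by move=> [_ /(_ a)[H _]]; exact: H. Qed.

Arguments Ck_has_partial {k U} a {f x}.

Lemma Ck_partial k U a f : CkU k.+1 U f -> CkU k U (D a f).
Proof. by move=> [_ /(_ a)[]]. Qed.

Lemma CkW k U f : CkU k.+1 U f -> CkU k U f.
Proof.
elim: k f => [|k IH] f; first by case.
move=> [cf Df]; split=> // a; have [H1 H2] := Df a.
by split=> //; exact: IH.
Qed.

Lemma Ck_leq j k U f : (j <= k)%N -> CkU k U f -> CkU j U f.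
Proof.
move=> /subnK <-; elim: (k - j)%N => [//|i IH] /CkW; exact: IH.
Qed.

Lemma Ck_subset k U U' f : U' `<=` U -> CkU k U f -> CkU k U' f.
Proof.
move=> sub; elim: k f => [|k IH] f [cf Df].
  by split=> //; exact: continuous_subspaceW cf.
split; first exact: continuous_subspaceW cf.
move=> a; have [H1 H2] := Df a; split; last exact: IH.
by move=> x /sub; exact: H1.
Qed.

Lemma eq_partial U a f g x : ropen U -> U x -> (forall z, U z -> f z = g z) ->
  partially_diff a f x -> D a f x = D a g x.
Proof.
move=> Uo Ux fg df; apply/esym/has_partialE; first exact: Uo.1.
exact: eq_has_partial Uo Ux fg df.
Qed.

Lemma eq_continuous_within U f g : (forall z, U z -> f z = g z) ->
  {within U, continuous f} -> {within U, continuous g}.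
Proof.
move=> fg /subspace_continuousP H; apply/subspace_continuousP => x Ux.
have gE : g z @[z --> within U (nbhs x)] --> g x.
  rewrite -(fg x Ux); apply: cvg_trans (H x Ux); apply: near_eq_cvg.
  by apply: filterS (withinT _ (nbhs_filter x)) => z Uz; have := fg z Uz.
exact: gE.
Qed.

Lemma eq_Ck k U f g : ropen U -> (forall z, U z -> f z = g z) -> CkU k U f -> CkU k U g.
Proof.
move=> Uo; elim: k f g => [|k IH] f g fg [cf Df].
  by split=> //; exact: eq_continuous_within cf.
split; first exact: eq_continuous_within cf.
move=> a; have [H1 H2] := Df a; split.
  by move=> x Ux; exact: (has_partial_diff (eq_has_partial Uo Ux fg (H1 x Ux))).
apply: IH H2 => z Uz; exact: (eq_partial Uo Uz fg (H1 z Uz)).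
Qed.

Lemma Ck_cst k U (l : R) : ropen U -> CkU k U (fun=> l).
Proof.
move=> Uo; elim: k l => [|k IH] l.
  by split=> //; apply: continuous_subspaceT; exact: cst_continuous.
split; first by apply: continuous_subspaceT; exact: cst_continuous.
move=> a; split; first by move=> x Ux; apply: has_partial_diff; exact: has_partial_cst.
apply: (eq_Ck Uo _ (IH 0)) => z Uz; apply/esym/has_partialE; first exact: Uo.1.
exact: has_partial_cst.
Qed.

Lemma Ck_intro k U f (df : 'I_n.+1 -> V -> R) : ropen U ->
  {within U, continuous f} ->
  (forall a x, U x -> has_partial a f x (df a x)) -> (forall a, CkU k U (df a)) ->
  CkU k.+1 U f.
Proof.
move=> Uo cf H1 H2; split=> // a; split=> [x Ux|]; first exact: has_partial_diff (H1 a x Ux).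
apply: (eq_Ck Uo _ (H2 a)) => z Uz; apply/esym/has_partialE; first exact: Uo.1.
exact: H1.
Qed.

Lemma CkD k U f g : ropen U -> CkU k U f -> CkU k U g -> CkU k U (fun z => f z + g z).
Proof.
move=> Uo; elim: k f g => [|k IH] f g Hf Hg.
  split=> //; apply/subspace_continuousP => x Ux.
  exact: cvgD (Ck_cvg Hf Ux) (Ck_cvg Hg Ux).
apply: (@Ck_intro _ _ _ (fun a z => D a f z + D a g z)) => //.
- apply/subspace_continuousP => x Ux.
  exact: cvgD (Ck_cvg Hf Ux) (Ck_cvg Hg Ux).
- by move=> a x Ux; apply: has_partialD; apply: Ck_has_partial Ux; eassumption.
- by move=> a; apply: IH; exact: Ck_partial.
Qed.

Lemma CkM k U f g : ropen U -> CkU k U f -> CkU k U g -> CkU k U (fun z => f z * g z).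
Proof.
move=> Uo; elim: k f g => [|k IH] f g Hf Hg.
  split=> //; apply/subspace_continuousP => x Ux.
  exact: cvgM (Ck_cvg Hf Ux) (Ck_cvg Hg Ux).
apply: (@Ck_intro _ _ _ (fun a z => D a f z * g z + f z * D a g z)) => //.
- apply/subspace_continuousP => x Ux.
  exact: cvgM (Ck_cvg Hf Ux) (Ck_cvg Hg Ux).
- by move=> a x Ux; apply: has_partialM; apply: Ck_has_partial Ux; eassumption.
- by move=> a; apply: CkD => //; apply: IH; [exact: Ck_partial|exact: CkW|exact: CkW|exact: Ck_partial].
Qed.

Lemma CkN k U f : ropen U -> CkU k U f -> CkU k U (fun z => - f z).
Proof.
move=> Uo Hf; apply: (eq_Ck Uo _ (CkM Uo (Ck_cst k (-1) Uo) Hf)) => z _.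
by rewrite mulN1r.
Qed.

Lemma CkB k U f g : ropen U -> CkU k U f -> CkU k U g -> CkU k U (fun z => f z - g z).
Proof. by move=> Uo Hf Hg; apply: CkD => //; exact: CkN. Qed.

Lemma CkV k U f : ropen U -> (forall x, U x -> f x != 0) -> CkU k U f ->
  CkU k U (fun z => (f z)^-1).
Proof.
move=> Uo f0; elim: k => [|k IH] Hf.
  split=> //; apply/subspace_continuousP => x Ux.
  exact: cvgV (f0 x Ux) (Ck_cvg Hf Ux).
have Hi := IH (CkW Hf).
apply: (@Ck_intro _ _ _ (fun a z => - ((f z)^-1 * (f z)^-1 * D a f z))) => //.
- apply/subspace_continuousP => x Ux.
  exact: cvgV (f0 x Ux) (Ck_cvg Hf Ux).
- move=> a x Ux; have := has_partialV (f0 x Ux) (Ck_has_partial a Hf Ux).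
  by rewrite mulNr expr2 invfM.
- move=> a; apply: CkN => //; apply: CkM => //; first exact: CkM.
  exact: Ck_partial.
Qed.

Lemma Ck_sum k U (I : Type) (s : seq I) (P : pred I) (F : I -> V -> R) : ropen U ->
  (forall i, P i -> CkU k U (F i)) -> CkU k U (fun z => \sum_(i <- s | P i) F i z).
Proof.
move=> Uo H; elim: s => [|i s IH].
  by apply: (eq_Ck Uo _ (Ck_cst k 0 Uo)) => z _; rewrite big_nil.
case Pi : (P i); last by apply: (eq_Ck Uo _ IH) => z _; rewrite big_cons Pi.
apply: (eq_Ck Uo _ (CkD Uo (H i Pi) IH)) => z _; by rewrite big_cons Pi.
Qed.

Lemma Ck_prod k U (I : Type) (s : seq I) (P : pred I) (F : I -> V -> R) : ropen U ->
  (forall i, P i -> CkU k U (F i)) -> CkU k U (fun z => \prod_(i <- s | P i) F i z).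
Proof.
move=> Uo H; elim: s => [|i s IH].
  by apply: (eq_Ck Uo _ (Ck_cst k 1 Uo)) => z _; rewrite big_nil.
case Pi : (P i); last by apply: (eq_Ck Uo _ IH) => z _; rewrite big_cons Pi.
apply: (eq_Ck Uo _ (CkM Uo (H i Pi) IH)) => z _; by rewrite big_cons Pi.
Qed.

End HalfspaceCalculus.
Arguments Ck_has_partial {R n k U} a {f x}.
Arguments Ck_partial {R n k U} a {f}.

(** * Mean value theorem, chain rule, symmetry of second derivatives *)

Section MeanValue.
Context {R : realType} {n : nat}.
Local Notation V := 'rV[R]_n.+1.
Local Notation HS := (halfspace R n).
Local Notation D := (partial HS).
Local Notation axis a := (delta_mx 0 a : V).
Local Notation CkU k U := (Ck HS U k).
Implicit Types (U : set V) (f g : V -> R) (x y z : V) (a b c : 'I_n.+1).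

Lemma nbhs_rowP x (P : set V) : (\forall z \near x, P z) <->
  exists2 e : R, 0 < e & forall z, (forall c, `|z 0 c - x 0 c| < e) -> P z.
Proof.
split=> [/nbhs_ballP[e /= e0 He]|[e e0 He]].
  exists e => // z Hz; apply: He; split=> // i c.
  by rewrite /ball /= (ord1 i) distrC; exact: Hz.
apply/nbhs_ballP; exists e => //= z [_ Hz]; apply: He => c.
by have := Hz 0 c; rewrite /ball /= distrC.
Qed.

Lemma cvg_row (T : Type) (F : set_system T) (FF : Filter F) (y : T -> V) x :
  (forall c, y t 0 c @[t --> F] --> x 0 c) -> y t @[t --> F] --> x.
Proof.
move=> H P /nbhs_rowP[e e0 He].
have : \forall t \near F, forall c, `|y t 0 c - x 0 c| < e.
  apply: filter_forall => c; have /cvgrPdist_lt/(_ e e0) := H c.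
  by apply: filterS => t; rewrite distrC.
by apply: filterS => t; exact: He.
Qed.

Lemma at_right_steps a x (P : set R) : HS x ->
  (\forall h \near steps a x, P h) -> \forall h \near (0 : R)^'+, P h.
Proof.
move=> hx; rewrite /steps /at_right /dnbhs !near_withinE.
apply: filterS => h H h0; apply: H; first by rewrite gt_eqF.
by apply: halfspace_step => //; exact: ltW.
Qed.

Lemma has_partial_is_derive a f x s l : HS x -> 0 < s ->
  has_partial a f (x + s *: axis a) l ->
  is_derive s (1 : R) (fun t => f (x + t *: axis a)) l.
Proof.
move=> hx s0 H.
have K : h^-1 *: (f (x + (h *: 1 + s) *: axis a) - f (x + s *: axis a))
           @[h --> (0 : R)^'] --> l.
  have H' : h^-1 * (f (x + s *: axis a + h *: axis a) - f (x + s *: axis a))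
           @[h --> (0 : R)^'] --> l.
    move=> P /H; rewrite /steps /fmap /= /within /= /nbhs /= => HP.
    have : \forall h \near (0 : R)^', 0 < s + h.
      apply: nbhs_dnbhs; have : - s < 0 by rewrite oppr_lt0.
      by move/lt_nbhsr; apply: filterS => h; rewrite -ltrBlDl sub0r.
    rewrite /= in HP *; apply: filterS2 HP => h /= HP h0; apply: HP.
    by rewrite -addrA -scalerDl; apply: halfspace_step => //; exact: ltW.
  apply: cvg_trans H'; apply: near_eq_cvg; apply: nearW => h /=.
  by rewrite -addrA -scalerDl [h%:A]mulr1 (addrC s).
apply: DeriveDef; first by apply/cvg_ex; exists l.
exact: cvg_lim K.
Qed.

(** The interval runs in the direction of increasing coordinate, so that it stays
in the half-space even when it starts on the boundary; there the one-sided
derivative gives the continuity that the mean value theorem requires. *)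
Lemma line_mvt a f (df : R -> R) x h : HS x -> 0 <= h ->
  (forall s, 0 <= s <= h -> has_partial a f (x + s *: axis a) (df s)) ->
  exists2 s, 0 <= s <= h & f (x + h *: axis a) - f x = df s * h.
Proof.
move=> hx h0 H; have [->|hn0] := eqVneq h 0.
  by exists 0; rewrite ?lexx // scale0r addr0 subrr mulr0.
have {hn0}h1 : 0 < h by rewrite lt_def hn0.
have der s : 0 < s -> s <= h -> is_derive s (1 : R) (fun t => f (x + t *: axis a)) (df s).
  by move=> s0 sh; apply: has_partial_is_derive => //; apply: H; rewrite (ltW s0).
have dv s : s \in `]0, h[ -> is_derive s (1 : R) (fun t => f (x + t *: axis a)) (df s).
  by rewrite in_itv /= => /andP[? ?]; apply: der => //; exact: ltW.
have cf : {within `[0, h], continuous (fun t => f (x + t *: axis a))}.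
  apply/continuous_within_itvP => //; split.
  - move=> s /dv[d _].
    by apply: differentiable_continuous; apply/derivable1_diffP.
  - rewrite scale0r addr0.
    have H0 : has_partial a f x (df 0).
      by have := H 0; rewrite scale0r addr0; apply; rewrite lexx.
    apply: cvg_trans (has_partial_cvg H0) => P HP.
    exact: (at_right_steps (P := [set h | P (f (x + h *: axis a))]) hx HP).
  - apply: cvg_at_left_filter; have [d _] := der h h1 (lexx h).
    by apply: differentiable_continuous; apply/derivable1_diffP.
have [s + E] := MVT h1 dv cf; rewrite in_itv /= => /andP[s0 sh].
exists s; first by rewrite !ltW.
by move: E; rewrite scale0r addr0 subr0.
Qed.

Lemma Ck_mvt a f U p h : U `<=` HS -> CkU 1 U f ->
  (forall th, 0 <= th <= 1 -> U (p + (th * h) *: axis a)) ->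
  exists2 th, 0 <= th <= 1 &
    f (p + h *: axis a) - f p = D a f (p + (th * h) *: axis a) * h.
Proof.
move=> UH Hf seg; have [h0|h0] := leP 0 h.
- have [->|hn0] := eqVneq h 0.
    by exists 0; rewrite ?lexx ?ler01 // scale0r addr0 subrr mulr0.
  have hp : 0 < h by rewrite lt_def hn0.
  have Hp : HS p by apply: UH; have := seg 0; rewrite mul0r scale0r addr0; apply; rewrite lexx ler01.
  have [s /andP[s0 sh] E] : exists2 s, 0 <= s <= h &
     f (p + h *: axis a) - f p = D a f (p + s *: axis a) * h.
    apply: (line_mvt (df := fun s => D a f (p + s *: axis a))) => // s /andP[s0 sh].
    apply: Ck_has_partial Hf _; rewrite -[s](divfK hn0); apply: seg.
    by rewrite divr_ge0 //= ler_pdivrMr // mul1r.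
  exists (s / h); last by rewrite divfK.
  by rewrite divr_ge0 //= ler_pdivrMr // mul1r.
- have hn0 : h != 0 by rewrite lt_eqF.
  have Hp : HS (p + h *: axis a).
    by apply: UH; have := seg 1; rewrite mul1r; apply; rewrite lexx ler01.
  have shift s : p + h *: axis a + s *: axis a = p + ((h + s) / h * h) *: axis a.
    by rewrite divfK // -addrA -scalerDl.
  have inI s : 0 <= s -> s <= - h -> 0 <= (h + s) / h <= 1.
    move=> s0 sh; rewrite ler_ndivrMr // mul1r lerDl s0 andbT.
    by rewrite ler_ndivlMr // mul0r addrC -lerBrDr sub0r.
  have [s /andP[s0 sh] E] : exists2 s, 0 <= s <= - h &
     f (p + h *: axis a + (- h) *: axis a) - f (p + h *: axis a) =
     D a f (p + h *: axis a + s *: axis a) * (- h).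
    apply: (line_mvt (df := fun s => D a f (p + h *: axis a + s *: axis a))) => //.
      by rewrite oppr_ge0 ltW.
    move=> s /andP[s0 sh]; apply: Ck_has_partial Hf _.
    by rewrite shift; apply: seg; exact: inI.
  exists ((h + s) / h); first exact: inI.
  move: E; rewrite scaleNr addrK shift mulrN => /(congr1 (@GRing.opp _)).
  by rewrite opprB opprK.
Qed.

(** The path from x to y that changes one coordinate at a time stays in the box
spanned by x and y, hence in the half-space and near x. *)
Definition hybrid x y (i : nat) : V := \row_c (if (c < i)%N then y 0 c else x 0 c).

Lemma hybridS x y c : hybrid x y c.+1 = hybrid x y c + (y 0 c - x 0 c) *: axis c.
Proof.
apply/rowP => d; rewrite !mxE /= ltnS leq_eqVlt.
have -> : (nat_of_ord d == c) = (d == c) by [].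
case: eqP => [->|_] /=; first by rewrite ltnn mulr1 addrC subrK.
by rewrite mulr0 addr0.
Qed.

(** Summing the mean value theorem over the edges of the path [hybrid]. This replaces
total differentiability, which at a boundary point would need a separate notion. *)
Lemma first_order_mvt f U x : ropen U -> CkU 1 U f -> U x ->
  \forall y \near x, HS y -> exists xi : 'I_n.+1 -> V,
    (forall c, HS (xi c) /\ forall d, `|xi c 0 d - x 0 d| <= `|y 0 d - x 0 d|) /\
    f y - f x = \sum_c D c f (xi c) * (y 0 c - x 0 c).
Proof.
move=> [UH Uo] Hf Ux; have /nbhs_rowP[e e0 He] := Uo x Ux.
apply/nbhs_rowP; exists e => // y Hy yH.
have xH : HS x by exact: UH.
pose pt c th := hybrid x y c + (th * (y 0 c - x 0 c)) *: axis c.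
have near_pt c th d : 0 <= th <= 1 -> `|pt c th 0 d - x 0 d| <= `|y 0 d - x 0 d|.
  move=> /andP[th0 th1]; rewrite !mxE /=; have [->|_] := eqVneq d c.
    rewrite ltnn mulr1 addrAC subrr add0r normrM ger0_norm //.
    by rewrite ler_piMl.
  by rewrite mulr0 addr0; case: ifP => // _; rewrite subrr normr0.
have pt_HS c th : 0 <= th <= 1 -> HS (pt c th).
  move=> /andP[th0 th1]; rewrite /halfspace /= !mxE.
  move: xH yH; rewrite /halfspace /= => x0 y0.
  have [<-|_] := eqVneq ord0 c.
    rewrite ?ltnn ?eqxx /= ?mulr1.
    have -> : x 0 ord0 + th * (y 0 ord0 - x 0 ord0) =
      (1 - th) * x 0 ord0 + th * y 0 ord0 by ring.
    by rewrite addr_ge0 // mulr_ge0 // subr_ge0.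
  by rewrite /= mulr0 addr0; case: ifP.
have pt_U c th : 0 <= th <= 1 -> U (pt c th).
  move=> H; apply: He (pt_HS c th H) => d.
  exact: le_lt_trans (near_pt c th d H) (Hy d).
have step c : exists xi, (HS xi /\ forall d, `|xi 0 d - x 0 d| <= `|y 0 d - x 0 d|) /\
    f (hybrid x y c.+1) - f (hybrid x y c) = D c f xi * (y 0 c - x 0 c).
  have [th Hth E] := Ck_mvt UH Hf (pt_U c).
  exists (pt c th); split; first by split; [exact: pt_HS|move=> d; exact: near_pt].
  by rewrite hybridS E.
have [xi Hxi] := choice step.
exists xi; split; first by move=> c; exact: (Hxi c).1.
rewrite -(eq_bigr _ (fun c _ => (Hxi c).2)).
rewrite -(big_mkord xpredT (fun i => f (hybrid x y i.+1) - f (hybrid x y i))).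
rewrite telescope_sumr //; congr (f _ - f _); apply/rowP => c; rewrite !mxE //.
by rewrite ltn_ord.
Qed.

Lemma cvg_bigsum (T I : Type) (F : set_system T) (FF : Filter F) (s : seq I)
    (P : pred I) (u : I -> T -> R) (l : I -> R) :
  (forall i, P i -> u i t @[t --> F] --> l i) ->
  \sum_(i <- s | P i) u i t @[t --> F] --> \sum_(i <- s | P i) l i.
Proof.
move=> H; elim: s => [|i s IH].
  under eq_fun do rewrite big_nil.
  by rewrite big_nil; exact: cvg_cst.
under eq_fun do rewrite big_cons.
rewrite big_cons; case Pi : (P i) => //.
exact: cvgD (H i Pi) IH.
Qed.

(** The filter and the increment w are arbitrary because the inner map moves the
argument in no coordinate direction: a partial derivative of a composite is a
limit along the admissible increments of the inner variable. *)
Lemma chain_rule (T : Type) (F : set_system T) (FF : Filter F) f U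
    (y : T -> V) (w : T -> R) y0 (l : 'I_n.+1 -> R) :
  ropen U -> CkU 1 U f -> U y0 ->
  y t @[t --> F] --> y0 -> (\forall t \near F, HS (y t)) ->
  (forall c, (w t)^-1 * (y t 0 c - y0 0 c) @[t --> F] --> l c) ->
  (w t)^-1 * (f (y t) - f y0) @[t --> F] --> \sum_c D c f y0 * l c.
Proof.
move=> Uo Hf Uy cy Hy dy.
pose good z (xi : 'I_n.+1 -> V) :=
  (forall c, HS (xi c) /\ forall d, `|xi c 0 d - y0 0 d| <= `|z 0 d - y0 0 d|) /\
    f z - f y0 = \sum_c D c f (xi c) * (z 0 c - y0 0 c).
have ex z : exists xi, (exists xi, good z xi) -> good z xi.
  case: (pselect (exists xi, good z xi)) => [[xi H]|H]; first by exists xi.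
  by exists (fun=> 0) => /H.
have [xi Hxi] := choice ex.
have H1 : \forall t \near F, good (y t) (xi (y t)).
  have := cy _ (first_order_mvt Uo Hf Uy); rewrite /fmap /= => H.
  near=> t; apply: Hxi.
  have yt : HS (y t) by near: t.
  move: yt; near: t; exact: H.
have cxi c : D c f (xi (y t) c) @[t --> F] --> D c f y0.
  have := Ck_cvg (Ck_partial c Hf) Uy; apply: cvg_trans => P.
  rewrite /fmap /= /within /= => HP.
  have /nbhs_rowP[e e0 He] : \forall z \near y0, HS z -> P (D c f z).
    by apply: filterS2 (Uo.2 _ Uy) HP => z /= h1 h2 h3; apply: h2 (h1 h3).
  have H2 : \forall t \near F, forall d, `|y t 0 d - y0 0 d| < e.
    by apply: (cy [set z | forall d, `|z 0 d - y0 0 d| < e]); apply/nbhs_rowP; exists e.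
  apply: filterS2 H1 H2 => t [Ht _] yt.
  apply: He (Ht c).1 => d; exact: le_lt_trans ((Ht c).2 d) (yt d).
have S : \sum_c D c f (xi (y t) c) * ((w t)^-1 * (y t 0 c - y0 0 c)) @[t --> F]
   --> \sum_c D c f y0 * l c.
  by apply: cvg_bigsum => c _; apply: cvgM.
apply: cvg_trans S; apply: near_eq_cvg; apply: filterS H1 => t [_ ->].
by rewrite mulr_sumr; apply: eq_bigr => c _; rewrite mulrCA.
Unshelve. all: by end_near.
Qed.

Lemma has_partial_comp U W f (Phi : V -> V) a x (l : 'I_n.+1 -> R) :
  ropen U -> CkU 1 U f -> ropen W -> W x -> (forall z, W z -> U (Phi z)) ->
  (forall c, has_partial a (fun z => Phi z 0 c) x (l c)) ->
  has_partial a (fun z => f (Phi z)) x (\sum_c D c f (Phi x) * l c).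
Proof.
move=> Uo Hf Wo Wx WU dPhi.
have Hin := steps_in a Wo Wx.
apply: (@chain_rule _ (steps a x) (steps_filter a x) f U
  (fun h => Phi (x + h *: axis a)) id (Phi x) l Uo Hf (WU x Wx)) => //.
- apply: cvg_row => c; exact: (has_partial_cvg (dPhi c)).
- by apply: filterS Hin => h /WU; exact: Uo.1.
Qed.

Lemma has_partial_shift a b f x h l : 0 <= h ->
  has_partial a f (x + h *: axis b) l ->
  has_partial a (fun z => f (z + h *: axis b)) x l.
Proof.
move=> h0 H; rewrite /has_partial.
under eq_fun do rewrite (addrAC x).
move=> P /H; rewrite /steps /fmap /= /within /= /nbhs /=.
apply: filterS => t HP Ht; apply: HP.
by rewrite addrAC; exact: halfspace_step.
Qed.

(** The classical double increment over a square with one corner at x. Only positive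
increments occur, so x may lie on the boundary. *)
Lemma square_increment f U a b x h : ropen U -> CkU 2 U f -> 0 < h ->
  (forall s t, 0 <= s <= h -> 0 <= t <= h -> U (x + s *: axis a + t *: axis b)) ->
  exists s t, [/\ 0 <= s <= h, 0 <= t <= h &
    f (x + h *: axis a + h *: axis b) - f (x + h *: axis a)
      - (f (x + h *: axis b) - f x)
    = D b (D a f) (x + s *: axis a + t *: axis b) * h ^+ 2].
Proof.
move=> Uo Hf h0 sq.
have h1 := ltW h0.
have hh : 0 <= h <= h by rewrite h1 lexx.
have h00 : 0 <= (0 : R) <= h by rewrite lexx.
have xH : HS x.
  by have := Uo.1 _ (sq 0 0 h00 h00); rewrite !scale0r !addr0.
have sq0 s : 0 <= s <= h -> U (x + s *: axis a).
  by move=> Hs; have := sq s 0 Hs h00; rewrite scale0r addr0.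
have [s Hs E1] := @line_mvt a (fun z => f (z + h *: axis b) - f z)
  (fun s => D a f (x + s *: axis a + h *: axis b) - D a f (x + s *: axis a))
  x h xH h1 (fun s Hs => has_partialD
    (has_partial_shift h1 (Ck_has_partial a (CkW Hf) (sq s h Hs hh)))
    (has_partialN (Ck_has_partial a (CkW Hf) (sq0 s Hs)))).
have [t Ht E2] := @line_mvt b (D a f)
  (fun t => D b (D a f) (x + s *: axis a + t *: axis b))
  (x + s *: axis a) h (Uo.1 _ (sq0 s Hs)) h1
  (fun t Ht => Ck_has_partial b (Ck_partial a Hf) (sq s t Hs Ht)).
by exists s, t; split=> //; rewrite E1 E2 expr2 mulrA.
Qed.

(** Both mixed derivatives are approximated by the same double increment over small
squares in the half-space; this is valid up to the boundary. *)
Lemma Ck_schwarz f U a b x : ropen U -> CkU 2 U f -> U x ->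
  D a (D b f) x = D b (D a f) x.
Proof.
move=> Uo Hf Ux.
have cont c d (e : R) : 0 < e -> exists2 r : R, 0 < r & forall z,
    (forall i, `|z 0 i - x 0 i| < r) -> HS z -> `|D c (D d f) x - D c (D d f) z| < e.
  move=> e0; have /cvgrPdist_lt/(_ e e0) := Ck_cvg (Ck_partial c (Ck_partial d Hf)) Ux.
  rewrite near_withinE => H.
  have /nbhs_rowP[r r0 Hr] : \forall z \near x, HS z -> `|D c (D d f) x - D c (D d f) z| < e.
    by apply: filterS2 (Uo.2 _ Ux) H => z h1 h2 h3; apply: h2 (h1 h3).
  by exists r.
apply/eqP; rewrite -subr_eq0 -normr_le0; apply/ler_addgt0Pr => e e0; rewrite add0r.
have e20 : 0 < e / 2 by rewrite divr_gt0.
have [r1 r10 H1] := cont a b _ e20.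
have [r2 r20 H2] := cont b a _ e20.
have /nbhs_rowP[r3 r30 H3] := Uo.2 _ Ux.
(* With this side the square lies within distance h + h of x in each coordinate,
   well inside the three neighborhoods. *)
pose h := Num.min r1 (Num.min r2 r3) / 4.
have hr : 0 < Num.min r1 (Num.min r2 r3) by rewrite !lt_min r10 r20.
have h0 : 0 < h by rewrite divr_gt0.
have small c d s t : 0 <= s <= h -> 0 <= t <= h -> forall i,
    `|(x + s *: axis c + t *: axis d) 0 i - x 0 i| < Num.min r1 (Num.min r2 r3).
  move=> Hs Ht i; rewrite !mxE /=.
  have b1 (k : bool) u : 0 <= u <= h -> 0 <= u * k%:R <= h.
    by case: k => /andP[u0 uh]; rewrite ?mulr1 ?mulr0 ?u0 ?uh ?lexx ?(ltW h0).
  have /andP[p0 p1] := b1 (i == c) s Hs; have /andP[q0 q1] := b1 (i == d) t Ht.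
  rewrite (_ : _ - _ = s * (i == c)%:R + t * (i == d)%:R); last by ring.
  rewrite ger0_norm; last exact: addr_ge0.
  by apply: le_lt_trans (lerD p1 q1) _; rewrite /h; lra.
have smallr c d s t k : k \in [:: r1; r2; r3] -> 0 <= s <= h -> 0 <= t <= h -> forall i,
    `|(x + s *: axis c + t *: axis d) 0 i - x 0 i| < k.
  move=> kr Hs Ht i; apply: lt_le_trans (small c d s t Hs Ht i) _.
  by move: kr; rewrite !inE => /or3P[] /eqP ->; rewrite !ge_min lexx ?orbT.
have inHS c d s t : 0 <= s <= h -> 0 <= t <= h -> HS (x + s *: axis c + t *: axis d).
  move=> /andP[s0 _] /andP[t0 _].
  by do 2! apply: halfspace_step => //; exact: Uo.1.
have inU c d s t : 0 <= s <= h -> 0 <= t <= h -> U (x + s *: axis c + t *: axis d).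
  move=> Hs Ht; apply: H3 (inHS c d s t Hs Ht) => i.
  by apply: smallr => //; rewrite !inE eqxx !orbT.
have [s [t [Hs Ht E1]]] := square_increment Uo Hf h0 (inU a b).
have [s' [t' [Hs' Ht' E2]]] := square_increment Uo Hf h0 (inU b a).
move: H1 H2 E1 E2; generalize (D a (D b f)) (D b (D a f)) => F G H1 H2 E1 E2.
have EE : G (x + s *: axis a + t *: axis b) =
  F (x + s' *: axis b + t' *: axis a).
  have hn : h ^+ 2 != 0 by rewrite expf_neq0 // gt_eqF.
  apply: (mulIf hn); rewrite -E1 -E2 (addrAC x (h *: axis b)); ring.
have K1 := H1 _ (smallr b a s' t' r1 _ Hs' Ht') (inHS b a s' t' Hs' Ht').
have K2 := H2 _ (smallr a b s t r2 _ Hs Ht) (inHS a b s t Hs Ht).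
have {}K1 := K1 _; have {}K2 := K2 _.
rewrite -(subrKA (F (x + s' *: axis b + t' *: axis a))).
apply: le_trans (ler_normD _ _) _; rewrite [e]splitr lerD //.
  by apply: ltW; apply: K1; rewrite !inE eqxx.
by rewrite -EE distrC; apply: ltW; apply: K2; rewrite !inE eqxx orbT.
Qed.

End MeanValue.

(** * Limits at the boundary *)

Section Boundary.
Context {R : realType} {n : nat}.
Local Notation V := 'rV[R]_n.+1.
Local Notation HS := (halfspace R n).
Local Notation D := (partial HS).
Local Notation axis a := (delta_mx 0 a : V).
Local Notation CkU k U := (Ck HS U k).
Implicit Types (U : set V) (f g : V -> R) (x y z : V) (a b c : 'I_n.+1).

(** Approach to a boundary point through the interior, along arbitrary directions;
normal approach alone would not control a function on a neighborhood. *)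
Definition inner_nbhs U x : set_system V := within [set z | U z /\ 0 < z 0 ord0] (nbhs x).

#[global] Instance inner_nbhs_filter U x : Filter (inner_nbhs U x).
Proof. exact: within_filter. Qed.

Lemma inner_nbhs_proper U x : ropen U -> U x -> ProperFilter (inner_nbhs U x).
Proof.
move=> Uo Ux; apply: Build_ProperFilter_ex => P HP.
have H1 : \forall h \near (0 : R)^'+, 0 < h /\ U (x + h *: axis ord0).
  have H0 := at_right_steps (Uo.1 _ Ux) (steps_in ord0 Uo Ux).
  by apply: filterS2 H0 (nbhs_right_gt 0) => h.
have H2 : \forall h \near (0 : R)^'+, U (x + h *: axis ord0) /\ 0 < (x + h *: axis ord0) 0 ord0
     -> P (x + h *: axis ord0).
  apply: (at_right_steps (Uo.1 _ Ux)); exact: (@step_cvg _ _ ord0 x _ HP).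
have /filter_ex [h Ph] : \forall h \near (0 : R)^'+, P (x + h *: axis ord0).
  apply: filterS2 H1 H2 => h [h0 Uh]; apply; split=> //.
  rewrite !mxE !eqxx mulr1; apply: ltr_wpDl => //.
  exact: Uo.1.
by exists (x + h *: axis ord0).
Qed.

Lemma inner_nbhs_in U x : \forall z \near inner_nbhs U x, U z /\ 0 < z 0 ord0.
Proof. exact: withinT. Qed.

Lemma inner_nbhs_cvg k U f x : CkU k U f -> U x -> f z @[z --> inner_nbhs U x] --> f x.
Proof.
move=> Hf Ux; apply: cvg_trans (Ck_cvg Hf Ux) => P H.
have {}H : \forall z \near x, U z -> P (f z) by exact: H.
suff K : \forall z \near x, U z /\ 0 < z 0 ord0 -> P (f z) by exact: K.
by apply: filterS H => z Hz [Uz _]; exact: Hz.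
Qed.

(** By the mean value theorem along the normal line through z, the quotient is a
normal derivative at a point closer to the boundary than z. This is the
C^1 version of dividing f by the boundary coordinate. *)
Lemma bdry_slope U f x : ropen U -> CkU 1 U f -> U x -> x 0 ord0 = 0 ->
  (forall z, U z -> z 0 ord0 = 0 -> f z = 0) ->
  f z / z 0 ord0 @[z --> inner_nbhs U x] --> D ord0 f x.
Proof.
move=> Uo Hf Ux x0 f0 P.
move=> HP.
have H : \forall z \near x, U z -> P (D ord0 f z).
  exact: (Ck_cvg (Ck_partial ord0 Hf) Ux HP).
have {H} : \forall z \near x, HS z -> U z /\ P (D ord0 f z).
  by apply: filterS2 (Uo.2 _ Ux) H => z /= h1 h2 h3; split; [exact: h1|exact: h2 (h1 h3)].
move=> /nbhs_rowP[e e0 He].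
rewrite /fmap /= /inner_nbhs /within /=; apply/nbhs_rowP; exists e => // z Hz [Uz z0].
have pt s : 0 <= s <= z 0 ord0 -> U (z - z 0 ord0 *: axis ord0 + s *: axis ord0) /\
     P (D ord0 f (z - z 0 ord0 *: axis ord0 + s *: axis ord0)).
  move=> /andP[s0 sz]; apply: He => [c|].
    rewrite !mxE /=; have [->|_] := eqVneq c ord0.
      rewrite !mulr1 subrr add0r x0 subr0 ger0_norm //.
      by apply: le_lt_trans sz _; have := Hz ord0; rewrite x0 subr0 gtr0_norm.
    by rewrite !mulr0 subr0 addr0; exact: Hz.
  by rewrite /halfspace /= !mxE /= !mulr1 subrr add0r.
have [s Hs] : exists2 s, 0 <= s <= z 0 ord0 &
    f (z - z 0 ord0 *: axis ord0 + z 0 ord0 *: axis ord0) - f (z - z 0 ord0 *: axis ord0)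
    = D ord0 f (z - z 0 ord0 *: axis ord0 + s *: axis ord0) * z 0 ord0.
  have h0 : 0 <= (0 : R) <= z 0 ord0 by rewrite lexx ltW.
  apply: (line_mvt (df := fun s => D ord0 f (z - z 0 ord0 *: axis ord0 + s *: axis ord0))).
  - by have [/Uo.1] := pt 0 h0; rewrite scale0r addr0.
  - exact: ltW.
  - move=> s Hs; apply: (Ck_has_partial ord0 Hf); exact: (pt s Hs).1.
rewrite subrK (f0 (z - _)); first last.
- by rewrite !mxE /= mulr1 subrr.
- have h0 : 0 <= (0 : R) <= z 0 ord0 by rewrite lexx ltW.
  by have [] := pt 0 h0; rewrite scale0r addr0.
rewrite subr0 => E; change (P (f z / z 0 ord0)); rewrite E mulfK ?gt_eqF //; exact: (pt s Hs).2.
Qed.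

Lemma bdry_quotient U f g x : ropen U -> CkU 1 U f -> CkU 1 U g -> U x -> x 0 ord0 = 0 ->
  (forall z, U z -> z 0 ord0 = 0 -> f z = 0) ->
  (forall z, U z -> z 0 ord0 = 0 -> g z = 0) -> D ord0 g x != 0 ->
  f z / g z @[z --> inner_nbhs U x] --> D ord0 f x / D ord0 g x.
Proof.
move=> Uo Hf Hg Ux x0 f0 g0 dg0.
pose proof (cvgM (bdry_slope Uo Hf Ux x0 f0) (cvgV dg0 (bdry_slope Uo Hg Ux x0 g0))) as K.
apply: cvg_trans K; apply: near_eq_cvg; apply: filterS (inner_nbhs_in U x) => z [Uz z0].
by rewrite /= invf_div mulrA divfK ?gt_eqF.
Qed.

(** Increments in tangential directions do not leave the boundary, so the derivative
depends only on the boundary values. *)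
Lemma has_partial_tangential U f g x l (a : 'I_n) : ropen U -> U x -> x 0 ord0 = 0 ->
  (forall z, U z -> z 0 ord0 = 0 -> f z = g z) ->
  has_partial (lift ord0 a) f x l -> has_partial (lift ord0 a) g x l.
Proof.
move=> Uo Ux x0 fg; apply: cvg_trans; apply: near_eq_cvg.
apply: filterS (steps_in (lift ord0 a) Uo Ux) => h Uh /=.
rewrite fg //; last by rewrite !mxE /= mulr0 addr0.
by rewrite (fg x).
Qed.

Lemma partial_tangential0 U f x (a : 'I_n) : ropen U -> U x -> x 0 ord0 = 0 ->
  (forall z, U z -> z 0 ord0 = 0 -> f z = 0) -> D (lift ord0 a) f x = 0.
Proof.
move=> Uo Ux x0 f0; apply: has_partialE; first exact: Uo.1.
apply: (@has_partial_tangential U (fun=> 0)) => //; first by move=> z Uz z0; rewrite f0.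
exact: has_partial_cst.
Qed.

Lemma hpt_step (t h : R) (y : 'rV[R]_n) (a : 'I_n) :
  hpt t (y + h *: delta_mx 0 a) = hpt t y + h *: axis (lift ord0 a).
Proof.
apply/rowP => c; rewrite !mxE; case: unliftP => [b ->|->] /=.
  by rewrite !mxE (inj_eq lift_inj).
by rewrite mulr0 addr0.
Qed.

Lemma hptE0 (t : R) (y : 'rV[R]_n) : hpt t y 0 ord0 = t.
Proof. by rewrite mxE unlift_none. Qed.

Lemma hptE (t : R) (y : 'rV[R]_n) (a : 'I_n) : hpt t y 0 (lift ord0 a) = y 0 a.
Proof. by rewrite mxE liftK. Qed.

Lemma col'_hpt (t : R) (y : 'rV[R]_n) : col' ord0 (hpt t y) = y.
Proof. by apply/rowP => c; rewrite mxE hptE. Qed.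

Lemma hpt_col' x : hpt (x 0 ord0) (col' ord0 x) = x.
Proof.
apply/rowP => c; rewrite !mxE; case: unliftP => [b ->|-> //]; by rewrite mxE.
Qed.

Lemma partial_hpt (f : V -> R) (a : 'I_n) (y : 'rV[R]_n) :
  partial [set: 'rV[R]_n] a (fun z : 'rV[R]_n => f (hpt 0 z)) y = D (lift ord0 a) f (hpt 0 y).
Proof.
have E : [set h | [set: 'rV[R]_n] (y + h *: delta_mx 0 a)] =
    [set h | HS (hpt 0 y + h *: axis (lift ord0 a))].
  apply/seteqP; split=> h _ //=.
  by rewrite /halfspace /= mxE hptE0 !mxE /= mulr0 addr0.
rewrite /partial /pquot E; congr (lim _).
by under eq_fun do rewrite hpt_step.
Qed.

End Boundary.

(** * The Levi-Civita connection as a matrix-valued form *)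

Section Entries.
Context {R : pzRingType}.

Lemma addmx_ij p q (M N : 'M[R]_(p, q)) i j : (M + N) i j = M i j + N i j.
Proof. by rewrite mxE. Qed.

Lemma oppmx_ij p q (M : 'M[R]_(p, q)) i j : (- M) i j = - M i j.
Proof. by rewrite mxE. Qed.

Lemma scalemx_ij p q (c : R) (M : 'M[R]_(p, q)) i j : (c *: M) i j = c * M i j.
Proof. by rewrite mxE. Qed.

Lemma mulmx_ij p q s (M : 'M[R]_(p, q)) (N : 'M[R]_(q, s)) i j :
  (M *m N) i j = \sum_l M i l * N l j.
Proof. by rewrite mxE. Qed.

Lemma trmx_ij p q (M : 'M[R]_(p, q)) i j : M^T i j = M j i.
Proof. by rewrite mxE. Qed.

End Entries.

(** The nested limits behind a second derivative or a curvature are costly to compare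
by unfolding: this operator and the ones built on it are locked. *)
HB.lock Definition dmx (R : realType) (k : nat) (S : set 'rV[R]_k) p q (a : 'I_k)
    (M : 'rV[R]_k -> 'M[R]_(p, q)) (x : 'rV[R]_k) : 'M[R]_(p, q) :=
  \matrix_(i, j) partial S a (fun z => M z i j) x.

(** Matrices act on row vectors from the right: row b of [conn S g x a] holds the
components of the covariant derivative of e_b along e_a. Metric compatibility is
then A g + g A^T = dg. *)
HB.lock Definition conn (R : realType) (k : nat) (S : set 'rV[R]_k)
    (g : 'rV[R]_k -> 'M[R]_k) (x : 'rV[R]_k) (a : 'I_k) : 'M[R]_k :=
  \matrix_(b, c) christoffel S g x c a b.

(** The curvature form dA - A /\ A for matrices acting on rows, which reverses the
order of the products: row c of [curv S g x a b] is R(e_a, e_b) e_c. *)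
HB.lock Definition curv (R : realType) (k : nat) (S : set 'rV[R]_k)
    (g : 'rV[R]_k -> 'M[R]_k) (x : 'rV[R]_k) (a b : 'I_k) : 'M[R]_k :=
  dmx S a (fun z => conn S g z b) x - dmx S b (fun z => conn S g z a) x
  + (conn S g x b *m conn S g x a - conn S g x a *m conn S g x b).

Section LeviCivita.
Context {R : realType} {k : nat}.
Implicit Types (S : set 'rV[R]_k) (g : 'rV[R]_k -> 'M[R]_k) (x : 'rV[R]_k).

Lemma dmxE S p q a (M : 'rV[R]_k -> 'M[R]_(p, q)) x i j :
  dmx S a M x i j = partial S a (fun z => M z i j) x.
Proof. by rewrite dmx.unlock mxE. Qed.

Lemma connE S g x a b c : conn S g x a b c = christoffel S g x c a b.
Proof. by rewrite conn.unlock mxE. Qed.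

Lemma riemannE S g x d c a b : riemann S g x d c a b = curv S g x a b c d.
Proof.
rewrite /riemann curv.unlock !(addmx_ij, oppmx_ij, mulmx_ij, dmxE); congr (_ - _ + _).
- by congr partial; apply/funext => z; rewrite connE.
- by congr partial; apply/funext => z; rewrite connE.
- rewrite -sumrB; apply: eq_bigr => e _; rewrite !connE; ring.
Qed.

Lemma ricciE S g x b c : ricci S g x b c = \sum_a curv S g x a b c a.
Proof. by rewrite mxE; apply: eq_bigr => a _; exact: riemannE. Qed.

Lemma sym_entry (M : 'M[R]_k) i j : M^T = M -> M i j = M j i.
Proof. by move=> E; rewrite -{1}E mxE. Qed.

Lemma invmx_sym (M : 'M[R]_k) : M^T = M -> (invmx M)^T = invmx M.
Proof. by move=> E; rewrite trmx_inv E. Qed.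

Section AtPoint.
Variables (S : set 'rV[R]_k) (g : 'rV[R]_k -> 'M[R]_k) (x : 'rV[R]_k).
Hypothesis gS : (g x)^T = g x.
Hypothesis gU : g x \in unitmx.

(** The Koszul formula. It identifies a connection without computing Christoffel
symbols, and is used for coordinate changes, for conformal changes and for the
connection induced on the boundary. *)
Lemma conn_unique (A : 'I_k -> 'M[R]_k) :
  (forall a b c, A a b c = A b a c) ->
  (forall a, A a *m g x + g x *m (A a)^T = dmx S a g x) ->
  forall a, A a = conn S g x a.
Proof.
move=> As Ac a; apply/matrixP => b c; rewrite connE /christoffel.
pose L a b d := (A a *m g x) b d.
have LS a' b' d : L a' b' d = L b' a' d.
  by rewrite /L !mxE; apply: eq_bigr => e _; rewrite As.
have dE a' b' d : partial S a' (fun z => g z b' d) x = L a' b' d + L a' d b'.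
  have := congr1 (fun M : 'M[R]_k => M b' d) (Ac a'); rewrite !(addmx_ij, dmxE) => <-; congr (_ + _).
  by rewrite /L !mulmx_ij; apply: eq_bigr => e _; rewrite trmx_ij mulrC (sym_entry e b' gS).
under eq_bigr => d _.
  rewrite !dE (LS b a d) (LS a d b) (LS b d a).
  rewrite (_ : _ - _ = 2 * L a b d); last by ring.
  rewrite mulrCA; over.
rewrite -mulr_sumr mulrA mulVf ?mul1r ?pnatr_eq0 //.
have -> : A a b c = (A a *m g x *m invmx (g x)) b c by rewrite mulmxK.
rewrite mxE; apply: eq_bigr => d _.
by rewrite mulrC (sym_entry c d (invmx_sym gS)).
Qed.

Hypothesis dgS : forall a, (dmx S a g x)^T = dmx S a g x.

Lemma conn_sym a b c : conn S g x a b c = conn S g x b a c.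
Proof.
rewrite !connE /christoffel; congr (_ * _); apply: eq_bigr => d _; congr (_ * _).
have := sym_entry a b (dgS d); rewrite !dmxE => ->; ring.
Qed.

Lemma conn_compat a : conn S g x a *m g x + g x *m (conn S g x a)^T = dmx S a g x.
Proof.
have lower a' b d : (conn S g x a' *m g x) b d = 2^-1 *
    (dmx S a' g x b d + dmx S b g x a' d - dmx S d g x a' b).
  rewrite mxE.
  pose w e := dmx S a' g x b e + dmx S b g x a' e - dmx S e g x a' b.
  under eq_bigr => c _.
    rewrite connE /christoffel -mulrA mulr_suml.
    under eq_bigr => e _.
      rewrite (_ : _ - _ = w e); last by rewrite /w !dmxE.
      rewrite mulrAC (sym_entry c e (invmx_sym gS)); over.
    over.
  rewrite -mulr_sumr; congr (_ * _); rewrite exchange_big /=.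
  under eq_bigr => e _ do rewrite -mulr_suml.
  rewrite (bigD1 d) //= [X in _ + X]big1 ?addr0 => [|e ed].
    have := congr1 (fun M : 'M[R]_k => M d d) (mulVmx gU).
    by rewrite !mxE eqxx => ->; rewrite mul1r /w.
  have := congr1 (fun M : 'M[R]_k => M e d) (mulVmx gU).
  by rewrite !mxE (negbTE ed) => ->; rewrite mul0r.
apply/matrixP => b d; rewrite addmx_ij lower.
have -> : (g x *m (conn S g x a)^T) b d = (conn S g x a *m g x) d b.
  rewrite !mulmx_ij; apply: eq_bigr => e _; rewrite trmx_ij mulrC (sym_entry b e gS) //.
rewrite lower (sym_entry d b (dgS a)).
rewrite -mulrDr (_ : _ + _ = 2 * dmx S a g x b d); last by ring.
by rewrite mulrA mulVf ?mul1r ?pnatr_eq0.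
Qed.

End AtPoint.
End LeviCivita.

(** Proves identities that are additive in the matrix products: each product is
made opaque and the identity is checked entrywise. *)
Ltac mx_abel :=
  repeat match goal with
  | |- context [@mulmx ?R ?m ?n ?p ?A ?B] =>
      let x := fresh in set x := (@mulmx R m n p A B); clearbody x
  end;
  apply/matrixP => ? ?; rewrite !(addmx_ij, oppmx_ij, trmx_ij, scalemx_ij); ring.

(** The algebra of [curv_antisym]: P and Q stand for derivatives of the connection,
A and B for the connection itself; the hypothesis is the symmetry of the second
derivatives of g. *)
Lemma antisym_algebra (R : comNzRingType) k (P Q A B g : 'M[R]_k) :
  P *m g + A *m (B *m g + g *m B^T) + ((B *m g + g *m B^T) *m A^T + g *m P^T) =
  Q *m g + B *m (A *m g + g *m A^T) + ((A *m g + g *m A^T) *m B^T + g *m Q^T) ->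
  (P - Q + (A *m B - B *m A)) *m g + g *m (P - Q + (A *m B - B *m A))^T = 0.
Proof.
have -> : (P - Q + (A *m B - B *m A))^T = P^T - Q^T + (B^T *m A^T - A^T *m B^T).
  by rewrite -!trmx_mul; move: (A *m B) (B *m A) => X Y; apply/matrixP => i j; rewrite !mxE.
rewrite !(mulmxDl, mulmxDr, mulNmx, mulmxN, mulmxA).
move=> /eqP; rewrite -subr_eq0 => /eqP <-.
mx_abel.
Qed.

(** * Calculus of matrix-valued functions *)

Section MatrixCalculus.
Context {R : realType} {n : nat}.
Local Notation V := 'rV[R]_n.+1.
Local Notation HS := (halfspace R n).
Local Notation D := (partial HS).
Local Notation dm := (dmx HS).
Implicit Types (U : set V) (x : V) (a b c : 'I_n.+1).

Definition Ck_mx k U p q (M : V -> 'M[R]_(p, q)) :=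
  forall i j, Ck HS U k (fun z => M z i j).

Lemma Ck_mxW k U p q (M : V -> 'M[R]_(p, q)) : Ck_mx k.+1 U M -> Ck_mx k U M.
Proof. by move=> H i j; exact: CkW. Qed.

Lemma Ck_mx_leq j k U p q (M : V -> 'M[R]_(p, q)) : (j <= k)%N -> Ck_mx k U M -> Ck_mx j U M.
Proof. by move=> jk H i l; exact: Ck_leq jk (H i l). Qed.

Lemma eq_Ck_mx k U p q (M N : V -> 'M[R]_(p, q)) : ropen U ->
  (forall z, U z -> M z = N z) -> Ck_mx k U M -> Ck_mx k U N.
Proof. by move=> Uo MN H i j; apply: (eq_Ck Uo _ (H i j)) => z Uz; rewrite MN. Qed.

Lemma Ck_mx_mul k U p q s (M : V -> 'M[R]_(p, q)) (N : V -> 'M[R]_(q, s)) : ropen U ->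
  Ck_mx k U M -> Ck_mx k U N -> Ck_mx k U (fun z => M z *m N z).
Proof.
move=> Uo HM HN i j; under eq_fun do rewrite mxE.
by apply: Ck_sum => // l _; apply: CkM => //.
Qed.

Lemma Ck_mx_tr k U p q (M : V -> 'M[R]_(p, q)) : Ck_mx k U M -> Ck_mx k U (fun z => (M z)^T).
Proof. by move=> H i j; under eq_fun do rewrite mxE; exact: H. Qed.

Lemma Ck_det k U p (M : V -> 'M[R]_p) : ropen U ->
  Ck_mx k U M -> Ck HS U k (fun z => \det (M z)).
Proof.
move=> Uo HM; apply: Ck_sum => // s _; apply: CkM => //; first exact: Ck_cst.
by apply: Ck_prod => // i _.
Qed.

Lemma Ck_mx_inv k U p (M : V -> 'M[R]_p) : ropen U -> (forall z, U z -> M z \in unitmx) ->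
  Ck_mx k U M -> Ck_mx k U (fun z => invmx (M z)).
Proof.
move=> Uo MU HM i j.
apply: (eq_Ck Uo (f := fun z => (\det (M z))^-1 * cofactor (M z) j i)).
  by move=> z Uz; rewrite /invmx MU // !mxE.
apply: CkM => //.
  by apply: CkV => // [z /MU|]; [rewrite unitmxE unitfE|exact: Ck_det].
rewrite /cofactor; apply: CkM => //; first exact: Ck_cst.
apply: Ck_det => // i' j'; under eq_fun do rewrite !mxE; exact: HM.
Qed.

Lemma Ck_mx_dmx k U p q a (M : V -> 'M[R]_(p, q)) : Ck_mx k.+1 U M -> Ck_mx k U (dm a M).
Proof. move=> H; by move=> i j; under eq_fun do rewrite dmxE; exact: Ck_partial. Qed.

Lemma eq_dmx U p q a (M N : V -> 'M[R]_(p, q)) x : ropen U -> U x ->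
  (forall z, U z -> M z = N z) -> Ck_mx 1 U M -> dm a M x = dm a N x.
Proof.
move=> Uo Ux MN HM; apply/matrixP => i j; rewrite !dmxE.
apply: (eq_partial Uo Ux (g := fun z => N z i j)) => [z Uz|]; first by rewrite MN.
exact: (has_partial_diff (Ck_has_partial a (HM i j) Ux)).
Qed.

Lemma dmxM U p q s a (M : V -> 'M[R]_(p, q)) (N : V -> 'M[R]_(q, s)) x : ropen U -> U x ->
  Ck_mx 1 U M -> Ck_mx 1 U N ->
  dm a (fun z => M z *m N z) x = dm a M x *m N x + M x *m dm a N x.
Proof.
move=> Uo Ux HM HN; apply/matrixP => i j; rewrite addmx_ij !mulmx_ij dmxE.
under eq_fun do rewrite mulmx_ij.
rewrite -big_split /=; apply: has_partialE; first exact: Uo.1.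
apply: has_partial_sum => l _; rewrite !dmxE.
by apply: has_partialM; [exact: Ck_has_partial (HM i l) Ux|exact: Ck_has_partial (HN l j) Ux].
Qed.

Lemma dmxD U p q a (M N : V -> 'M[R]_(p, q)) x : ropen U -> U x ->
  Ck_mx 1 U M -> Ck_mx 1 U N ->
  dm a (fun z => M z + N z) x = dm a M x + dm a N x.
Proof.
move=> Uo Ux HM HN; apply/matrixP => i j; rewrite addmx_ij !dmxE.
under eq_fun do rewrite addmx_ij.
apply: has_partialE; first exact: Uo.1.
by apply: has_partialD; [exact: Ck_has_partial (HM i j) Ux|exact: Ck_has_partial (HN i j) Ux].
Qed.

Lemma dmxZ U p q a (f : V -> R) (M : V -> 'M[R]_(p, q)) x : ropen U -> U x ->
  Ck HS U 1 f -> Ck_mx 1 U M ->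
  dm a (fun z => f z *: M z) x = D a f x *: M x + f x *: dm a M x.
Proof.
move=> Uo Ux Hf HM; apply/matrixP => i j; rewrite addmx_ij !scalemx_ij !dmxE.
under eq_fun do rewrite scalemx_ij.
apply: has_partialE; first exact: Uo.1.
by apply: has_partialM; [exact: Ck_has_partial Hf Ux|exact: Ck_has_partial (HM i j) Ux].
Qed.

Lemma dmx_sum U (I : finType) p q a (M : I -> V -> 'M[R]_(p, q)) x : ropen U -> U x ->
  (forall l, Ck_mx 1 U (M l)) ->
  dm a (fun z => \sum_l M l z) x = \sum_l dm a (M l) x.
Proof.
move=> Uo Ux HM; apply/matrixP => i j; rewrite dmxE summxE.
under eq_fun do rewrite summxE.
apply: has_partialE; first exact: Uo.1.
apply: has_partial_sum => l _; rewrite dmxE.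
exact: Ck_has_partial (HM l i j) Ux.
Qed.

Lemma Ck_mx_scale k U p q (f : V -> R) (M : V -> 'M[R]_(p, q)) : ropen U ->
  Ck HS U k f -> Ck_mx k U M -> Ck_mx k U (fun z => f z *: M z).
Proof. by move=> Uo Hf HM i j; under eq_fun do rewrite scalemx_ij; exact: CkM. Qed.

Lemma Ck_mx_add k U p q (M N : V -> 'M[R]_(p, q)) : ropen U ->
  Ck_mx k U M -> Ck_mx k U N -> Ck_mx k U (fun z => M z + N z).
Proof. by move=> Uo HM HN i j; under eq_fun do rewrite addmx_ij; exact: CkD. Qed.

Lemma Ck_mx_sum k U (I : finType) p q (M : I -> V -> 'M[R]_(p, q)) : ropen U ->
  (forall l, Ck_mx k U (M l)) -> Ck_mx k U (fun z => \sum_l M l z).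
Proof. by move=> Uo HM i j; under eq_fun do rewrite summxE; apply: Ck_sum => // l _; exact: HM. Qed.

Lemma dmx_tr p q a (M : V -> 'M[R]_(p, q)) x : dm a (fun z => (M z)^T) x = (dm a M x)^T.
Proof.
by apply/matrixP => i j; rewrite trmx_ij !dmxE; congr partial; apply/funext => z; rewrite trmx_ij.
Qed.

Lemma dmx_schwarz U p q a b (M : V -> 'M[R]_(p, q)) x : ropen U -> U x -> Ck_mx 2 U M ->
  dm a (dm b M) x = dm b (dm a M) x.
Proof.
move=> Uo Ux HM; apply/matrixP => i j; rewrite !dmxE.
have E c : (fun z => dm c M z i j) = D c (fun z => M z i j).
  by apply/funext => z; rewrite dmxE.
by rewrite !E (Ck_schwarz _ _ Uo (HM i j) Ux).
Qed.

Lemma dmx_comp U W p q a (M : V -> 'M[R]_(p, q)) (Phi : V -> V) x :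
  ropen U -> ropen W -> W x -> (forall z, W z -> U (Phi z)) -> Ck_mx 1 U M ->
  (forall c, Ck HS W 1 (fun z => Phi z 0 c)) ->
  dm a (fun z => M (Phi z)) x = \sum_c D a (fun z => Phi z 0 c) x *: dm c M (Phi x).
Proof.
move=> Uo Wo Wx WU HM HPhi; apply/matrixP => i j; rewrite dmxE.
apply: has_partialE; first exact: Wo.1.
rewrite summxE; under eq_bigr => c _ do rewrite scalemx_ij dmxE mulrC.
apply: (has_partial_comp Uo (HM i j) Wo Wx WU) => c; exact: Ck_has_partial (HPhi c) Wx.
Qed.

Lemma continuous_comp_within U W (Phi : V -> V) (f : V -> R) : ropen U ->
  (forall x, W x -> U (Phi x)) -> (forall c, Ck HS W 1 (fun z => Phi z 0 c)) ->
  Ck HS U 0 f -> Ck HS W 0 (fun w => f (Phi w)).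
Proof.
move=> Uo WU PhiC Hf; split=> //; apply/subspace_continuousP => x Wx P HP.
have K : \forall y \near Phi x, HS y -> P (f y).
  have K : \forall y \near Phi x, U y -> P (f y) by exact: (Ck_cvg Hf (WU x Wx) HP).
  by apply: filterS2 (Uo.2 _ (WU x Wx)) K => z h1 h2 h3; exact: h2 (h1 h3).
have cphi : Phi z @[z --> within W (nbhs x)] --> Phi x.
  by apply: cvg_row => c; exact: Ck_cvg (PhiC c) Wx.
have K1 : \forall z \near within W (nbhs x), HS (Phi z) -> P (f (Phi z)) := cphi _ K.
have K2 : \forall z \near within W (nbhs x), W z by exact: withinT.
have K3 : \forall z \near within W (nbhs x), P (f (Phi z)).
  by apply: filterS2 K1 K2 => z h1 /WU/Uo.1.
exact: K3.
Qed.

Lemma Ck_mx_comp U W p q (M : V -> 'M[R]_(p, q)) (Phi : V -> V) :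
  ropen U -> ropen W -> (forall x, W x -> U (Phi x)) -> Ck_mx 1 U M ->
  (forall c, Ck HS W 1 (fun z => Phi z 0 c)) -> Ck_mx 1 W (fun w => M (Phi w)).
Proof.
move=> Uo Wo WU HM PhiC i j.
apply: (Ck_intro (df := fun a z =>
  \sum_c D a (fun w => Phi w 0 c) z * D c (fun w => M w i j) (Phi z)) Wo).
- exact: (continuous_comp_within Uo WU PhiC (CkW (HM i j))).1.
- move=> a x Wx; under eq_bigr => c _ do rewrite mulrC.
  apply: (has_partial_comp Uo (HM i j) Wo Wx WU) => c; exact: Ck_has_partial (PhiC c) Wx.
- move=> a; apply: Ck_sum => // c _; apply: CkM => //; first exact: Ck_partial.
  by apply: (continuous_comp_within Uo WU PhiC); exact: Ck_partial.
Qed.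

Section Metric.
Variables (U : set V) (g : V -> 'M[R]_n.+1).
Hypothesis Uo : ropen U.
Hypothesis gS : forall z, U z -> (g z)^T = g z.
Hypothesis gU : forall z, U z -> g z \in unitmx.
Local Notation A := (conn HS g).
Local Notation F := (curv HS g).

Lemma conn_Ck k : Ck_mx k.+1 U g -> forall a, Ck_mx k U (fun z => A z a).
Proof.
move=> Hg a b c; under eq_fun do rewrite connE /christoffel.
apply: CkM => //; first exact: Ck_cst.
apply: Ck_sum => // d _; apply: CkM => //; first exact: (Ck_mx_inv Uo gU (Ck_mxW Hg)).
by apply: CkB => //; first apply: CkD => //; exact: Ck_partial.
Qed.

Lemma dmx_metric_sym a x : U x -> Ck_mx 1 U g -> (dm a g x)^T = dm a g x.
Proof.
move=> Ux Hg; rewrite -dmx_tr; apply/esym/(eq_dmx _ Uo Ux) => // z Uz.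
by rewrite gS.
Qed.

Lemma connC a b c x : U x -> Ck_mx 1 U g -> A x a b c = A x b a c.
Proof. by move=> Ux Hg; apply: conn_sym => d; exact: dmx_metric_sym. Qed.

Lemma conn_metric a x : U x -> Ck_mx 1 U g -> A x a *m g x + g x *m (A x a)^T = dm a g x.
Proof.
move=> Ux Hg; apply: conn_compat => [||b]; [exact: gS|exact: gU|exact: dmx_metric_sym].
Qed.

(** Differentiate A g + g A^T = dg once more and use the symmetry of second
derivatives of g. *)
Lemma curv_antisym a b x : U x -> Ck_mx 2 U g -> F x a b *m g x + g x *m (F x a b)^T = 0.
Proof.
move=> Ux Hg; have Hg1 := Ck_mxW Hg; have HA := conn_Ck Hg.
have E c d : dm d (dm c g) x = dm d (fun z => A z c) x *m g x + A x c *m dm d g x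
    + (dm d g x *m (A x c)^T + g x *m (dm d (fun z => A z c) x)^T).
  rewrite -dmx_tr.
  rewrite -(dmxM d Uo Ux (HA c) Hg1) -(dmxM d Uo Ux Hg1 (Ck_mx_tr (HA c))).
  have C1 := Ck_mx_mul Uo (HA c) Hg1; have C2 := Ck_mx_mul Uo Hg1 (Ck_mx_tr (HA c)).
  rewrite -(dmxD d Uo Ux C1 C2); apply: (eq_dmx d Uo Ux).
    by move=> z Uz; rewrite conn_metric.
  exact: Ck_mx_dmx.
have := dmx_schwarz a b Uo Ux Hg; rewrite (E b a) (E a b) -(conn_metric a Ux Hg1).
rewrite -(conn_metric b Ux Hg1) curv.unlock; exact: antisym_algebra.
Qed.

End Metric.
End MatrixCalculus.

HB.lock Definition jac (R : realType) (n : nat) (phi : 'rV[R]_n.+1 -> 'rV[R]_n.+1)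
    (z : 'rV[R]_n.+1) : 'M[R]_n.+1 :=
  \matrix_(a, c) partial (halfspace R n) a (fun w => phi w 0 c) z.

Lemma jacE (R : realType) (n : nat) (phi : 'rV[R]_n.+1 -> 'rV[R]_n.+1) z a c :
  jac phi z a c = partial (halfspace R n) a (fun w => phi w 0 c) z.
Proof. by rewrite jac.unlock mxE. Qed.

(** * Invariance of scalar curvature under changes of coordinates *)

Section Invariance.
Context {R : realType} {n : nat}.
Local Notation V := 'rV[R]_n.+1.
Local Notation HS := (halfspace R n).
Local Notation D := (partial HS).
Local Notation dm := (dmx HS).
Variables (U U' : set V) (phi : V -> V) (g g' : V -> 'M[R]_n.+1).
Local Notation J := (jac phi).
Hypotheses (Uo : ropen U) (Uo' : ropen U').
Hypothesis phiU : forall z, U z -> U' (phi z).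
Hypothesis phiC : forall c, Ck HS U 3 (fun z => phi z 0 c).
Hypotheses (gC : Ck_mx 2 U g) (gC' : Ck_mx 2 U' g').
Hypotheses (gS : forall z, U z -> (g z)^T = g z) (gU : forall z, U z -> g z \in unitmx).
Hypotheses (gS' : forall z, U' z -> (g' z)^T = g' z) (gU' : forall z, U' z -> g' z \in unitmx).
Hypothesis gE : forall z, U z -> g z = J z *m g' (phi z) *m (J z)^T.

Local Notation A := (conn HS g).
Local Notation A' := (conn HS g').
Let pulled z a : 'M[R]_n.+1 := \sum_c J z a c *: A' (phi z) c.

Let phiC1 c : Ck HS U 1 (fun z => phi z 0 c).
Proof. exact: Ck_leq (phiC c). Qed.

Let JC : Ck_mx 2 U J.
Proof. by move=> a c; under eq_fun do rewrite jacE; exact: Ck_partial. Qed.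

Let JU z : U z -> J z \in unitmx.
Proof. by move=> Uz; move: (gU Uz); rewrite gE // !unitmx_mul => /andP[/andP[]]. Qed.

Let dm_comp a p q (M : V -> 'M[R]_(p, q)) z : U z -> Ck_mx 1 U' M ->
  dm a (fun w => M (phi w)) z = \sum_c J z a c *: dm c M (phi z).
Proof.
move=> Uz HM; rewrite (dmx_comp _ Uo' Uo Uz phiU HM phiC1).
by apply: eq_bigr => c _; rewrite jacE.
Qed.

Let comp_C1 p q (M : V -> 'M[R]_(p, q)) : Ck_mx 1 U' M -> Ck_mx 1 U (fun w => M (phi w)).
Proof. by move=> HM; exact: (Ck_mx_comp Uo' Uo phiU HM phiC1). Qed.

Let J_sym a b c z : U z -> dm a J z b c = dm b J z a c.
Proof.
move=> Uz; rewrite !dmxE.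
have E d e : (fun w => J w d e) = D d (fun w => phi w 0 e).
  by apply/funext => w; rewrite jacE.
by rewrite !E (Ck_schwarz _ _ Uo (CkW (phiC c)) Uz).
Qed.

Let gC1' : Ck_mx 1 U' g'. Proof. exact: Ck_mxW. Qed.
Let A'C a : Ck_mx 1 U' (fun z => A' z a). Proof. exact: conn_Ck. Qed.
Let AC a : Ck_mx 1 U (fun z => A z a). Proof. exact: conn_Ck. Qed.

(** The transformation law of Christoffel symbols. The connection defined by the
right-hand side is torsion-free since second derivatives of phi are symmetric,
and is metric because g is the pull-back of g'; uniqueness does the rest. *)
Lemma conn_pullback a z : U z -> A z a *m J z = dm a J z + J z *m pulled z a.
Proof.
move=> Uz; have JUz := JU Uz; have U'z := phiU Uz.
pose B b := (dm b J z + J z *m pulled z b) *m invmx (J z).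
have BJ b : B b *m J z = dm b J z + J z *m pulled z b by rewrite mulmxKV.
suff <- : B a = A z a by [].
apply: (conn_unique (gS Uz) (gU Uz)).
- move=> b c d; rewrite !mulmx_ij; apply: eq_bigr => e _; congr (_ * _).
  rewrite !addmx_ij (J_sym b c e Uz); congr (_ + _).
  have E b' c' : (J z *m pulled z b') c' e = \sum_d \sum_f J z c' d * J z b' f * A' (phi z) f d e.
    rewrite mulmx_ij; apply: eq_bigr => d' _; rewrite /pulled summxE mulr_sumr.
    by apply: eq_bigr => f _; rewrite scalemx_ij mulrA.
  rewrite !E exchange_big /=; apply: eq_bigr => f _; apply: eq_bigr => d' _.
  by rewrite (connC Uo' gS' _ _ _ U'z gC1') [J z c _ * _]mulrC.
- move=> b.
  have Jg : Ck_mx 1 U (fun z => J z *m g' (phi z)).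
    by apply: Ck_mx_mul => //; [exact: Ck_mxW|exact: comp_C1].
  have JT : Ck_mx 1 U (fun z => (J z)^T) by apply: Ck_mx_tr; exact: Ck_mxW.
  rewrite -[RHS](eq_dmx b Uo Uz (fun w Uw => esym (gE Uw)) (Ck_mx_mul Uo Jg JT)).
  rewrite (dmxM b Uo Uz Jg JT) (dmxM b Uo Uz (Ck_mxW JC) (comp_C1 gC1')) dmx_tr.
  rewrite (dm_comp b Uz gC1') gE //.
  have -> : \sum_c J z b c *: dm c g' (phi z) =
      pulled z b *m g' (phi z) + g' (phi z) *m (pulled z b)^T.
    rewrite /pulled linear_sum mulmx_suml mulmx_sumr -big_split /=.
    apply: eq_bigr => c _; rewrite linearZ /= -scalemxAl -scalemxAr -scalerDr.
    by rewrite (conn_metric Uo' gS' gU' c U'z gC1').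
  have -> : B b *m (J z *m g' (phi z) *m (J z)^T) = (B b *m J z) *m g' (phi z) *m (J z)^T.
    by rewrite !mulmxA.
  have -> : J z *m g' (phi z) *m (J z)^T *m (B b)^T = J z *m g' (phi z) *m (B b *m J z)^T.
    by rewrite [(B b *m J z)^T]trmx_mul !mulmxA.
  rewrite BJ linearD /= trmx_mul !(mulmxDl, mulmxDr, mulmxA).
  mx_abel.
Qed.

Let pulledC a : Ck_mx 1 U (fun z => pulled z a).
Proof.
apply: Ck_mx_sum => // c; apply: Ck_mx_scale => //; last exact: (comp_C1 (A'C c)).
exact: (Ck_mxW JC).
Qed.

Let dm_pulled a b z : U z -> dm b (fun w => pulled w a) z =
  \sum_c dm b J z a c *: A' (phi z) c +
  \sum_c \sum_d (J z b d * J z a c) *: dm d (fun w => A' w c) (phi z).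
Proof.
move=> Uz; have JE c : Ck HS U 1 (fun w => J w a c) := Ck_mxW JC a c.
rewrite (dmx_sum b Uo Uz); last by move=> c; apply: Ck_mx_scale => //; exact: (comp_C1 (A'C c)).
rewrite -big_split /=; apply: eq_bigr => c _.
rewrite (dmxZ b Uo Uz (JE c) (comp_C1 (A'C c))) dmxE; congr (_ + _).
rewrite (dm_comp b Uz (A'C c)) scaler_sumr; apply: eq_bigr => d _.
by rewrite scalerA mulrC.
Qed.

(** The first three terms on the right are together symmetric in a and b, so they
cancel in the curvature, which is the antisymmetric part of the left-hand side. *)
Let half_curv a b z : U z ->
  (dm a (fun w => A w b) z + A z b *m A z a) *m J z =
  dm a (dm b J) z + dm a J z *m pulled z b + dm b J z *m pulled z a
  + J z *m (dm a (fun w => pulled w b) z + pulled z b *m pulled z a).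
Proof.
move=> Uz; have JC1 := Ck_mxW JC.
have Jp : Ck_mx 1 U (fun w => J w *m pulled w b) by apply: Ck_mx_mul.
have dJ : Ck_mx 1 U (dm b J) by exact: Ck_mx_dmx.
have AJ : Ck_mx 1 U (fun w => A w b *m J w) by apply: Ck_mx_mul.
have := eq_dmx a Uo Uz (fun w Uw => conn_pullback b Uw) AJ.
rewrite (dmxM a Uo Uz (AC b) JC1) (dmxD a Uo Uz dJ Jp) (dmxM a Uo Uz JC1 (pulledC b)) => E.
rewrite mulmxDl -mulmxA conn_pullback // mulmxDr addrA E mulmxA conn_pullback //.
rewrite mulmxDl mulmxDr !mulmxA !addrA.
rewrite -!addrA; do 2! congr (_ + _).
by rewrite addrCA.
Qed.

Lemma curv_pullback a b z : U z -> curv HS g z a b *m J z =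
  J z *m \sum_c \sum_d (J z a c * J z b d) *: curv HS g' (phi z) c d.
Proof.
move=> Uz.
have -> : curv HS g z a b = (dm a (fun w => A w b) z + A z b *m A z a) -
    (dm b (fun w => A w a) z + A z a *m A z b) by rewrite curv.unlock; mx_abel.
rewrite mulmxBl !half_curv // (dmx_schwarz a b Uo Uz JC).
set X := dm b (dm a J) z; set Y := dm a J z; set Z := dm b J z.
rewrite (_ : _ - _ = J z *m ((dm a (fun w => pulled w b) z + pulled z b *m pulled z a) -
   (dm b (fun w => pulled w a) z + pulled z a *m pulled z b))); last first.
  rewrite mulmxBr; mx_abel.
congr (_ *m _); rewrite !dm_pulled //.
have -> : \sum_c dm a J z b c *: A' (phi z) c = \sum_c dm b J z a c *: A' (phi z) c.
  by apply: eq_bigr => c _; rewrite J_sym.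
have prod e f : pulled z e *m pulled z f =
    \sum_c \sum_d (J z e c * J z f d) *: (A' (phi z) c *m A' (phi z) d).
  rewrite /pulled mulmx_suml; apply: eq_bigr => c _; rewrite mulmx_sumr.
  by apply: eq_bigr => d _; rewrite -scalemxAl -scalemxAr scalerA.
rewrite !prod.
set T := \sum_c dm b J z a c *: _.
pose S (M : 'I_n.+1 -> 'I_n.+1 -> 'M[R]_n.+1) := \sum_c \sum_d (J z a c * J z b d) *: M c d.
have SE M N P Q : S (fun c d => M c d - N c d + (P c d - Q c d)) = S M - S N + (S P - S Q).
  rewrite /S -!sumrB -big_split /=; apply: eq_bigr => c _.
  rewrite -!sumrB -big_split /=; apply: eq_bigr => d _.
  by rewrite scalerDr !scalerBr.
have Sswap M : \sum_c \sum_d (J z b c * J z a d) *: M c d = S (fun c d => M d c).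
  by rewrite /S exchange_big /=; apply: eq_bigr => c _; apply: eq_bigr => d _; rewrite mulrC.
have Sswap' M : \sum_c \sum_d (J z a d * J z b c) *: M c d = S (fun c d => M d c).
  by rewrite /S exchange_big.
have Scomm M : \sum_c \sum_d (J z b d * J z a c) *: M c d = S M.
  by rewrite /S; apply: eq_bigr => c _; apply: eq_bigr => d _; rewrite mulrC.
rewrite (Sswap' (fun c d => dm d (fun w => A' w c) (phi z))).
rewrite (Scomm (fun c d => dm d (fun w => A' w c) (phi z))).
rewrite (Sswap (fun c d => A' (phi z) c *m A' (phi z) d)).
rewrite -/(S (fun c d => A' (phi z) c *m A' (phi z) d)).
rewrite -/(S (fun c d => curv HS g' (phi z) c d)).
have -> : S (fun c d => curv HS g' (phi z) c d) = S (fun c d =>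
    dm c (fun w => A' w d) (phi z) - dm d (fun w => A' w c) (phi z) +
    (A' (phi z) d *m A' (phi z) c - A' (phi z) c *m A' (phi z) d)).
  by apply: eq_bigr => c _; apply: eq_bigr => d _; rewrite curv.unlock.
rewrite SE; move: (S _) (S _) (S _) (S _) => s1 s2 s3 s4; mx_abel.
Qed.

Lemma ricci_pullback z : U z -> ricci HS g z = J z *m ricci HS g' (phi z) *m (J z)^T.
Proof.
move=> Uz; have JUz := JU Uz.
have cE a b : curv HS g z a b =
    \sum_c \sum_d (J z a c * J z b d) *: (J z *m curv HS g' (phi z) c d *m invmx (J z)).
  rewrite -[LHS](mulmxK JUz) curv_pullback // mulmx_sumr mulmx_suml.
  apply: eq_bigr => c _; rewrite mulmx_sumr mulmx_suml; apply: eq_bigr => d _.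
  by rewrite -scalemxAr -scalemxAl.
apply/matrixP => b e; rewrite ricciE.
transitivity (\sum_c \sum_d J z b d * (J z *m curv HS g' (phi z) c d) e c).
  under eq_bigr => a _.
    rewrite cE summxE; under eq_bigr => c _.
      rewrite summxE; under eq_bigr => d _ do rewrite scalemx_ij.
      over.
    over.
  rewrite exchange_big /=; apply: eq_bigr => c _.
  rewrite exchange_big /=; apply: eq_bigr => d _.
  rewrite -[J z *m curv _ _ _ _ _ in RHS](mulmxKV JUz) mulmx_ij mulr_sumr.
  by apply: eq_bigr => a _; rewrite mulrAC mulrC; ring.
rewrite exchange_big /= -mulmxA mulmx_ij; apply: eq_bigr => d _.
rewrite -mulr_sumr; congr (_ * _).
under eq_bigr => c _ do rewrite mulmx_ij.
rewrite exchange_big /= mulmx_ij; apply: eq_bigr => f _.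
by rewrite ricciE trmx_ij -mulr_sumr mulrC.
Qed.

Lemma scalar_curvature_pullback z : U z ->
  scalar_curvature HS g z = scalar_curvature HS g' (phi z).
Proof.
move=> Uz; have JUz := JU Uz; have U'z := phiU Uz.
rewrite /scalar_curvature ricci_pullback //.
have -> : invmx (g z) = (invmx (J z))^T *m invmx (g' (phi z)) *m invmx (J z).
  have gg : g z *m ((invmx (J z))^T *m invmx (g' (phi z)) *m invmx (J z)) = 1%:M.
    rewrite gE // !mulmxA -[_ *m (J z)^T *m _]mulmxA -trmx_mul mulVmx // trmx1 mulmx1.
    by rewrite -[_ *m _ *m invmx (g' _)]mulmxA mulmxV ?gU' // mulmx1 mulmxV.
  by rewrite -[LHS]mulmx1 -gg mulmxA mulVmx ?gU // mul1mx.
rewrite !mulmxA mulmxKV // mxtrace_mulC !mulmxA -trmx_mul mulVmx //.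
by rewrite trmx1 mul1mx.
Qed.

End Invariance.

(** * Ricci curvature of a conformal metric *)

Section ConformalAlgebra.
Context {R : comNzRingType} {k : nat}.
Variables (A : 'I_k -> 'M[R]_k) (g : 'M[R]_k) (u w : 'I_k -> R).
Hypothesis As : forall a b c, A a b c = A b a c.
Hypothesis gS : g^T = g.
Hypothesis guw : forall a, \sum_e g a e * w e = u a.

(** The difference of the Levi-Civita connections of r^-2 g and g, where u is the
differential of log r and w its gradient. The Christoffel symbols enter the
algebra below only through their symmetry, so A is any symmetric family. *)
Definition conf_shift a : 'M[R]_k :=
  \matrix_(b, c) - (u b * (a == c)%:R + u a * (b == c)%:R - g a b * w c).
Local Notation B := conf_shift.

Let uu := \sum_e u e * w e.
Let ga e := \sum_a A a e a.

Lemma sum_delta (F : 'I_k -> R) b : \sum_e F e * (b == e)%:R = F b.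
Proof.
rewrite (bigD1 b) //= eqxx mulr1 big1 ?addr0 // => e eb.
by rewrite eq_sym (negbTE eb) mulr0.
Qed.

Let gsym a b : g a b = g b a. Proof. by rewrite -{1}gS mxE. Qed.

Let contr b c (X : 'I_k -> R) :
  \sum_e B b c e * X e = - (u c * X b + u b * X c - g b c * \sum_e w e * X e).
Proof.
rewrite mulr_sumr -(sum_delta (fun e => u c * X e) b) -(sum_delta (fun e => u b * X e) c).
rewrite -big_split -sumrB -sumrN /=; apply: eq_bigr => e _.
by rewrite mxE; ring.
Qed.

Let trB1 e : \sum_a B a e a = - (k%:R * u e).
Proof.
under eq_bigr => a _ do rewrite mxE eqxx mulr1 (gsym a e).
rewrite sumrN sumrB big_split /= sumr_const card_ord guw sum_delta.
by rewrite mulr_natl addrK.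
Qed.

Let trB2 b : \sum_a B b a a = - (k%:R * u b).
Proof.
under eq_bigr => a _ do rewrite mxE eqxx mulr1.
rewrite sumrN sumrB big_split /= sumr_const card_ord guw sum_delta.
by rewrite mulr_natl addrAC subrr add0r.
Qed.

Let gwl c : \sum_a w a * g a c = u c.
Proof. by rewrite -guw; apply: eq_bigr => a _; rewrite mulrC gsym. Qed.

Lemma conf_shift_tr e : \sum_a B a e a = - (k%:R * u e). Proof. exact: trB1. Qed.

(** The contribution of the products of connection matrices to the Ricci tensor of
the conformal metric: the terms linear in u assemble into covariant derivatives,
the quadratic ones into multiples of u u and |u|^2 g. *)
Lemma conf_quadratic b c :
  \sum_a ((A b + B b) *m (A a + B a) - (A a + B a) *m (A b + B b)) c a =
  \sum_a (A b *m A a - A a *m A b) c a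
  + ((2 - k%:R) * (\sum_e A b c e * u e) + g b c * (\sum_e w e * ga e)
     - \sum_a w a * (A a *m g + g *m (A a)^T) b c
     + (k%:R - 2) * (u b * u c - g b c * uu)).
Proof.
have gaE e : \sum_a A e a a = ga e by apply: eq_bigr => a _; rewrite As.
have T1 : \sum_a (A b *m B a) c a = - (k%:R * \sum_e A b c e * u e).
  under eq_bigr => a _ do rewrite mulmx_ij.
  rewrite exchange_big /= mulr_sumr -sumrN; apply: eq_bigr => e _.
  rewrite -mulr_sumr trB1; ring.
have T2 : \sum_a (B b *m A a) c a = - (u c * ga b + u b * ga c - g b c * \sum_e w e * ga e).
  under eq_bigr => a _ do rewrite mulmx_ij.
  rewrite exchange_big /= -contr; apply: eq_bigr => e _.
  by rewrite -mulr_sumr.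
have T3 : \sum_a (B b *m B a) c a = k%:R * (2 * u b * u c - g b c * uu).
  under eq_bigr => a _ do rewrite mulmx_ij.
  rewrite exchange_big /=.
  under eq_bigr => e _ do rewrite -mulr_sumr trB1.
  rewrite (contr b c (fun e => - (k%:R * u e))).
  have -> : \sum_e w e * - (k%:R * u e) = - (k%:R * uu).
    by rewrite /uu mulr_sumr -sumrN; apply: eq_bigr => e _; ring.
  ring.
have T4 : \sum_a (A a *m B b) c a = - (\sum_e A b c e * u e + u b * ga c
     - \sum_a w a * (A a *m g) c b).
  under eq_bigr => a _ do rewrite mulmx_ij.
  rewrite exchange_big /=.
  under eq_bigr => e _.
    under eq_bigr => a _ do rewrite mulrC.
    rewrite (contr b e (fun a => A a c e)); over.
  rewrite sumrN sumrB big_split /= -mulr_sumr; congr (- (_ + _ - _)).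
  - by apply: eq_bigr => e _; rewrite mulrC.
  - under eq_bigr => e _ do rewrite mulr_sumr.
    rewrite exchange_big /=; apply: eq_bigr => a _.
    rewrite mulmx_ij mulr_sumr; apply: eq_bigr => e _; rewrite (gsym e b); ring.
have T5 : \sum_a (B a *m A b) c a = - (u c * ga b + \sum_e A b c e * u e
     - \sum_a w a * (A a *m g) b c).
  under eq_bigr => a _ do rewrite mulmx_ij (contr a c (fun e => A b e a)).
  rewrite sumrN sumrB big_split /= -mulr_sumr gaE; congr (- (_ + _ - _)).
  - by apply: eq_bigr => e _; rewrite mulrC.
  - under eq_bigr => a _ do rewrite mulr_sumr.
    rewrite exchange_big /=; apply: eq_bigr => e _.
    rewrite mulmx_ij mulr_sumr; apply: eq_bigr => a _; rewrite (As b e a); ring.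
have T6 : \sum_a (B a *m B b) c a = (k%:R + 2) * u b * u c - 2 * g b c * uu.
  under eq_bigr => a _ do rewrite mulmx_ij (contr a c (fun e => B b e a)).
  rewrite sumrN sumrB big_split /= -mulr_sumr trB2.
  have -> : \sum_a u a * B b c a = - (2 * u c * u b - g b c * uu).
    under eq_bigr => a _ do rewrite mulrC.
    rewrite contr (eq_bigr (fun e => u e * w e)); last by move=> e _; rewrite mulrC.
    by rewrite -/uu; ring.
  have -> : \sum_a g a c * (\sum_e w e * B b e a) = - (uu * g b c).
    under eq_bigr => a _ do rewrite mulr_sumr.
    rewrite exchange_big /=.
    under eq_bigr => e _.
      under eq_bigr => a _ do rewrite mulrCA.
      rewrite -mulr_sumr.
      under eq_bigr => a _ do rewrite mulrC.
      rewrite (contr b e (fun a => g a c)) gwl.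
      rewrite (_ : _ * _ = - (u e * w e * g b c + u b * (w e * g e c) - u c * (g b e * w e))); last by ring.
      over.
    rewrite sumrN sumrB big_split /= -mulr_suml -!mulr_sumr gwl guw -/uu; ring.
  ring.
have T7 a : (A a *m g + g *m (A a)^T) b c = (A a *m g) b c + (A a *m g) c b.
  rewrite addmx_ij; congr (_ + _); rewrite !mulmx_ij; apply: eq_bigr => e _.
  by rewrite trmx_ij mulrC gsym.
have S7 : \sum_a w a * (A a *m g + g *m (A a)^T) b c =
   \sum_a w a * (A a *m g) b c + \sum_a w a * (A a *m g) c b.
  by rewrite -big_split /=; apply: eq_bigr => a _; rewrite T7 mulrDr.
under eq_bigr => a _.
  rewrite (_ : _ - _ = (A b *m A a - A a *m A b) + (A b *m B a + B b *m A a + B b *m B a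
    - (A a *m B b + B a *m A b + B a *m B b))); last by rewrite !(mulmxDl, mulmxDr); mx_abel.
  rewrite addmx_ij [X in _ + X]addmx_ij oppmx_ij !addmx_ij.
  over.
rewrite big_split /= sumrB !big_split /= T1 T2 T3 T4 T5 T6 S7.
have -> : \sum_a (A b *m A a - A a *m A b) c a =
    \sum_a (A b *m A a) c a + \sum_a (- (A a *m A b)) c a.
  by rewrite -big_split /=; apply: eq_bigr => a _; rewrite addmx_ij.
ring.
Qed.

Lemma conf_shiftC a b c : B a b c = B b a c.
Proof. by rewrite !mxE (gsym b a); ring. Qed.

Lemma conf_shift_metric a : B a *m g + g *m (B a)^T = - (2 * u a) *: g.
Proof.
have E b d : (B a *m g) b d = - (u b * g a d + u a * g b d - g a b * u d).
  rewrite mulmx_ij -(gwl d).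
  rewrite mulr_sumr -(sum_delta (fun e => u b * g e d) a) -(sum_delta (fun e => u a * g e d) b).
  rewrite -big_split -sumrB -sumrN /=; apply: eq_bigr => e _.
  by rewrite mxE; ring.
apply/matrixP => b d; rewrite addmx_ij scalemx_ij.
have -> : (g *m (B a)^T) b d = (B a *m g) d b.
  by rewrite !mulmx_ij; apply: eq_bigr => e _; rewrite trmx_ij mulrC gsym.
by rewrite !E (gsym d b); ring.
Qed.

End ConformalAlgebra.

HB.lock Definition pd (R : realType) (n : nat) (a : 'I_n.+1)
    (f : 'rV[R]_n.+1 -> R) (x : 'rV[R]_n.+1) : R := partial (halfspace R n) a f x.

Lemma pdE (R : realType) (n : nat) (a : 'I_n.+1) (f : 'rV[R]_n.+1 -> R) x :
  pd a f x = partial (halfspace R n) a f x.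
Proof. by rewrite pd.unlock. Qed.

HB.lock Definition hess (R : realType) (n : nat) (g : 'rV[R]_n.+1 -> 'M[R]_n.+1)
    (r : 'rV[R]_n.+1 -> R) (x : 'rV[R]_n.+1) : 'M[R]_n.+1 :=
  \matrix_(b, c) (partial (halfspace R n) b (partial (halfspace R n) c r) x
    - \sum_e conn (halfspace R n) g x b c e * partial (halfspace R n) e r x).

Section Hessian.
Context {R : realType} {n : nat}.
Local Notation V := 'rV[R]_n.+1.
Local Notation HS := (halfspace R n).
Local Notation D := (partial HS).
Local Notation dm := (dmx HS).

Lemma hessE (g : V -> 'M[R]_n.+1) (r : V -> R) x b c :
  hess g r x b c = D b (D c r) x - \sum_e conn HS g x b c e * D e r x.
Proof. by rewrite hess.unlock mxE. Qed.

Variables (U : set V) (g : V -> 'M[R]_n.+1) (r : V -> R).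
Hypotheses (Uo : ropen U) (gC : Ck_mx 2 U g).
Hypotheses (gS : forall z, U z -> (g z)^T = g z) (gU : forall z, U z -> g z \in unitmx).
Local Notation A := (conn HS g).
Local Notation H := (hess g r).

Lemma hess_sym z : Ck HS U 2 r -> U z -> (H z)^T = H z.
Proof.
move=> rC Uz; apply/matrixP => b c; rewrite trmx_ij !hessE (Ck_schwarz _ _ Uo rC Uz).
by congr (_ - _); apply: eq_bigr => e _; rewrite (connC Uo gS _ _ _ Uz (Ck_mxW gC)).
Qed.

Lemma hess_Ck k : Ck HS U k.+2 r -> Ck_mx k.+1 U g -> Ck_mx k U H.
Proof.
move=> rC HC b c; under eq_fun do rewrite hessE.
apply: CkB => //; first by apply: Ck_partial; exact: Ck_partial.
apply: Ck_sum => // e _; apply: CkM => //; first exact: (conn_Ck Uo gU HC).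
by apply: CkW; exact: Ck_partial.
Qed.

Hypothesis rC : Ck HS U 2 r.
Hypothesis r0 : forall z, U z -> r z != 0.
Variable gq : V -> 'M[R]_n.+1.
Hypothesis gqE : forall z, U z -> gq z = (r z)^-2 *: g z.

Let u a z := D a r z / r z.
Let w e z := \sum_d u d z * invmx (g z) d e.
Let B a z : 'M[R]_n.+1 := conf_shift (g z) (u^~ z) (w^~ z) a.

Let uC a : Ck HS U 1 (u a).
Proof. by apply: CkM => //; [exact: Ck_partial|apply: CkV => //; exact: CkW]. Qed.

Let giC : Ck_mx 2 U (fun z => invmx (g z)). Proof. exact: Ck_mx_inv. Qed.

Let wC e : Ck HS U 1 (w e).
Proof. by apply: Ck_sum => // d _; apply: CkM => //; exact: (Ck_mxW giC). Qed.

Let guw z : U z -> forall a, \sum_e g z a e * w e z = u a z.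
Proof.
move=> Uz a; rewrite /w.
under eq_bigr => e _ do rewrite mulr_sumr.
rewrite exchange_big /= -(sum_delta (fun d => u d z) a); apply: eq_bigr => d _.
have := congr1 (fun M : 'M[R]_n.+1 => M a d) (mulmxV (gU Uz)).
rewrite /= mulmx_ij [1%:M a d]mxE => <-; rewrite mulr_sumr; apply: eq_bigr => e _.
by rewrite mulrCA (sym_entry d e (invmx_sym (gS Uz))).
Qed.

Let BC a : Ck_mx 1 U (B a).
Proof.
move=> b c; under eq_fun do rewrite /B mxE.
apply: CkN => //; apply: CkB => //; first apply: CkD => //.
- by apply: CkM => //; exact: Ck_cst.
- by apply: CkM => //; exact: Ck_cst.
- by apply: CkM => //; exact: (Ck_mxW gC).
Qed.

(** The shifted connection is symmetric, and its failure to preserve g is the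
derivative of the factor r^-2. *)
Lemma conn_conformal a z : U z -> conn HS gq z a = A z a + B a z.
Proof.
move=> Uz; apply/esym.
have gqS : (gq z)^T = gq z by rewrite gqE // linearZ /= gS.
have rn : (r z)^-2 != 0 by rewrite invr_neq0 // expf_neq0 // r0.
have gqU : gq z \in unitmx by rewrite gqE // unitmxZ ?gU // unitfE.
apply: (conn_unique (A := fun a => A z a + B a z) gqS gqU) => [b c d|b].
  rewrite !addmx_ij (connC Uo gS _ _ _ Uz (Ck_mxW gC)) /B.
  by rewrite (conf_shiftC _ _ (gS Uz)).
have r2C : Ck HS U 1 (fun y => (r y)^-2).
  apply: CkV => // [y Uy|]; first by rewrite expf_neq0 // r0.
  by apply: CkM => //; exact: CkW.
have zgC : Ck_mx 1 U (fun y => (r y)^-2 *: g y) by apply: Ck_mx_scale => //; exact: Ck_mxW.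
rewrite -(eq_dmx b Uo Uz (fun y Uy => esym (gqE Uy)) zgC) (dmxZ b Uo Uz r2C (Ck_mxW gC)).
have -> : D b (fun y => (r y)^-2) z = - (2 * u b z) * (r z)^-2.
  have rd := Ck_has_partial b rC Uz.
  have K : has_partial b (fun y => (r y)^-2) z
    (- (r z * r z)^-2 * (D b r z * r z + r z * D b r z)).
    by apply: (has_partialV (f := fun y => r y * r y)); [rewrite mulf_neq0 ?r0|exact: has_partialM].
  rewrite (has_partialE (Uo.1 _ Uz) K) /u; field; exact: r0.
rewrite gqE // -(conn_metric Uo gS gU b Uz (Ck_mxW gC)).
rewrite -scalemxAr -scalemxAl -scalerA -scalerDr mulmxDl [(_ + _)^T]linearD /= mulmxDr.
rewrite addrACA (conf_shift_metric (u := u^~ z) (w := w^~ z) (gS Uz) (guw Uz)).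
rewrite scalerDr [RHS]addrC; congr (_ + _).
by rewrite !scalerA mulrC.
Qed.

Let uu z := \sum_e u e z * w e z.
Let ga z e := \sum_a A z a e a.
Let nab z b c := pd b (u c) z - \sum_e A z b c e * u e z.

Let D_B a b c d z : U z -> dm d (B a) z b c =
  - (pd d (u b) z * (a == c)%:R + pd d (u a) z * (b == c)%:R
     - (dm d g z a b * w c z + g z a b * pd d (w c) z)).
Proof.
move=> Uz; rewrite !pdE !dmxE; have E : (fun y => B a y b c) =
    (fun y => - (u b y * (a == c)%:R + u a y * (b == c)%:R - g y a b * w c y)).
  by apply/funext => y; rewrite /B mxE.
rewrite E; apply: (has_partialE (Uo.1 _ Uz)); apply: has_partialN.
have du i := Ck_has_partial d (uC i) Uz.
have K i j : has_partial d (fun y => u i y * j%:R) z (D d (u i) z * j%:R).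
  by have := has_partialM (du i) (has_partial_cst d (j%:R) z); rewrite mulr0 addr0.
apply: has_partialD; first by apply: has_partialD; exact: K.
apply/has_partialN/has_partialM; first exact: (Ck_has_partial d (gC a b) Uz).
exact: (Ck_has_partial d (wC c) Uz).
Qed.

Let sum_D_B1 b c z : U z -> \sum_a dm a (B b) z c a =
  - (pd b (u c) z + pd c (u b) z
     - (\sum_a dm a g z b c * w a z + g z b c * \sum_a pd a (w a) z)).
Proof.
move=> Uz; under eq_bigr => a _ do rewrite D_B //.
rewrite sumrN sumrB big_split /= big_split /= (sum_delta (fun a => pd a (u c) z)).
by rewrite (sum_delta (fun a => pd a (u b) z)) mulr_sumr.
Qed.

Let sum_D_B2 b c z : U z -> \sum_a dm b (B a) z c a = - (n.+1%:R * pd b (u c) z).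
Proof.
move=> Uz; under eq_bigr => a _ do rewrite dmxE; rewrite pdE.
have K : has_partial b (fun y => \sum_a B a y c a) z (\sum_a D b (fun y => B a y c a) z).
  by apply: has_partial_sum => a _; exact: (Ck_has_partial b (BC a c a) Uz).
rewrite -(has_partialE (Uo.1 _ Uz) K).
apply: (has_partialE (Uo.1 _ Uz)).
have L : has_partial b (fun y => - (n.+1%:R * u c y)) z (- (n.+1%:R * D b (u c) z)).
  apply: has_partialN.
  have := has_partialM (has_partial_cst b n.+1%:R z) (Ck_has_partial b (uC c) Uz).
  by rewrite mul0r add0r.
apply: (eq_has_partial Uo Uz _ L) => y Uy.
by rewrite (conf_shift_tr (u := u^~ y) (w := w^~ y) (gS Uy) (guw Uy)).
Qed.

(** The usual formula, with the divergence of w still written with Christoffel symbols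
and with a last term that vanishes since u is closed. *)
Let ricci_shift b c z : U z -> ricci HS gq z b c = ricci HS g z b c
  + (n.+1%:R - 2) * nab z b c + g z b c * (\sum_a pd a (w a) z + \sum_e w e z * ga z e)
  + (n.+1%:R - 2) * (u b z * u c z - g z b c * uu z) + (pd b (u c) z - pd c (u b) z).
Proof.
move=> Uz; have gC1 := Ck_mxW gC; have AC a := conn_Ck Uo gU gC a.
have ABC a : Ck_mx 1 U (fun y => A y a + B a y) by apply: Ck_mx_add.
have dconn a e : dm a (fun y => conn HS gq y e) z = dm a (fun y => A y e) z + dm a (B e) z.
  rewrite -(eq_dmx a Uo Uz (fun y Uy => esym (conn_conformal e Uy)) (ABC e)).
  exact: (dmxD a Uo Uz (AC e) (BC e)).
have F a : curv HS gq z a b c a = curv HS g z a b c a - (A z b *m A z a - A z a *m A z b) c a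
    + dm a (B b) z c a - dm b (B a) z c a
    + ((A z b + B b z) *m (A z a + B a z) - (A z a + B a z) *m (A z b + B b z)) c a.
  rewrite !curv.unlock !dconn !conn_conformal //.
  set X := (_ *m _ - _ *m _); set Y := (_ *m _ - _ *m _).
  by rewrite !(addmx_ij, oppmx_ij); ring.
rewrite !ricciE; under eq_bigr => a _ do rewrite F.
rewrite !big_split !sumrN /=.
have Q := conf_quadratic (fun a b c => connC Uo gS a b c Uz gC1) (gS Uz) (guw Uz) b c.
have -> : \sum_a ((A z b + B b z) *m (A z a + B a z) - (A z a + B a z) *m (A z b + B b z)) c a
  = _ := Q.
rewrite sum_D_B1 // sum_D_B2 //.
have -> : \sum_a w a z * (A z a *m g z + g z *m (A z a)^T) b c = \sum_a dm a g z b c * w a z.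
  by apply: eq_bigr => a _; rewrite (conn_metric Uo gS gU a Uz gC1) mulrC.
have -> : \sum_e w e z * (\sum_a A z a e a) = \sum_e w e z * ga z e by [].
rewrite /nab -/(uu z); ring.
Qed.

Let pd_u b c z : U z -> pd b (u c) z = D b (D c r) z / r z - u b z * u c z.
Proof.
move=> Uz; rewrite pdE; apply: (has_partialE (Uo.1 _ Uz)).
have K := has_partialM (Ck_has_partial b (Ck_partial c rC) Uz)
  (has_partialV (r0 Uz) (Ck_has_partial b (CkW rC) Uz)).
suff <- : D b (D c r) z / r z + D c r z * (- (r z) ^- 2 * D b r z)
  = D b (D c r) z / r z - u b z * u c z by exact: K.
rewrite /u; field; exact: r0.
Qed.

Let nabE b c z : U z -> nab z b c = H z b c / r z - u b z * u c z.
Proof.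
move=> Uz; rewrite /nab pd_u // hessE mulrBl mulr_suml addrAC; congr (_ - _ - _).
by apply: eq_bigr => e _; rewrite mulrA.
Qed.

(** The divergence of w is the trace of the covariant derivative of u, because
lowering an index commutes with covariant differentiation. *)
Let divergence z : U z -> \sum_a pd a (w a) z + \sum_e w e z * ga z e =
  \tr (invmx (g z) *m H z) / r z - uu z.
Proof.
move=> Uz; have gC1 := Ck_mxW gC.
pose N : 'M[R]_n.+1 := \matrix_(a, c) nab z a c.
pose W : 'M[R]_n.+1 := \matrix_(a, f) (pd a (w f) z + \sum_e w e z * A z a e f).
have gs i j := sym_entry i j (gS Uz).
have du a c : pd a (u c) z = \sum_e (dm a g z c e * w e z + g z c e * pd a (w e) z).
  have K : has_partial a (fun y => \sum_e g y c e * w e y) z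
      (\sum_e (dm a g z c e * w e z + g z c e * pd a (w e) z)).
    apply: has_partial_sum => e _; rewrite dmxE pdE.
    by apply: has_partialM; [exact: (Ck_has_partial a (gC1 c e) Uz)|exact: (Ck_has_partial a (wC e) Uz)].
  rewrite pdE; apply: (has_partialE (Uo.1 _ Uz)).
  by apply: (eq_has_partial Uo Uz _ K) => y Uy; exact: guw.
have NE : N = W *m g z.
  apply/matrixP => a c; rewrite mulmx_ij [LHS]mxE /nab du.
  have -> : \sum_(e < n.+1) (dm a g z c e * w e z + g z c e * pd a (w e) z) =
     \sum_e (A z a *m g z) c e * w e z + \sum_e (A z a *m g z) e c * w e z
     + \sum_e g z c e * pd a (w e) z.
    rewrite -!big_split /=; apply: eq_bigr => e _; congr (_ + _); rewrite -mulrDl; congr (_ * _).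
    rewrite -(conn_metric Uo gS gU a Uz gC1) addmx_ij; congr (_ + _).
    by rewrite !mulmx_ij; apply: eq_bigr => f _; rewrite trmx_ij mulrC gs.
  have -> : \sum_e (A z a *m g z) c e * w e z = \sum_e A z a c e * u e z.
    under eq_bigr => e _ do rewrite mulmx_ij mulr_suml.
    rewrite exchange_big /=; apply: eq_bigr => f _.
    by rewrite -(guw Uz f) mulr_sumr; apply: eq_bigr => e _; rewrite mulrA.
  have rearrange (p q s : R) : p + q + s - p = s + q by ring.
  rewrite rearrange.
  have -> : \sum_l W a l * g z l c = \sum_l g z c l * pd a (w l) z +
      \sum_l (\sum_e w e z * A z a e l) * g z l c.
    by rewrite -big_split /=; apply: eq_bigr => l _; rewrite mxE (gs c l); ring.
  congr (_ + _).
  under [RHS]eq_bigr => l _ do rewrite mulr_suml.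
  rewrite exchange_big /=; apply: eq_bigr => e _.
  by rewrite mulmx_ij mulr_suml; apply: eq_bigr => l _; rewrite -mulrA mulrC.
have <- : \tr (invmx (g z) *m N) = \sum_a pd a (w a) z + \sum_e w e z * ga z e.
  rewrite NE mxtrace_mulC mulmxK ?gU // /mxtrace.
  have -> : \sum_e w e z * ga z e = \sum_a \sum_e w e z * A z a e a.
    by rewrite exchange_big /=; apply: eq_bigr => e _; rewrite mulr_sumr.
  by rewrite -big_split /=; apply: eq_bigr => a _; rewrite mxE.
have -> : N = (r z)^-1 *: H z - \matrix_(a, c) (u a z * u c z).
  by apply/matrixP => a c; rewrite addmx_ij oppmx_ij scalemx_ij !mxE nabE // mulrC.
rewrite mulmxBr -scalemxAr linearB /= mxtraceZ mulrC; congr (_ - _).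
rewrite /mxtrace; apply: eq_bigr => a _; rewrite mulmx_ij /w mulr_sumr.
apply: eq_bigr => d _; rewrite mxE (sym_entry a d (invmx_sym (gS Uz))); ring.
Qed.

(** With |dr| = 1 the terms quadratic in u have total - n r^-2 g, which is the
multiple - n of the conformal metric; what remains has only a simple pole in r. *)
Lemma conformal_ricci z : U z ->
  inner (invmx (g z)) (\row_a D a r z) (\row_a D a r z) = 1 ->
  ricci HS gq z + n%:R *: gq z = ricci HS g z
   + (r z)^-1 *: ((n%:R - 1) *: H z + \tr (invmx (g z) *m H z) *: g z).
Proof.
move=> Uz unit_grad.
have uuE : uu z = (r z)^-2.
  rewrite -[RHS]mul1r -unit_grad /inner mulmx_ij mulr_suml; apply: eq_bigr => e _.
  rewrite mulmx_ij trmx_ij mxE /w !mulr_suml mulr_sumr; apply: eq_bigr => d _.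
  by rewrite mxE /u; field; exact: r0.
apply/matrixP => b c; rewrite !addmx_ij ricci_shift //.
rewrite !scalemx_ij addmx_ij !scalemx_ij gqE // scalemx_ij divergence // nabE // uuE.
have -> : pd b (u c) z = pd c (u b) z.
  rewrite (pd_u b c Uz) (pd_u c b Uz).
  exact: (congr2 (fun s t => s / r z - t) (Ck_schwarz b c Uo rC Uz) (mulrC _ _)).
rewrite -natr1; ring.
Qed.

End Hessian.

(** * Traces and positive forms *)

Section TraceSplit.
Context {R : realType} {n : nat}.
Implicit Types (g S : 'M[R]_n.+1).

Definition posdef k (M : 'M[R]_k) := forall v, v != 0 -> 0 < inner M v v.

Lemma inner_row k (M : 'M[R]_k) v w : inner M v w = \sum_i \sum_j v 0 i * M i j * w 0 j.
Proof.
rewrite /inner mulmx_ij exchange_big /=; apply: eq_bigr => j _.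
by rewrite mulmx_ij trmx_ij mulr_suml.
Qed.

Lemma posdef_unitmx k (M : 'M[R]_k) : posdef M -> M \in unitmx.
Proof.
move=> Mp; rewrite -row_free_unit -kermx_eq0; apply: contraT => /rowV0Pn[v vk v0].
have := Mp v v0; rewrite /inner; move/sub_kermxP: vk => ->.
by rewrite mul0mx mxE ltxx.
Qed.

Lemma tangential_ij g a b : tangential g a b = g (lift ord0 a) (lift ord0 b).
Proof. by rewrite /tangential !mxE. Qed.

Lemma inner_tangential g (v w : 'rV[R]_n) :
  inner (tangential g) v w = inner g (hpt 0 v) (hpt 0 w).
Proof.
rewrite !inner_row big_ord_recl [X in X + _]big1 ?add0r; last first.
  by move=> j _; rewrite hptE0 !mul0r.
apply: eq_bigr => i _; rewrite big_ord_recl hptE0 mulr0 add0r.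
by apply: eq_bigr => j _; rewrite tangential_ij !hptE.
Qed.

Lemma hpt0_eq0 (v : 'rV[R]_n) : (hpt 0 v == 0) = (v == 0).
Proof.
apply/eqP/eqP => [/rowP H|->]; apply/rowP => a.
  by have := H (lift ord0 a); rewrite hptE !mxE.
by rewrite !mxE; case: unliftP => // ? _; rewrite mxE.
Qed.

Lemma posdef_tangential g : posdef g -> posdef (tangential g).
Proof. by move=> gp v v0; rewrite inner_tangential; apply: gp; rewrite hpt0_eq0. Qed.

Lemma tangential_sym g : g^T = g -> (tangential g)^T = tangential g.
Proof. by move=> gS; apply/matrixP => a b; rewrite trmx_ij !tangential_ij (sym_entry _ _ gS). Qed.

(** The vector v is the unit normal of the hyperplane spanned by the tangential
coordinate vectors, and the inverse of g is the sum of the inverse of its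
tangential part and of the tensor square of v. *)
Lemma trace_split g S (rho : R) : g^T = g -> g \in unitmx -> tangential g \in unitmx ->
  rho ^+ 2 * invmx g 0 0 = 1 ->
  let v := rho *: row 0 (invmx g) in
  \tr (invmx g *m S) = \tr (invmx (tangential g) *m tangential S) + inner S v v.
Proof.
move=> gS gU tU rho1 v.
have G00 : invmx g 0 0 != 0.
  by apply/eqP => E; move: rho1; rewrite E mulr0 => /esym/eqP; rewrite oner_eq0.
have Gs i j := sym_entry i j (invmx_sym gS).
pose G' : 'M[R]_n := \matrix_(a, b) (invmx g (lift ord0 a) (lift ord0 b)
   - rho ^+ 2 * invmx g (lift ord0 a) 0 * invmx g 0 (lift ord0 b)).
have Gg i j : \sum_e invmx g i e * g e j = (i == j)%:R.
  by rewrite -mulmx_ij mulVmx // mxE.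
have G'E : G' *m tangential g = 1%:M.
  apply/matrixP => a c; rewrite mulmx_ij.
  have E1 := Gg (lift ord0 a) (lift ord0 c); rewrite big_ord_recl /= (inj_eq lift_inj) in E1.
  have E2 := Gg ord0 (lift ord0 c); rewrite big_ord_recl /= ?(negbTE (neq_lift _ _)) in E2.
  have -> : \sum_j G' a j * tangential g j c =
    \sum_(i < n) invmx g (lift ord0 a) (lift ord0 i) * g (lift ord0 i) (lift ord0 c)
    - rho ^+ 2 * invmx g (lift ord0 a) 0 *
      \sum_(i < n) invmx g 0 (lift ord0 i) * g (lift ord0 i) (lift ord0 c).
    rewrite mulr_sumr -sumrB; apply: eq_bigr => i _.
    by rewrite tangential_ij mxE; ring.
  rewrite mxE -E1.
  have -> : \sum_(i < n) invmx g 0 (lift ord0 i) * g (lift ord0 i) (lift ord0 c) =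
     - (invmx g 0 0 * g 0 (lift ord0 c)).
    by apply/eqP; rewrite -addr_eq0 addrC; apply/eqP.
  have -> : rho ^+ 2 * invmx g (lift ord0 a) 0 * - (invmx g 0 0 * g 0 (lift ord0 c)) =
    - ((rho ^+ 2 * invmx g 0 0) * (invmx g (lift ord0 a) 0 * g 0 (lift ord0 c))) by ring.
  by rewrite rho1 mul1r opprK addrC.
have -> : invmx (tangential g) = G'.
  by rewrite -[LHS]mul1mx -G'E -mulmxA mulmxV // mulmx1.
have trE k (M N : 'M[R]_k) : \tr (M *m N) = \sum_i \sum_j M i j * N j i.
  by rewrite /mxtrace; apply: eq_bigr => i _; rewrite mulmx_ij.
rewrite !trE inner_row.
have vE i : v 0 i = rho * invmx g 0 i by rewrite !mxE.
pose K i j := invmx g i j - rho ^+ 2 * invmx g i 0 * invmx g 0 j.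
have K0 j : K ord0 j = 0 by rewrite /K rho1 mul1r subrr.
have K0' i : K i ord0 = 0 by rewrite /K mulrAC rho1 mul1r subrr.
transitivity (\sum_i \sum_j K i j * S j i + \sum_i \sum_j v 0 i * S i j * v 0 j).
  rewrite [X in _ + X]exchange_big -big_split /=; apply: eq_bigr => i _.
  rewrite -big_split /=; apply: eq_bigr => j _.
  by rewrite !vE /K (Gs i 0); ring.
congr (_ + _); rewrite big_ord_recl [X in X + _]big1 ?add0r; last first.
  by move=> j _; rewrite K0 mul0r.
apply: eq_bigr => i _; rewrite big_ord_recl K0' mul0r add0r.
by apply: eq_bigr => j _; rewrite tangential_ij mxE.
Qed.

End TraceSplit.

Section Semidefinite.
Context {R : realType}.

Definition possemidef k (M : 'M[R]_k) := forall v, 0 <= inner M v v.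

Lemma inner_addl k (M : 'M[R]_k) v w z : inner M (v + w) z = inner M v z + inner M w z.
Proof. by rewrite /inner !mulmxDl addmx_ij. Qed.

Lemma inner_addr k (M : 'M[R]_k) v w z : inner M z (v + w) = inner M z v + inner M z w.
Proof. by rewrite /inner linearD /= mulmxDr addmx_ij. Qed.

Lemma inner_scalel k (M : 'M[R]_k) c v w : inner M (c *: v) w = c * inner M v w.
Proof. by rewrite /inner -!scalemxAl scalemx_ij. Qed.

Lemma inner_scaler k (M : 'M[R]_k) c v w : inner M v (c *: w) = c * inner M v w.
Proof. by rewrite /inner linearZ /= -scalemxAr scalemx_ij. Qed.

Lemma innerC k (M : 'M[R]_k) v w : M^T = M -> inner M v w = inner M w v.
Proof.
move=> MS; rewrite !inner_row exchange_big /=; apply: eq_bigr => i _; apply: eq_bigr => j _.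
by rewrite (sym_entry j i MS); ring.
Qed.

Lemma inner_delta k (M : 'M[R]_k) i j : inner M (delta_mx 0 i) (delta_mx 0 j) = M i j.
Proof. by rewrite /inner trmx_delta -rowE mulmx_ij (bigD1 j) //= big1 => [|l lj]; rewrite !mxE ?eqxx ?mulr1 ?addr0 // (negbTE lj) mulr0. Qed.

Lemma inner_mxD k (M N : 'M[R]_k) v w : inner (M + N) v w = inner M v w + inner N v w.
Proof. by rewrite /inner mulmxDr mulmxDl addmx_ij. Qed.

Lemma inner_mxZ k c (M : 'M[R]_k) v w : inner (c *: M) v w = c * inner M v w.
Proof. by rewrite /inner -scalemxAr -scalemxAl scalemx_ij. Qed.

Lemma polarization k (M : 'M[R]_k) : M^T = M -> (forall v, inner M v v = 0) -> M = 0.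
Proof.
move=> MS M0; apply/matrixP => i j; rewrite [RHS]mxE.
have := M0 (delta_mx 0 i + delta_mx 0 j).
rewrite inner_addl !inner_addr !M0 add0r addr0 (innerC (delta_mx 0 j) _ MS) inner_delta.
by move=> /eqP; rewrite -mulr2n mulrn_eq0 /= => /eqP.
Qed.

(** The Cauchy-Schwarz inequality for a semidefinite form, in the degenerate case. *)
Lemma possemidef_null k (M : 'M[R]_k) v w : M^T = M -> possemidef M ->
  inner M v v = 0 -> inner M v w = 0.
Proof.
move=> MS Mp v0; apply/eqP; apply: contraT => vw0.
(* Were the product nonzero, the form would be affine on the line w + t v, and
   this t makes its value -1. *)
pose t := - (inner M w w + 1) / (2 * inner M v w).
have := Mp (w + t *: v).
rewrite inner_addl !inner_addr !inner_scalel !inner_scaler v0 (innerC w v MS).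
have -> : inner M w w + t * inner M v w + (t * inner M v w + t * (t * 0)) = - 1.
  by rewrite /t; field.
by rewrite oppr_ge0 ler10.
Qed.

(** Induction on the dimension: [trace_split] peels off the normal of a coordinate
hyperplane, so neither a diagonalization nor a square root of g is needed. *)
Lemma possemidef_trace k (g T : 'M[R]_k) : g^T = g -> posdef g -> T^T = T -> possemidef T ->
  0 <= \tr (invmx g *m T) /\ (\tr (invmx g *m T) = 0 -> T = 0).
Proof.
elim: k g T => [|k IH] g T gS gp TS Tp.
  split; first by rewrite /mxtrace big_ord0.
  by move=> _; apply/matrixP; case.
have gU := posdef_unitmx gp; have tp := posdef_tangential gp.
have G00 : 0 < invmx g 0 0.
  have v0 : row 0 (invmx g) != 0.
    apply/eqP => E; have := mulVmx gU => /(congr1 (row 0)).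
    rewrite row_mul E mul0mx => /rowP /(_ 0); rewrite !mxE eqxx => /esym/eqP.
    by rewrite oner_eq0.
  have := gp _ v0; rewrite /inner -row_mul mulVmx //.
  by rewrite row1 -rowE !mxE.
pose rho := Num.sqrt (invmx g 0 0)^-1.
have rho1 : rho ^+ 2 * invmx g 0 0 = 1.
  by rewrite sqr_sqrtr ?invr_ge0 ?(ltW G00) // mulVf // gt_eqF.
have := trace_split T gS gU (posdef_unitmx tp) rho1 => /=.
set v := rho *: _ => E.
have Tt : possemidef (tangential T) by move=> w; rewrite inner_tangential.
have [IH1 IH2] := IH _ _ (tangential_sym gS) tp (tangential_sym TS) Tt.
rewrite E; split; first exact: addr_ge0.
move=> /eqP; rewrite paddr_eq0 // => /andP[/eqP/IH2 T0 /eqP Tv].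
have tT i j : T (lift ord0 i) (lift ord0 j) = 0 by rewrite -tangential_ij T0 mxE.
have v0 : v 0 0 != 0.
  rewrite !mxE mulf_neq0 ?(gt_eqF G00) //; apply/eqP => r0; move: rho1.
  by rewrite r0 expr0n mul0r => /esym/eqP; rewrite oner_eq0.
have rowv j : v 0 0 * T 0 j + \sum_(i < k) v 0 (lift ord0 i) * T (lift ord0 i) j = 0.
  have := possemidef_null (delta_mx 0 j) TS Tp Tv.
  rewrite inner_row exchange_big /= (bigD1 j) //= [X in _ + X]big1 => [|l lj].
    have dj : (delta_mx 0 j : 'rV[R]_k.+1) 0 j = 1 by rewrite mxE !eqxx.
    under eq_bigr => i _ do rewrite dj mulr1.
    by rewrite addr0 big_ord_recl.
  by apply: big1 => i _; rewrite [delta_mx _ _ _ _]mxE (negbTE lj) mulr0.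
have T0j j : T 0 (lift ord0 j) = 0.
  have := rowv (lift ord0 j); rewrite big1 ?addr0 => [/eqP|i _]; last by rewrite tT mulr0.
  by rewrite mulf_eq0 (negbTE v0) => /eqP.
have T00 : T 0 0 = 0.
  have := rowv ord0; rewrite big1 ?addr0 => [/eqP|i _].
    by rewrite mulf_eq0 (negbTE v0) => /eqP.
  by rewrite (sym_entry _ _ TS) T0j mulr0.
apply/matrixP => i j; rewrite mxE.
case: (unliftP ord0 i) => [i' ->|->]; case: (unliftP ord0 j) => [j' ->|->] //.
by rewrite (sym_entry _ _ TS).
Qed.

End Semidefinite.

(** * Symmetry of the Ricci tensor *)

Section Bianchi.
Context {R : realType} {n : nat}.
Local Notation V := 'rV[R]_n.+1.
Local Notation HS := (halfspace R n).
Variables (U : set V) (g : V -> 'M[R]_n.+1).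
Hypotheses (Uo : ropen U) (gC : Ck_mx 2 U g).
Hypotheses (gS : forall z, U z -> (g z)^T = g z) (gU : forall z, U z -> g z \in unitmx).
Local Notation A := (conn HS g).
Local Notation F := (curv HS g).

Lemma bianchi x a b c d : U x -> F x a b c d + F x b c a d + F x c a b d = 0.
Proof.
move=> Ux.
have dA i j l : dmx HS i (fun z => A z j) x l d = dmx HS i (fun z => A z l) x j d.
  rewrite !dmxE; apply: (eq_partial Uo Ux) => [z Uz|].
    exact: (connC Uo gS _ _ _ Uz (Ck_mxW gC)).
  exact: (has_partial_diff (Ck_has_partial i (conn_Ck Uo gU gC j l d) Ux)).
have AA i j l : (A x i *m A x j) l d = (A x l *m A x j) i d.
  by rewrite !mulmx_ij; apply: eq_bigr => e _; rewrite (connC Uo gS _ _ _ Ux (Ck_mxW gC)).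
rewrite !curv.unlock !(addmx_ij, oppmx_ij).
rewrite (dA a c b) (dA b a c) (dA c b a) (AA b a c) (AA c b a) (AA a c b).
ring.
Qed.

(** By the Bianchi identity the antisymmetric part of the Ricci tensor is the trace of
R(e_b, e_c), and this endomorphism is antisymmetric with respect to g. *)
Lemma ricci_sym x : U x -> (ricci HS g x)^T = ricci HS g x.
Proof.
move=> Ux; apply/matrixP => b c; rewrite trmx_ij !ricciE.
have FE i j : F x i j = - F x j i.
  by rewrite curv.unlock; mx_abel.
have tr0 i j : \tr (F x i j) = 0.
  have := curv_antisym Uo gS gU i j Ux gC => /(congr1 (fun M => \tr (M *m invmx (g x)))).
  rewrite /= mul0mx mxtrace0 mulmxDl mulmxK ?gU // linearD /=.
  rewrite [X in _ + X]mxtrace_mulC mulmxA mulVmx ?gU // mul1mx mxtrace_tr -mulr2n.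
  by move=> /eqP; rewrite mulrn_eq0 /= => /eqP.
apply/eqP; rewrite -subr_eq0 -sumrB; apply/eqP.
rewrite -[RHS](tr0 b c) /mxtrace; apply: eq_bigr => a _.
have := bianchi a b c a Ux; rewrite (FE c a) oppmx_ij => /eqP.
rewrite subr_eq0 => /eqP <-; ring.
Qed.

End Bianchi.

(** * Curvature at a totally geodesic boundary *)

Section BoundaryGeometry.
Context {R : realType} {n : nat}.
Local Notation V := 'rV[R]_n.+1.
Local Notation HS := (halfspace R n).
Local Notation D := (partial HS).
Local Notation dm := (dmx HS).
Variables (U : set V) (g : V -> 'M[R]_n.+1) (r : V -> R).
Hypotheses (Uo : ropen U) (gC : Ck_mx 2 U g) (rC : Ck HS U 3 r).
Hypotheses (gS : forall z, U z -> (g z)^T = g z) (gp : forall z, U z -> posdef (g z)).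
Hypothesis r0 : forall z, U z -> z 0 ord0 = 0 -> r z = 0.
Definition dr (f : V -> R) z : 'rV[R]_n.+1 := \row_e D e f z.
Hypothesis unit_grad : forall z, U z -> inner (invmx (g z)) (dr r z) (dr r z) = 1.
Local Notation A := (conn HS g).
Local Notation F := (curv HS g).
Local Notation H := (hess g r).
Variable x : V.
Hypotheses (Ux : U x) (x0 : x 0 ord0 = 0).

Let gU z : U z -> g z \in unitmx. Proof. by move=> Uz; exact: posdef_unitmx (gp Uz). Qed.
Let HC : Ck_mx 1 U H. Proof. exact: hess_Ck. Qed.

Lemma dr_bdry z : U z -> z 0 ord0 = 0 -> dr r z = D ord0 r z *: delta_mx 0 0.
Proof.
move=> Uz z0; apply/rowP => e; rewrite !mxE /=.
case: (unliftP ord0 e) => [a ->|->]; last by rewrite mulr1.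
by rewrite (partial_tangential0 _ Uo Uz z0 r0) mulr0.
Qed.

Lemma normal_unit z : U z -> z 0 ord0 = 0 -> D ord0 r z ^+ 2 * invmx (g z) 0 0 = 1.
Proof.
move=> Uz z0; rewrite -(unit_grad Uz) dr_bdry //.
by rewrite inner_scalel inner_scaler inner_delta mulrA.
Qed.

Lemma normal_neq0 z : U z -> z 0 ord0 = 0 -> D ord0 r z != 0.
Proof.
move=> Uz z0; apply/eqP => E; have := normal_unit Uz z0.
by rewrite E expr0n mul0r => /esym/eqP; rewrite oner_eq0.
Qed.

Let v z : 'rV[R]_n.+1 := dr r z *m invmx (g z).

(** Half the derivative of |dr|^2 = 1 in the direction a. In coordinates this
combines the derivatives of v g = dr and of v dr = 1 with the compatibility of the
connection with g. *)
Lemma hess_gradient z a : U z -> \sum_b H z a b * v z 0 b = 0.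
Proof.
move=> Uz; have gC1 := Ck_mxW gC.
have drC : Ck_mx 2 U (dr r).
  by move=> i j; under eq_fun do rewrite mxE; exact: Ck_partial.
have drC1 := Ck_mxW drC.
have vC : Ck_mx 1 U v.
  by apply: Ck_mx_mul => //; exact: Ck_mx_inv.
have vg y : U y -> v y *m g y = dr r y by move=> Uy; rewrite /v mulmxKV // gU.
have E1 : dm a v z *m g z + v z *m dm a g z = dm a (dr r) z.
  rewrite -(dmxM a Uo Uz vC gC1); apply: (eq_dmx a Uo Uz vg); exact: Ck_mx_mul.
have vdr y : U y -> v y *m (dr r y)^T = 1%:M.
  move=> Uy; apply/matrixP => i j; rewrite (ord1 i) (ord1 j) [RHS]mxE eqxx.
  exact: (unit_grad Uy).
have E2 : dm a v z *m (dr r z)^T + v z *m (dm a (dr r) z)^T = 0.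
  rewrite -dmx_tr -(dmxM a Uo Uz vC (Ck_mx_tr drC1)).
  rewrite (eq_dmx a Uo Uz vdr); last by apply: Ck_mx_mul => //; exact: Ck_mx_tr.
  apply/matrixP => i j; rewrite dmxE [RHS]mxE.
  apply: (has_partialE (Uo.1 _ Uz)); exact: has_partial_cst.
have rowH : \row_b H z a b = dm a (dr r) z - dr r z *m (A z a)^T.
  apply/rowP => b; rewrite [LHS]mxE hessE addmx_ij oppmx_ij dmxE mulmx_ij; congr (_ - _).
    by congr (D a _ z); apply/funext => y; rewrite mxE.
  by apply: eq_bigr => e _; rewrite trmx_ij mxE mulrC.
have -> : \sum_b H z a b * v z 0 b = (\row_b H z a b *m (v z)^T) 0 0.
  by rewrite mulmx_ij; apply: eq_bigr => b _; rewrite trmx_ij; congr (_ * _); rewrite mxE.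
rewrite rowH mulmxBl.
have vgT : g z *m (v z)^T = (dr r z)^T by rewrite -(vg z Uz) [(v z *m g z)^T]trmx_mul gS.
have tr2 (p q : 'rV[R]_n.+1) : (p *m q^T) 0 0 = (q *m p^T) 0 0.
  by rewrite !mulmx_ij; apply: eq_bigr => i _; rewrite !trmx_ij mulrC.
have q1 : (v z *m (dm a (dr r) z)^T) 0 0 = (dm a (dr r) z *m (v z)^T) 0 0 by exact: tr2.
have s1 : (dr r z *m (A z a)^T *m (v z)^T) 0 0 = (v z *m (A z a *m g z) *m (v z)^T) 0 0.
  rewrite tr2 [(_ *m (A z a)^T)^T]trmx_mul trmxK -vgT.
  by rewrite !mulmxA.
have s2 : (v z *m (g z *m (A z a)^T) *m (v z)^T) 0 0 = (dr r z *m (A z a)^T *m (v z)^T) 0 0.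
  by rewrite mulmxA vg.
have := congr1 (fun M : 'rV[R]_n.+1 => (M *m (v z)^T) 0 0) E1.
rewrite /= -(conn_metric Uo gS gU a Uz gC1) mulmxDr !mulmxDl !addmx_ij -s1 s2 -mulmxA vgT.
have := congr1 (fun M : 'M[R]_1 => M 0 0) E2; rewrite /= addmx_ij q1 [X in _ = X]mxE oppmx_ij.
lra.
Qed.

Hypothesis H0 : forall z, U z -> z 0 ord0 = 0 -> H z = 0.
(** The limit Q of H / r at the boundary point x when H vanishes on the boundary:
both H and r are divided by the boundary coordinate. *)
Definition hess_slope : 'M[R]_n.+1 := (D ord0 r x)^-1 *: dm ord0 H x.
Local Notation Q := hess_slope.
Local Notation rho := (D ord0 r x).

Lemma hess_slope_limit b c : H z b c / r z @[z --> inner_nbhs U x] --> Q b c.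
Proof.
rewrite scalemx_ij dmxE mulrC.
apply: (bdry_quotient Uo (HC b c) _ Ux x0 _ r0 (normal_neq0 Ux x0)).
  exact: Ck_leq rC.
by move=> z Uz z0; rewrite H0 // mxE.
Qed.

Lemma hess_slope_sym : Q^T = Q.
Proof.
apply/matrixP => b c; rewrite trmx_ij !scalemx_ij !dmxE; congr (_ * _).
apply: (eq_partial Uo Ux) => [z Uz|].
  exact: (sym_entry c b (hess_sym Uo gC gS (CkW rC) Uz)).
exact: (has_partial_diff (Ck_has_partial ord0 (HC c b) Ux)).
Qed.

Let dm_hess a : dm a H x = (rho * (a == ord0)%:R) *: Q.
Proof.
case: (unliftP ord0 a) => [a' ->|->].
  rewrite eq_sym (negbTE (neq_lift _ _)) mulr0 scale0r.
  apply/matrixP => b c; rewrite dmxE [RHS]mxE.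
  by apply: (partial_tangential0 _ Uo Ux x0) => z Uz z0; rewrite H0 // mxE.
by rewrite eqxx mulr1 scalerA mulfV ?scale1r // normal_neq0.
Qed.

Let D_r e : D e r x = rho * (e == ord0)%:R.
Proof.
have := congr1 (fun M : 'rV[R]_n.+1 => M 0 e) (dr_bdry Ux x0).
by rewrite /= mxE => ->; rewrite !mxE.
Qed.

Let sum_D_r (X : 'I_n.+1 -> R) : \sum_e X e * D e r x = rho * X ord0.
Proof.
under eq_bigr => e _ do rewrite D_r (eq_sym e) mulrA.
by rewrite (sum_delta (fun e => X e * rho)) mulrC.
Qed.

(** Since H = 0 at x, the second derivatives of r there are Christoffel symbols, and
the derivative of H is a third derivative of r minus a half of the curvature form
applied to dr. *)
Let dm_hessE a b c : dm a H x b c = D a (D b (D c r)) x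
  - rho * (dm a (fun z => A z b) x + A x b *m A x a) c ord0.
Proof.
have rC1 : Ck HS U 1 r by exact: Ck_leq rC.
have D2 e : D a (D e r) x = rho * A x a e ord0.
  have := congr1 (fun M : 'M[R]_n.+1 => M a e) (H0 Ux x0); rewrite /= hessE [RHS]mxE => /eqP.
  by rewrite subr_eq0 => /eqP ->; rewrite sum_D_r.
rewrite dmxE; apply: (has_partialE (Uo.1 _ Ux)).
have K : has_partial a (fun z => D b (D c r) z + - (\sum_e A z b c e * D e r z)) x
    (D a (D b (D c r)) x
     + - (\sum_e (D a (fun z => A z b c e) x * D e r x + A x b c e * D a (D e r) x))).
  apply: has_partialD; first exact: (Ck_has_partial a (Ck_partial b (Ck_partial c rC)) Ux).
  apply/has_partialN/has_partial_sum => e _; apply: has_partialM.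
    exact: (Ck_has_partial a (conn_Ck Uo gU gC b c e) Ux).
  exact: (Ck_has_partial a (Ck_partial e (CkW rC)) Ux).
have -> : D a (D b (D c r)) x - rho * (dm a (fun z => A z b) x + A x b *m A x a) c ord0 =
  D a (D b (D c r)) x
     + - (\sum_e (D a (fun z => A z b c e) x * D e r x + A x b c e * D a (D e r) x)).
  rewrite big_split /= sum_D_r addmx_ij dmxE mulrDr mulmx_ij; congr (_ - (_ + _)).
  by rewrite mulr_sumr; apply: eq_bigr => e _; rewrite D2 mulrCA.
by apply: (eq_has_partial Uo Ux _ K) => z Uz; rewrite hessE.
Qed.

(** The identity of Ricci for third covariant derivatives of r: antisymmetrizing
[dm_hessE] in a and b removes the third derivatives and leaves the curvature
paired with dr, which is a multiple of the covector of index [ord0]. *)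
Lemma curv_normal a b c :
  F x a b c ord0 = (b == ord0)%:R * Q a c - (a == ord0)%:R * Q b c.
Proof.
have rn := normal_neq0 Ux x0.
apply: (mulfI rn).
have -> : F x a b c ord0 = (dm a (fun z => A z b) x + A x b *m A x a) c ord0 -
     (dm b (fun z => A z a) x + A x a *m A x b) c ord0.
  by rewrite curv.unlock !(addmx_ij, oppmx_ij); ring.
have E1 := dm_hessE a b c; have E2 := dm_hessE b a c.
rewrite (Ck_schwarz a b Uo (Ck_partial c rC) Ux) in E1.
rewrite !dm_hess !scalemx_ij in E1 E2.
have swap (X p q : R) : rho * (p - q) = (X - rho * q) - (X - rho * p) by ring.
rewrite (swap (D b (D a (D c r)) x)) -E1 -E2.
by rewrite !scalemx_ij; ring.
Qed.

(** The slope of the identity [hess_gradient] along the normal direction. *)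
Let Qv : forall a, \sum_b Q a b * v x 0 b = 0.
Proof.
move=> a.
have vC b : Ck HS U 1 (fun z => v z 0 b).
  have drC : Ck_mx 1 U (dr r).
    by move=> i j; under eq_fun do rewrite mxE; apply: Ck_partial; exact: CkW.
  have giC : Ck_mx 1 U (fun z => invmx (g z)) by apply: Ck_mx_inv => //; exact: Ck_mxW.
  exact: (Ck_mx_mul Uo drC giC 0 b).
have K : has_partial ord0 (fun z => \sum_b H z a b * v z 0 b) x
   (\sum_b (D ord0 (fun z => H z a b) x * v x 0 b + H x a b * D ord0 (fun z => v z 0 b) x)).
  apply: has_partial_sum => b _; apply: has_partialM.
    exact: (Ck_has_partial ord0 (HC a b) Ux).
  exact: (Ck_has_partial ord0 (vC b) Ux).
have K0 : has_partial ord0 (fun z => \sum_b H z a b * v z 0 b) x 0.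
  by apply: (eq_has_partial Uo Ux _ (has_partial_cst ord0 0 x)) => z Uz; rewrite hess_gradient.
have := has_partialE (Uo.1 _ Ux) K; rewrite (has_partialE (Uo.1 _ Ux) K0) => E.
have : rho^-1 * \sum_b (D ord0 (fun z => H z a b) x * v x 0 b + H x a b * D ord0 (fun z => v z 0 b) x) = 0.
  by rewrite -E mulr0.
move=> E'; rewrite -[RHS]E' mulr_sumr; apply: eq_bigr => b _.
by rewrite scalemx_ij dmxE (H0 Ux x0) [X in _ + X * _]mxE mul0r addr0 mulrA.
Qed.

Let vE : v x = rho *: row 0 (invmx (g x)).
Proof. by rewrite /v dr_bdry // -scalemxAl rowE. Qed.

Lemma trace_split_slope : \tr (invmx (g x) *m Q) =
  \tr (invmx (tangential (g x)) *m tangential Q).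
Proof.
rewrite (trace_split Q (gS Ux) (gU Ux) (posdef_unitmx (posdef_tangential (gp Ux))) (normal_unit Ux x0)).
rewrite -vE [X in _ + X](_ : _ = 0) ?addr0 // inner_row; apply: big1 => i _.
under eq_bigr => j _ do rewrite -mulrA.
by rewrite -mulr_sumr Qv mulr0.
Qed.

(** Contract [curv_normal]; the antisymmetry of the curvature moves the normal vector
v to the index where that lemma applies, and Q annihilates v. *)
Lemma ricci_normal : inner (ricci HS g x) (v x) (v x) = - \tr (invmx (g x) *m Q).
Proof.
have Gs i j := sym_entry i j (invmx_sym (gS Ux)).
have ve i : v x 0 i = rho * invmx (g x) 0 i by rewrite vE !mxE.
have FG a b c d : \sum_e invmx (g x) c e * F x a b e d = - \sum_e F x a b e c * invmx (g x) e d.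
  have := curv_antisym Uo gS gU a b Ux gC => /(congr1 (fun M => invmx (g x) *m M *m invmx (g x))).
  rewrite mulmx0 mul0mx mulmxDr mulmxDl !mulmxA mulVmx ?gU // mul1mx.
  rewrite -!mulmxA mulmxV ?gU // mulmx1 => /(congr1 (fun M : 'M[R]_n.+1 => M c d)).
  rewrite addmx_ij [RHS]mxE !mulmx_ij => /eqP; rewrite addr_eq0 => /eqP ->.
  by congr (- _); apply: eq_bigr => e _; rewrite trmx_ij.
have vF a b : \sum_c v x 0 c * F x a b c a = - rho * ((b == ord0)%:R * (\sum_c Q a c * invmx (g x) c a)
     - (a == ord0)%:R * (\sum_c Q b c * invmx (g x) c a)).
  under eq_bigr => c _ do rewrite ve -mulrA.
  rewrite -mulr_sumr FG mulNr mulrN; congr (- (_ * _)).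
  rewrite !mulr_sumr -sumrB; apply: eq_bigr => c _; rewrite curv_normal; ring.
rewrite inner_row.
have E b : \sum_c v x 0 b * ricci HS g x b c * v x 0 c =
    v x 0 b * (- rho * ((b == ord0)%:R * \tr (invmx (g x) *m Q))).
  under eq_bigr => c _ do rewrite -mulrA.
  rewrite -mulr_sumr; congr (_ * _).
  under eq_bigr => c _ do rewrite ricciE mulr_suml.
  rewrite exchange_big /=.
  transitivity (\sum_a - rho * ((b == ord0)%:R * (\sum_c Q a c * invmx (g x) c a)
     - (a == ord0)%:R * (\sum_c Q b c * invmx (g x) c a))).
    by apply: eq_bigr => a _; rewrite -vF; apply: eq_bigr => c _; rewrite mulrC.
  rewrite -mulr_sumr sumrB -mulr_sumr; congr (_ * _).
  have -> : \sum_(i < n.+1) (i == ord0)%:R * (\sum_c Q b c * invmx (g x) c i) = 0.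
    rewrite big_ord_recl [X in _ + X]big1 ?addr0 => [|i _]; last by rewrite mul0r.
    rewrite mul1r; apply: (mulfI (normal_neq0 Ux x0)); rewrite mulr0 -[RHS](Qv b) mulr_sumr.
    by apply: eq_bigr => c _; rewrite ve (Gs c ord0) mulrCA.
  rewrite subr0; congr (_ * _); rewrite mxtrace_mulC /mxtrace; apply: eq_bigr => a _.
  by rewrite mulmx_ij.
under eq_bigr => b _ do rewrite E.
rewrite big_ord_recl [X in _ + X]big1 ?addr0 => [|i _]; last by rewrite mul0r !mulr0.
rewrite ve mul1r -[RHS]mul1r -(normal_unit Ux x0); ring.
Qed.

(** The boundary is totally geodesic: r is constant on it, so its second fundamental
form is a multiple of the tangential part of H. *)
Let conn_normal z (a b : 'I_n) : U z -> z 0 ord0 = 0 -> A z (lift ord0 a) (lift ord0 b) ord0 = 0.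
Proof.
move=> Uz z0; have := congr1 (fun M : 'M[R]_n.+1 => M (lift ord0 a) (lift ord0 b)) (H0 Uz z0).
rewrite hessE [RHS]mxE.
have -> : D (lift ord0 a) (D (lift ord0 b) r) z = 0.
  apply: (partial_tangential0 _ Uo Uz z0) => y Uy y0.
  exact: (partial_tangential0 _ Uo Uy y0 r0).
rewrite sub0r big_ord_recl [X in _ + X]big1 => [|i _].
  rewrite addr0 => /eqP; rewrite oppr_eq0 mulf_eq0 (negbTE (normal_neq0 Uz z0)) orbF.
  by move/eqP.
by rewrite (partial_tangential0 _ Uo Uz z0 r0) mulr0.
Qed.

Local Notation gh := (fun y : 'rV[R]_n => tangential (g (hpt 0 y))).
Local Notation ST := [set: 'rV[R]_n].

Let hpt_bdry (z : V) : z 0 ord0 = 0 -> hpt 0 (col' ord0 z) = z.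
Proof. by move=> z0; rewrite -{2}(hpt_col' z) z0. Qed.

(** The tangential entries of the ambient connection satisfy the two properties that
characterize the connection of the boundary metric; compatibility is where the
normal entries must vanish. *)
Let conn_tangential z a b c : U z -> z 0 ord0 = 0 ->
  conn ST gh (col' ord0 z) a b c = A z (lift ord0 a) (lift ord0 b) (lift ord0 c).
Proof.
move=> Uz z0; have zE := hpt_bdry z0.
pose B a' : 'M[R]_n := tangential (A z (lift ord0 a')).
suff <- : B a = conn ST gh (col' ord0 z) a by rewrite tangential_ij.
apply: conn_unique.
- by rewrite zE tangential_sym // gS.
- by rewrite zE; apply/posdef_unitmx/posdef_tangential/gp.
- by move=> a' b' c'; rewrite !tangential_ij (connC Uo gS _ _ _ Uz (Ck_mxW gC)).
- move=> a'; rewrite zE; apply/matrixP => b' c'.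
  have -> : dmx ST a' gh (col' ord0 z) b' c' = dm (lift ord0 a') g z (lift ord0 b') (lift ord0 c').
    rewrite !dmxE.
    under eq_fun do rewrite tangential_ij.
    by rewrite (partial_hpt (fun y => g y (lift ord0 b') (lift ord0 c'))) zE.
  rewrite -(conn_metric Uo gS gU _ Uz (Ck_mxW gC)) !addmx_ij !mulmx_ij !big_ord_recl.
  rewrite trmx_ij !conn_normal // mul0r mulr0 !add0r.
  by congr (_ + _); apply: eq_bigr => e _; rewrite ?trmx_ij !tangential_ij.
Qed.

(** The Gauss equation for a vanishing second fundamental form. Only tangential
derivatives of the connection occur, and these see boundary values alone. *)
Let curv_tangential a b c d : curv ST gh (col' ord0 x) a b c d =
  F x (lift ord0 a) (lift ord0 b) (lift ord0 c) (lift ord0 d).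
Proof.
have dE a' b' : dmx ST a' (fun y => conn ST gh y b') (col' ord0 x) c d =
    dm (lift ord0 a') (fun z => A z (lift ord0 b')) x (lift ord0 c) (lift ord0 d).
  rewrite !dmxE.
  have -> : (fun y => conn ST gh y b' c d) = (fun y => conn ST gh (col' ord0 (hpt 0 y)) b' c d).
    by apply/funext => y; rewrite col'_hpt.
  rewrite (partial_hpt (fun z => conn ST gh (col' ord0 z) b' c d)) (hpt_bdry x0).
  apply: (has_partialE (Uo.1 _ Ux)).
  apply: (has_partial_tangential Uo Ux x0 (f := fun z => A z (lift ord0 b') (lift ord0 c) (lift ord0 d))).
    by move=> z Uz z0; rewrite conn_tangential.
  exact: (Ck_has_partial _ (conn_Ck Uo gU gC _ _ _) Ux).
have AA a' b' : (conn ST gh (col' ord0 x) a' *m conn ST gh (col' ord0 x) b') c d =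
   (A x (lift ord0 a') *m A x (lift ord0 b')) (lift ord0 c) (lift ord0 d).
  rewrite !mulmx_ij big_ord_recl conn_normal // mul0r add0r.
  by apply: eq_bigr => e _; rewrite !conn_tangential.
by rewrite !curv.unlock !(addmx_ij, oppmx_ij) !dE !AA.
Qed.

(** The tangential terms of the contraction give the Ricci tensor of the boundary, the
normal one is evaluated by [curv_normal]. *)
Lemma ricci_tangential :
  tangential (ricci HS g x) = ricci ST gh (col' ord0 x) - tangential Q.
Proof.
apply/matrixP => b c; rewrite tangential_ij !(addmx_ij, oppmx_ij) !ricciE tangential_ij.
rewrite big_ord_recl curv_normal eqxx mul1r.
have -> : (lift ord0 b == ord0) = false by rewrite eq_sym (negbTE (neq_lift _ _)).
rewrite mul0r sub0r addrC; congr (_ - _).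
by apply: eq_bigr => a _; rewrite curv_tangential.
Qed.

Definition limit_tensor : 'M[R]_n.+1 :=
  ricci HS g x + ((n%:R - 1) *: Q + \tr (invmx (g x) *m Q) *: g x).

Lemma limit_tensor_tangential : tangential limit_tensor = ricci ST gh (col' ord0 x)
  + (n%:R - 2) *: tangential Q
  + \tr (invmx (tangential (g x)) *m tangential Q) *: tangential (g x).
Proof.
rewrite -trace_split_slope; have := ricci_tangential; set RH := ricci ST _ _.
rewrite /limit_tensor; move: hess_slope (ricci HS g x) => q ric E.
apply/matrixP => a b; rewrite !(addmx_ij, scalemx_ij, tangential_ij).
have := congr1 (fun M : 'M[R]_n => M a b) E.
rewrite /= !(addmx_ij, oppmx_ij, tangential_ij) => ->; ring.
Qed.

(** The normal component of [limit_tensor] is - tr Q + 0 + tr Q. *)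
Lemma limit_tensor_trace : \tr (invmx (g x) *m limit_tensor) =
  \tr (invmx (tangential (g x)) *m tangential limit_tensor).
Proof.
rewrite (trace_split limit_tensor (gS Ux) (gU Ux) (posdef_unitmx (posdef_tangential (gp Ux))) (normal_unit Ux x0)).
have expand (q : 'M[R]_n.+1) c d w : inner (ricci HS g x + (c *: q + d *: g x)) w w =
    inner (ricci HS g x) w w + (c * inner q w w + d * inner (g x) w w).
  by rewrite !inner_mxD !inner_mxZ.
rewrite -vE /limit_tensor expand ricci_normal.
have -> : inner Q (v x) (v x) = 0.
  rewrite inner_row; apply: big1 => i _.
  under eq_bigr => j _ do rewrite -mulrA.
  by rewrite -mulr_sumr Qv mulr0.
have -> : inner (g x) (v x) (v x) = 1.
  rewrite -(unit_grad Ux) /inner /v mulmxKV ?gU // trmx_mul invmx_sym ?gS //.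
  by rewrite mulmxA.
by rewrite mulr0 mulr1 add0r addNr addr0.
Qed.

End BoundaryGeometry.

(** * Taylor coefficients from one-sided limits *)

Section Expansion.
Context {R : realType}.
Implicit Types (h : R -> R) (p q l K : R).

Lemma remainder_cvg0 h K (k : nat) : (\forall t \near (0 : R)^'+, `|h t| <= K * t ^+ k.+1) ->
  h t @[t --> (0 : R)^'+] --> (0 : R).
Proof.
move=> H.
have c0 : t @[t --> (0 : R)^'+] --> (0 : R).
  by apply: cvg_trans (cvg_within _) _; exact: cvg_id.
pose proof (cvgM (cvg_cst `|K|) c0) as ck; rewrite mulr0 in ck.
pose proof (cvgN ck) as ckN; rewrite oppr0 in ckN.
apply: (squeeze_cvgr _ ckN ck).
near=> t; rewrite -ler_norml /=.
have t0 : 0 < t by near: t; exact: nbhs_right_gt.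
have t1 : t < 1 by near: t; exact: nbhs_right_lt.
apply: (@le_trans _ _ (K * t ^+ k.+1)); first by near: t.
have tk : 0 <= t ^+ k.+1 by rewrite exprn_ge0 // ltW.
apply: le_trans (ler_wpM2r tk (ler_norm K)) _.
apply: ler_wpM2l => //; rewrite exprS ler_piMr ?(ltW t0) //.
by rewrite exprn_ile1 ?ltW.
Unshelve. all: by end_near.
Qed.

Lemma first_coefficient h p q K l :
  h t / t @[t --> (0 : R)^'+] --> l ->
  (\forall t \near (0 : R)^'+, `|h t - (p * t + q * t ^+ 2)| <= K * t ^+ 3) -> p = l.
Proof.
move=> Hl HK.
have c0 : t @[t --> (0 : R)^'+] --> (0 : R).
  by apply: cvg_trans (cvg_within _) _; exact: cvg_id.
have E : (h t - (p * t + q * t ^+ 2)) / t @[t --> (0 : R)^'+] --> (0 : R).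
  apply: (@remainder_cvg0 _ K 1).
  apply: filterS2 (nbhs_right_gt 0) HK => t t0 Ht.
  by rewrite normrM normfV (gtr0_norm t0) ler_pdivrMr // -mulrA -exprSr.
have E2 : p + q * t @[t --> (0 : R)^'+] --> p.
  pose proof (cvgD (cvg_cst p) (cvgM (cvg_cst q) c0)) as E2.
  by rewrite mulr0 addr0 in E2.
have E3 : h t / t @[t --> (0 : R)^'+] --> p.
  pose proof (cvgD E E2) as E4; rewrite add0r in E4.
  apply: cvg_trans E4; apply: near_eq_cvg; apply: filterS (nbhs_right_gt 0) => t t0.
  by rewrite ?fctE /=; field; rewrite gt_eqF.
exact: (cvg_unique (@Rhausdorff R) E3 Hl).
Qed.

Lemma second_coefficient h p q K l :
  h t / t ^+ 2 @[t --> (0 : R)^'+] --> l ->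
  (\forall t \near (0 : R)^'+, `|h t - (p * t + q * t ^+ 2)| <= K * t ^+ 3) ->
  p = 0 /\ q = l.
Proof.
move=> Hl HK.
have c0 : t @[t --> (0 : R)^'+] --> (0 : R).
  by apply: cvg_trans (cvg_within _) _; exact: cvg_id.
have p0 : p = 0.
  apply: (first_coefficient _ HK).
  pose proof (cvgM Hl c0) as E; rewrite mulr0 in E.
  apply: cvg_trans E; apply: near_eq_cvg; apply: filterS (nbhs_right_gt 0) => t t0.
  by rewrite ?fctE /=; field; rewrite gt_eqF.
split=> //.
have E : (h t - (p * t + q * t ^+ 2)) / t ^+ 2 @[t --> (0 : R)^'+] --> (0 : R).
  apply: (@remainder_cvg0 _ K 0).
  apply: filterS2 (nbhs_right_gt 0) HK => t t0 Ht.
  by rewrite normrM normfV (gtr0_norm (exprn_gt0 2 t0)) ler_pdivrMr ?exprn_gt0 // expr1 -mulrA -exprS.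
have E3 : h t / t ^+ 2 @[t --> (0 : R)^'+] --> q.
  pose proof (cvgD E (cvg_cst q)) as E4; rewrite add0r in E4.
  apply: cvg_trans E4; apply: near_eq_cvg; apply: filterS (nbhs_right_gt 0) => t t0.
  by rewrite ?fctE /= p0; field; rewrite gt_eqF.
exact: (cvg_unique (@Rhausdorff R) E3 Hl).
Qed.

End Expansion.

(** * The metric along the gradient flow *)

Section Flow.
Context {R : realType} {n : nat}.
Local Notation V := 'rV[R]_n.+1.
Local Notation HS := (halfspace R n).
Local Notation D := (partial HS).
Local Notation dm := (dmx HS).
Variables (U : set V) (g : V -> 'M[R]_n.+1) (r : V -> R).
Hypotheses (Uo : ropen U) (gC : Ck_mx 2 U g) (rC : Ck HS U 3 r).
Hypotheses (gS : forall z, U z -> (g z)^T = g z) (gp : forall z, U z -> posdef (g z)).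
Hypothesis r0 : forall z, U z -> z 0 ord0 = 0 -> r z = 0.
Hypothesis unit_grad : forall z, U z -> inner (invmx (g z)) (dr r z) (dr r z) = 1.
Local Notation A := (conn HS g).
Local Notation H := (hess g r).

Let gU z : U z -> g z \in unitmx. Proof. by move=> Uz; exact: posdef_unitmx (gp Uz). Qed.

Definition grad_field (z : V) : V := dr r z *m invmx (g z).
Local Notation X := grad_field.

Lemma grad_field_Ck : Ck_mx 2 U X.
Proof.
have drC : Ck_mx 2 U (dr r).
  by move=> i j; under eq_fun do rewrite mxE; exact: Ck_partial.
exact: (Ck_mx_mul Uo drC (Ck_mx_inv Uo gU gC)).
Qed.

Definition grad_jac (z : V) : 'M[R]_n.+1 := \matrix_(d, c) D d (fun w => X w 0 c) z.

(** The Lie derivative of the metric along the gradient of r is twice the Hessian,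
written in coordinates. *)
Lemma lie_metric z : U z ->
  grad_jac z *m g z + g z *m (grad_jac z)^T + \sum_c X z 0 c *: dm c g z = 2 *: H z.
Proof.
move=> Uz; have gC1 := Ck_mxW gC; have gs i j := sym_entry i j (gS Uz).
have XC := Ck_mxW grad_field_Ck.
have Xg y : U y -> X y *m g y = dr r y by move=> Uy; rewrite /X mulmxKV // gU.
have E1 d e : (grad_jac z *m g z) d e = D d (D e r) z - \sum_f X z 0 f * dm d g z f e.
  have : dm d X z *m g z + X z *m dm d g z = dm d (dr r) z.
    by rewrite -(dmxM d Uo Uz XC gC1); apply: (eq_dmx d Uo Uz Xg); exact: Ck_mx_mul.
  move=> /(congr1 (fun M : 'rV[R]_n.+1 => M 0 e)); rewrite /= addmx_ij !mulmx_ij dmxE.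
  have -> : (fun y => dr r y 0 e) = D e r by apply/funext => y; rewrite mxE.
  move=> <-; rewrite addrK; apply: eq_bigr => f _; congr (_ * _).
  by rewrite dmxE mxE.
pose L d e f := (A z d *m g z) e f.
have LS d e f : L d e f = L e d f.
  by rewrite /L !mulmx_ij; apply: eq_bigr => i _; rewrite (connC Uo gS _ _ _ Uz gC1).
have dgE a b c : dm a g z b c = L a b c + L a c b.
  rewrite -(conn_metric Uo gS gU a Uz gC1) addmx_ij; congr (_ + _).
  by rewrite /L !mulmx_ij; apply: eq_bigr => i _; rewrite trmx_ij mulrC gs.
apply/matrixP => d e; rewrite !addmx_ij scalemx_ij summxE.
have -> : (g z *m (grad_jac z)^T) d e = (grad_jac z *m g z) e d.
  by rewrite !mulmx_ij; apply: eq_bigr => i _; rewrite trmx_ij mulrC gs.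
rewrite !E1 hessE (Ck_schwarz e d Uo (CkW rC) Uz).
have -> : \sum_c A z d e c * D c r z = \sum_f X z 0 f * L d e f.
  have drE c : D c r z = \sum_f X z 0 f * g z f c by rewrite -mulmx_ij Xg // mxE.
  under eq_bigr => c _ do rewrite drE mulr_sumr.
  rewrite exchange_big /=; apply: eq_bigr => f _; rewrite /L (mulmx_ij (A z d) (g z)) mulr_sumr.
  by apply: eq_bigr => c _; rewrite (gs f c) mulrCA.
have -> : \sum_c (X z 0 c *: dm c g z) d e = \sum_f X z 0 f * dm f g z d e.
  by apply: eq_bigr => f _; rewrite scalemx_ij.
have S : \sum_f X z 0 f * dm d g z f e + \sum_f X z 0 f * dm e g z f d
    - \sum_f X z 0 f * dm f g z d e = 2 * \sum_f X z 0 f * L d e f.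
  rewrite -big_split -sumrB mulr_sumr; apply: eq_bigr => f _ /=.
  by rewrite !dgE (LS f d) (LS f e) (LS e d); ring.
by rewrite mulrBr -S; ring.
Qed.

Variables (W : set V) (Phi : V -> V).
Hypotheses (Wo : ropen W) (PhiC : forall c, Ck HS W 2 (fun x => Phi x 0 c)).
Hypothesis WU : forall x, W x -> U (Phi x).
Hypothesis flow : forall x c, W x -> D ord0 (fun w => Phi w 0 c) x = X (Phi x) 0 c.
Hypothesis Phi0 : forall x, W x -> x 0 ord0 = 0 -> Phi x = x.

(** Only the tangential rows of the Jacobian of the collar map enter the metrics g_t;
the collar coordinates are the time t, at index [ord0], and a point of the
boundary. *)
Definition tan_jac (x : V) : 'M[R]_(n, n.+1) :=
  \matrix_(a, c) D (lift ord0 a) (fun w => Phi w 0 c) x.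
Local Notation J := tan_jac.

Let PhiC1 c : Ck HS W 1 (fun x => Phi x 0 c). Proof. exact: CkW. Qed.

Let JC : Ck_mx 1 W J.
Proof. by move=> a c; under eq_fun do rewrite mxE; exact: Ck_partial. Qed.

Let comp_C1 p q (M : V -> 'M[R]_(p, q)) : Ck_mx 1 U M -> Ck_mx 1 W (fun w => M (Phi w)).
Proof. by move=> HM; exact: (Ck_mx_comp Uo Wo WU HM PhiC1). Qed.

(** The linearized flow equation. It exchanges two derivatives of Phi, and class C^2
of the collar map is just enough for this. *)
Let dm_tan_jac x : W x -> dm ord0 J x = J x *m grad_jac (Phi x).
Proof.
move=> Wx; apply/matrixP => a c; rewrite dmxE mulmx_ij.
have -> : (fun z => J z a c) = D (lift ord0 a) (fun w => Phi w 0 c).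
  by apply/funext => z; rewrite mxE.
rewrite (Ck_schwarz ord0 (lift ord0 a) Wo (PhiC c) Wx).
have XC : Ck HS U 1 (fun w => X w 0 c) := Ck_mxW grad_field_Ck 0 c.
transitivity (D (lift ord0 a) (fun w => X (Phi w) 0 c) x).
  apply: (eq_partial Wo Wx) => [z Wz|]; first exact: flow.
  exact: (has_partial_diff (Ck_has_partial _ (Ck_partial _ (PhiC c)) Wx)).
apply: (has_partialE (Wo.1 _ Wx)).
under eq_bigr => d _ do rewrite mxE mulrC [grad_jac _ _ _]mxE.
apply: (has_partial_comp Uo XC Wo Wx WU) => d; exact: (Ck_has_partial _ (PhiC1 d) Wx).
Qed.

Definition pulled_metric x : 'M[R]_n := J x *m g (Phi x) *m (J x)^T.
Definition pulled_hess x : 'M[R]_n := J x *m H (Phi x) *m (J x)^T.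

Lemma pulled_metric_Ck : Ck_mx 1 W pulled_metric.
Proof.
apply: Ck_mx_mul => //; last exact: Ck_mx_tr.
by apply: Ck_mx_mul => //; apply: comp_C1; exact: Ck_mxW.
Qed.

Lemma pulled_hess_Ck : Ck_mx 0 W pulled_hess.
Proof.
have HC : Ck_mx 1 U H by exact: hess_Ck.
have JC0 := Ck_mxW JC.
apply: Ck_mx_mul => //; last exact: Ck_mx_tr.
by apply: Ck_mx_mul => //; exact: (Ck_mxW (comp_C1 HC)).
Qed.

(** The derivative of a metric pulled back by a flow is the pull-back of its Lie
derivative. *)
Lemma flow_metric x : W x -> dm ord0 pulled_metric x = 2 *: pulled_hess x.
Proof.
move=> Wx; have Uy := WU Wx; have gC1 := Ck_mxW gC; have gPC := comp_C1 gC1.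
rewrite /pulled_metric (dmxM ord0 Wo Wx (Ck_mx_mul Wo JC gPC) (Ck_mx_tr JC)).
rewrite (dmxM ord0 Wo Wx JC gPC) dmx_tr dm_tan_jac //.
rewrite (dmx_comp ord0 Uo Wo Wx WU gC1 PhiC1).
have -> : \sum_c D ord0 (fun z => Phi z 0 c) x *: dm c g (Phi x) =
   2 *: H (Phi x) - (grad_jac (Phi x) *m g (Phi x) + g (Phi x) *m (grad_jac (Phi x))^T).
  rewrite -(lie_metric Uy) [X in _ = X]addrAC subrr add0r.
  by apply: eq_bigr => c _; rewrite flow.
rewrite /pulled_hess scalemxAl scalemxAr trmx_mul.
rewrite !(mulmxDl, mulmxDr, mulNmx, mulmxN, mulmxA); mx_abel.
Qed.

(** Along the flow r grows at the rate |dr|^2 = 1. *)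
Lemma flow_param t x : W x -> x 0 ord0 = 0 -> 0 <= t ->
  (forall s, 0 <= s <= t -> W (x + s *: delta_mx 0 ord0)) ->
  r (Phi (x + t *: delta_mx 0 ord0)) = t.
Proof.
move=> Wx x0 t0 seg.
have [s Hs] : exists2 s, 0 <= s <= t &
   r (Phi (x + t *: delta_mx 0 ord0)) - r (Phi x) = 1 * t.
  apply: (@line_mvt _ _ ord0 (fun w => r (Phi w)) (fun=> 1) x t (Wo.1 _ Wx) t0) => s Hs.
  have Wy := seg s Hs; set y := x + _ in Wy *.
  have -> : 1 = \sum_c D c r (Phi y) * X (Phi y) 0 c.
    rewrite -(unit_grad (WU Wy)) /inner mulmx_ij; apply: eq_bigr => c _.
    by rewrite trmx_ij [dr _ _ _ _]mxE mulrC.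
  apply: (has_partial_comp Uo (Ck_leq (isT : (1 <= 3)%N) rC) Wo Wy WU) => c.
  by rewrite -flow //; exact: (Ck_has_partial ord0 (PhiC1 c) Wy).
by rewrite (Phi0 Wx x0) (r0 _ x0) ?subr0 ?mul1r // -(Phi0 Wx x0); exact: WU.
Qed.

Lemma tan_jac_bdry x a c : W x -> x 0 ord0 = 0 -> J x a c = (lift ord0 a == c)%:R.
Proof.
move=> Wx x0; rewrite mxE; apply: (has_partialE (Wo.1 _ Wx)).
apply: (has_partial_tangential Wo Wx x0 (f := fun z => z 0 c)).
  by move=> z Wz z0; rewrite Phi0.
have K : (fun=> (lift ord0 a == c)%:R : R) h @[h --> steps (lift ord0 a) x]
    --> ((lift ord0 a == c)%:R : R) by exact: cvg_cst.
apply: cvg_trans K; apply: near_eq_cvg.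
apply: filterS (@steps_neq0 _ _ (lift ord0 a) x) => h h0.
by rewrite !mxE /= addrAC subrr add0r mulrA mulVf // mul1r eq_sym.
Qed.

(** The flow starts at the identity, so at time 0 its Jacobian is the inclusion of the
tangential directions. *)
Lemma pulled_bdry (M : 'M[R]_n.+1) x : W x -> x 0 ord0 = 0 ->
  J x *m M *m (J x)^T = tangential M.
Proof.
move=> Wx x0; apply/matrixP => a b; rewrite tangential_ij mulmx_ij.
under eq_bigr => c _ do rewrite trmx_ij tan_jac_bdry //.
rewrite sum_delta mulmx_ij.
under eq_bigr => c _ do rewrite tan_jac_bdry // mulrC.
exact: sum_delta.
Qed.

Section AtBoundaryPoint.
Variable x : V.
Hypotheses (Wx : W x) (x0 : x 0 ord0 = 0).
Local Notation ray t := (x + t *: delta_mx 0 ord0).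

Let Ux : U x. Proof. by rewrite -(Phi0 Wx x0); exact: WU. Qed.

Let ray_HS t : 0 <= t -> HS (ray t).
Proof. by move=> t0; apply: halfspace_step => //; exact: Wo.1. Qed.

Let ray_near (P : V -> Prop) : (\forall z \near x, W z -> P z) ->
  exists2 e : R, 0 < e & forall s, 0 <= s < e -> W (ray s) /\ P (ray s).
Proof.
move=> HP; have : \forall z \near x, HS z -> W z /\ P z.
  by apply: filterS2 (Wo.2 _ Wx) HP => z h1 h2 h3; split; [exact: h1|exact: h2 (h1 h3)].
move=> /nbhs_rowP[e e0 He]; exists e => // s /andP[s0 se].
apply: He => [c|]; last exact: ray_HS.
rewrite !mxE /= addrAC subrr add0r; case: (c == ord0); last by rewrite mulr0 normr0.
by rewrite mulr1 ger0_norm.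
Qed.

Let ray_in : exists2 e : R, 0 < e & forall s, 0 <= s < e -> W (ray s).
Proof.
have K : \forall z \near x, W z -> (fun=> True) z by apply: filterS (Wo.2 _ Wx).
have [e e0 He] := ray_near K.
by exists e => // s /He[].
Qed.

Let near0 (e : R) (P : R -> Prop) : 0 < e -> (forall t, 0 < t < e -> P t) ->
  \forall t \near (0 : R)^'+, P t.
Proof.
move=> e0 H; apply: filterS2 (nbhs_right_gt 0) (nbhs_right_lt e0) => t t0 te.
by apply: H; rewrite t0.
Qed.

Variable w : 'rV[R]_n.
Let h t := inner (pulled_metric (ray t)) w w - inner (tangential (g x)) w w.
Let dh t := 2 * inner (pulled_hess (ray t)) w w.

Let h_partial t l : 0 <= t -> W (ray t) ->
  has_partial ord0 (fun z => inner (pulled_metric z) w w - l * (z 0 ord0) ^+ 2) (ray t)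
    (dh t - 2 * l * t).
Proof.
move=> t0 Wt; have rt : (ray t) 0 ord0 = t by rewrite !mxE /= x0 add0r mulr1.
have K1 : has_partial ord0 (fun z => inner (pulled_metric z) w w) (ray t) (dh t).
  have -> : (fun z => inner (pulled_metric z) w w) =
     (fun z => \sum_i \sum_j w 0 i * pulled_metric z i j * w 0 j).
    by apply/funext => z; rewrite inner_row.
  rewrite /dh inner_row mulr_sumr; apply: has_partial_sum => i _.
  rewrite mulr_sumr; apply: has_partial_sum => j _.
  have dp : has_partial ord0 (fun z => pulled_metric z i j) (ray t) (2 * pulled_hess (ray t) i j).
    have := congr1 (fun M : 'M[R]_n => M i j) (flow_metric Wt).
    rewrite /= dmxE scalemx_ij => <-; exact: (Ck_has_partial ord0 (pulled_metric_Ck i j) Wt).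
  have := has_partialM (has_partialM (has_partial_cst ord0 (w 0 i) (ray t)) dp) (has_partial_cst ord0 (w 0 j) (ray t)).
  by rewrite mul0r add0r mulr0 addr0; congr (has_partial _ _ _ _); ring.
have K2 : has_partial ord0 (fun z : V => z 0 ord0) (ray t) 1.
  have K : (fun=> 1 : R) s @[s --> steps ord0 (ray t)] --> (1 : R) by exact: cvg_cst.
  apply: cvg_trans K; apply: near_eq_cvg.
  apply: filterS (@steps_neq0 _ _ ord0 (ray t)) => s s0.
  rewrite !mxE ?eqxx /=; field; exact: s0.
have := has_partialD K1 (has_partialN (has_partialM (has_partial_cst ord0 l (ray t)) (has_partialM K2 K2))).
by rewrite rt mul0r add0r; congr (has_partial _ _ _ _); ring.
Qed.

(** Subtracting l t^2 before applying the mean value theorem lets one estimate serve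
both orders: l = 0 gives the slope of h, and l = lim h t / t^2 its curvature. *)
Let h_mvt t l : 0 <= t -> (forall s, 0 <= s <= t -> W (ray s)) ->
  exists2 s, 0 <= s <= t & h t - l * t ^+ 2 = (dh s - 2 * l * s) * t.
Proof.
move=> t0 seg.
have dP s : 0 <= s <= t -> has_partial ord0
    (fun z => inner (pulled_metric z) w w - l * (z 0 ord0) ^+ 2) (ray s) (dh s - 2 * l * s).
  by move=> Hs; apply: h_partial; [case/andP: Hs|exact: seg].
have [s Hs E] := line_mvt (Wo.1 _ Wx) t0 dP.
exists s => //; rewrite -E /h.
have -> : (ray t) 0 ord0 = t by rewrite !mxE /= x0 add0r mulr1.
rewrite x0 /pulled_metric (pulled_bdry _ Wx x0) (Phi0 Wx x0); ring.
Qed.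

(** By [h_mvt] the quotient is a value of the derivative 2 H pulled back, which is
continuous up to time 0. *)
Lemma metric_slope : h t / t @[t --> (0 : R)^'+] --> 2 * inner (tangential (H x)) w w.
Proof.
have lim : dh 0 = 2 * inner (tangential (H x)) w w.
  by rewrite /dh scale0r addr0 /pulled_hess pulled_bdry // (Phi0 Wx x0).
rewrite -lim => P HP.
have cont : 2 * inner (pulled_hess z) w w @[z --> within W (nbhs x)] --> dh 0.
  rewrite /dh scale0r addr0; apply: cvgM; first exact: cvg_cst.
  under eq_fun do rewrite inner_row.
  rewrite inner_row; apply: cvg_bigsum => i _; apply: cvg_bigsum => j _.
  apply: cvgM; last exact: cvg_cst.
  apply: cvgM; first exact: cvg_cst.
  exact: (Ck_cvg (pulled_hess_Ck i j) Wx).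
have [e e0 He] := ray_near (cont _ HP).
apply: (near0 e0) => t /andP[t0 te].
have seg s : 0 <= s <= t -> W (ray s).
  by move=> /andP[s0 st]; apply: (He s _).1; rewrite s0 (le_lt_trans st).
have [s /andP[s0 st] E] := h_mvt 0 (ltW t0) seg.
change (P (h t / t)); rewrite mul0r subr0 in E.
rewrite E mulr0 mul0r subr0 mulfK ?gt_eqF //.
by apply: (He s _).2; rewrite s0 (le_lt_trans st).
Qed.

Hypothesis H0 : forall z, U z -> z 0 ord0 = 0 -> H z = 0.
Local Notation Q := (hess_slope g r x).

(** Flow lines leave the boundary at once, since r is positive on them and zero on the
boundary; so they may be inserted into limits taken through the interior. *)
Let ray_inner : Phi (ray s) @[s --> (0 : R)^'+] --> inner_nbhs U x.
Proof.
have cray : ray s @[s --> (0 : R)^'+] --> within W (nbhs x).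
  move=> P HP; have [e e0 He] := ray_near HP.
  by apply: (near0 e0) => s /andP[s0 se]; apply: (He s _).2; rewrite (ltW s0).
have cphi : Phi z @[z --> within W (nbhs x)] --> x.
  apply: cvg_row => c; rewrite -[in X in _ --> X](Phi0 Wx x0).
  exact: (Ck_cvg (PhiC1 c) Wx).
have lim : Phi (ray s) @[s --> (0 : R)^'+] --> x by move=> P HP; exact: (cray _ (cphi _ HP)).
move=> P HP.
have [e e0 He] := ray_in.
have N1 : \forall s \near (0 : R)^'+, U (Phi (ray s)) /\ 0 < Phi (ray s) 0 ord0.
  apply: (near0 e0) => s /andP[s0 se].
  have seg s' : 0 <= s' <= s -> W (ray s').
    by move=> /andP[s0' st]; apply: (He s' _); rewrite s0' (le_lt_trans st).
  have Ws : W (ray s) by apply: seg; rewrite (ltW s0) lexx.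
  split; first exact: WU.
  have ph : 0 <= Phi (ray s) 0 ord0 := Uo.1 _ (WU Ws).
  rewrite lt_def ph andbT; apply/eqP => E.
  have := flow_param Wx x0 (ltW s0) seg; rewrite r0 //; last exact: WU.
  by move=> s00; rewrite -s00 ltxx in s0.
have N2 : \forall s \near (0 : R)^'+, U (Phi (ray s)) /\ 0 < Phi (ray s) 0 ord0 -> P (Phi (ray s)).
  exact: (lim [set z | U z /\ 0 < z 0 ord0 -> P z] HP).
by apply: filterS2 N1 N2 => s h1 h2; exact: h2.
Qed.

(** On a flow line the parameter s equals r, so dividing by s is dividing H by r. *)
Let dh_slope : dh s / s @[s --> (0 : R)^'+] --> 2 * inner (tangential Q) w w.
Proof.
have cray : ray s @[s --> (0 : R)^'+] --> within W (nbhs x).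
  move=> P HP; have [e e0 He] := ray_near HP.
  by apply: (near0 e0) => s /andP[s0 se]; apply: (He s _).2; rewrite (ltW s0).
have cJ a c : J (ray s) a c @[s --> (0 : R)^'+] --> J x a c.
  by move=> P HP; exact: (cray _ (Ck_cvg (JC a c) Wx HP)).
have cH c d : H (Phi (ray s)) c d / s @[s --> (0 : R)^'+] --> Q c d.
  have K : H (Phi (ray s)) c d / r (Phi (ray s)) @[s --> (0 : R)^'+] --> Q c d.
    by move=> P HP; exact: (ray_inner (hess_slope_limit Uo gC rC gp r0 unit_grad Ux x0 H0 HP)).
  apply: cvg_trans K; apply: near_eq_cvg.
  have [e e0 He] := ray_in.
  apply: (near0 e0) => s /andP[s0 se]; rewrite flow_param ?(ltW s0) // => s' /andP[s0' st].
  by apply: (He s' _); rewrite s0' (le_lt_trans st).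
have cP a b : pulled_hess (ray s) a b / s @[s --> (0 : R)^'+] --> tangential Q a b.
  rewrite -(pulled_bdry Q Wx x0) mulmx_ij.
  have E s : pulled_hess (ray s) a b / s =
     \sum_d (\sum_c J (ray s) a c * (H (Phi (ray s)) c d / s)) * J (ray s) b d.
    rewrite /pulled_hess mulmx_ij mulr_suml; apply: eq_bigr => d _.
    rewrite trmx_ij mulmx_ij mulrAC; congr (_ * _); rewrite mulr_suml.
    by apply: eq_bigr => c _; rewrite mulrA.
  under eq_fun do rewrite E.
  apply: cvg_bigsum => d _; rewrite trmx_ij mulmx_ij; apply: cvgM => //.
  by apply: cvg_bigsum => c _; apply: cvgM.
have E s : dh s / s = 2 * \sum_i \sum_j w 0 i * (pulled_hess (ray s) i j / s) * w 0 j.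
  rewrite /dh inner_row -mulrA mulr_suml; congr (_ * _); apply: eq_bigr => i _.
  by rewrite mulr_suml; apply: eq_bigr => j _; ring.
under eq_fun do rewrite E.
rewrite inner_row; apply: cvgM; first exact: cvg_cst.
apply: cvg_bigsum => i _; apply: cvg_bigsum => j _; apply: cvgM; last exact: cvg_cst.
by apply: cvgM => //; exact: cvg_cst.
Qed.

(** The derivative of h is 2 l s + o(s), and h vanishes at 0. The argument uses a
single derivative of the pulled-back metric, the only one available. *)
Lemma metric_curve : h t / t ^+ 2 @[t --> (0 : R)^'+] --> inner (tangential Q) w w.
Proof.
set l := inner _ _ _.
apply/cvgrPdist_le => e e0.
have [d /= d0 Hd] : \forall s \near (0 : R)^'+, `|dh s / s - 2 * l| <= e.
  have /cvgrPdist_le/(_ e e0) := dh_slope.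
  by apply: filterS => s; rewrite distrC.
have dh0 : dh 0 = 0.
  rewrite /dh scale0r addr0 /pulled_hess (pulled_bdry _ Wx x0) (Phi0 Wx x0) (H0 Ux x0).
  rewrite inner_row big1 ?mulr0 // => i _; apply: big1 => j _.
  by rewrite tangential_ij mxE mulr0 mul0r.
have [e1 e10 He] := ray_in.
have m0 : 0 < Num.min d e1 by rewrite lt_min d0.
apply: (near0 m0) => t /andP[t0]; rewrite lt_min => /andP[td te].
have seg s : 0 <= s <= t -> W (ray s).
  by move=> /andP[s0 st]; apply: (He s _); rewrite s0 (le_lt_trans st).
have [s /andP[s0 st] E] := h_mvt l (ltW t0) seg.
have bound : `|dh s - 2 * l * s| <= e * t.
  have [->|sn0] := eqVneq s 0; first by rewrite dh0 mulr0 subr0 normr0 mulr_ge0 // ltW.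
  have sp : 0 < s by rewrite lt_def sn0.
  have -> : dh s - 2 * l * s = (dh s / s - 2 * l) * s by field.
  rewrite normrM (gtr0_norm sp); apply: ler_pM => //; apply: Hd => //=.
  by rewrite sub0r normrN gtr0_norm // (le_lt_trans st).
have -> : l - h t / t ^+ 2 = - ((h t - l * t ^+ 2) / t ^+ 2) by field; rewrite gt_eqF.
have -> : (h t - l * t ^+ 2) / t ^+ 2 = (dh s - 2 * l * s) / t.
  by rewrite E; field; rewrite gt_eqF.
by rewrite normrN normrM normfV (gtr0_norm t0) ler_pdivrMr.
Qed.

End AtBoundaryPoint.

End Flow.

(** * The limits of the Einstein defect in a chart *)

Section MatrixLimits.
Context {R : realType}.

Lemma cvg_mulmx_ij (T : Type) (F : set_system T) (FF : Filter F) p q s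
    (M : T -> 'M[R]_(p, q)) (N : T -> 'M[R]_(q, s)) (L : 'M[R]_(p, q)) (K : 'M[R]_(q, s)) :
  (forall i j, M t i j @[t --> F] --> L i j) -> (forall i j, N t i j @[t --> F] --> K i j) ->
  forall i j, (M t *m N t) i j @[t --> F] --> (L *m K) i j.
Proof.
move=> HM HN i j; under eq_fun do rewrite mulmx_ij.
by rewrite mulmx_ij; apply: cvg_bigsum => l _; apply: cvgM.
Qed.

Lemma cvg_mxtrace (T : Type) (F : set_system T) (FF : Filter F) k
    (M : T -> 'M[R]_k) (L : 'M[R]_k) :
  (forall i j, M t i j @[t --> F] --> L i j) -> \tr (M t) @[t --> F] --> \tr L.
Proof. by move=> HM; apply: cvg_bigsum => i _; exact: HM. Qed.

Lemma cvg_inner (T : Type) (F : set_system T) (FF : Filter F) k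
    (M : T -> 'M[R]_k) (L : 'M[R]_k) v :
  (forall i j, M t i j @[t --> F] --> L i j) -> inner (M t) v v @[t --> F] --> inner L v v.
Proof.
move=> HM; under eq_fun do rewrite inner_row; rewrite inner_row.
apply: cvg_bigsum => i _; apply: cvg_bigsum => j _.
by apply: cvgM; [apply: cvgM => //; exact: cvg_cst|exact: cvg_cst].
Qed.

End MatrixLimits.

Section LocalTheorem.
Context {R : realType} {n : nat}.
Local Notation V := 'rV[R]_n.+1.
Local Notation HS := (halfspace R n).
Local Notation D := (partial HS).
Local Notation dm := (dmx HS).
Variables (U : set V) (g : V -> 'M[R]_n.+1) (r : V -> R).
Hypotheses (Uo : ropen U) (gC : Ck_mx 2 U g) (rC : Ck HS U 3 r).
Hypotheses (gS : forall z, U z -> (g z)^T = g z) (gp : forall z, U z -> posdef (g z)).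
Hypothesis r0 : forall z, U z -> z 0 ord0 = 0 -> r z = 0.
Hypothesis rpos : forall z, U z -> 0 < z 0 ord0 -> 0 < r z.
Hypothesis unit_grad : forall z, U z -> inner (invmx (g z)) (dr r z) (dr r z) = 1.
Variable gq : V -> 'M[R]_n.+1.
Hypothesis gqE : forall z, U z -> 0 < z 0 ord0 -> gq z = (r z)^-2 *: g z.
Local Notation H := (hess g r).

Let gU z : U z -> g z \in unitmx. Proof. by move=> Uz; exact: posdef_unitmx (gp Uz). Qed.

Definition einstein_defect (z : V) : 'M[R]_n.+1 := ricci HS gq z + n%:R *: gq z.
Local Notation E := einstein_defect.

Lemma ropen_interior : ropen [set z | U z /\ 0 < z 0 ord0].
Proof.
split=> [z [/Uo.1]//|z [Uz z0]].
have pos : \forall y \near z, 0 < (y : V) 0 ord0.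
  apply/nbhs_rowP; exists (z 0 ord0) => // y /(_ ord0).
  by rewrite ltr_norml => /andP[]; rewrite ltrBrDl subrr.
by apply: filterS2 pos (Uo.2 _ Uz) => y y0 yU yH; split=> //; exact: yU.
Qed.

Lemma einstein_defectE z : U z -> 0 < z 0 ord0 -> E z = ricci HS g z
  + (r z)^-1 *: ((n%:R - 1) *: H z + \tr (invmx (g z) *m H z) *: g z).
Proof.
move=> Uz z0; pose Ui : set V := [set z | U z /\ 0 < z 0 ord0].
have sub : Ui `<=` U by move=> y [].
have gCi : Ck_mx 2 Ui g by move=> i j; exact: Ck_subset sub (gC i j).
have rCi : Ck HS Ui 2 r by apply: (Ck_subset sub); exact: CkW.
apply: (conformal_ricci ropen_interior gCi _ _ rCi _ _ _ (unit_grad Uz)).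
- by move=> y [Uy _]; exact: gS.
- by move=> y [Uy _]; exact: gU.
- by move=> y [Uy y0]; rewrite gt_eqF // rpos.
- by move=> y [Uy y0]; exact: gqE.
- by [].
Qed.

(** The trace of g_+ with respect to itself is n + 1, and the inverse of g_+ is r^2
times the inverse of gb. *)
Lemma scalar_defect z : U z -> 0 < z 0 ord0 ->
  scalar_curvature HS gq z + n%:R * (n%:R + 1) = r z ^+ 2 * \tr (invmx (g z) *m E z).
Proof.
move=> Uz z0; have rz := rpos Uz z0.
have rn : r z != 0 by rewrite gt_eqF.
have iE : invmx (gq z) = r z ^+ 2 *: invmx (g z).
  rewrite gqE // invmxZ ?invrK // unitmxZ ?gU // unitfE.
  by rewrite invr_neq0 // expf_neq0.
rewrite /scalar_curvature iE -scalemxAl mxtraceZ /E mulmxDr mxtraceD [RHS]mulrDr.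
congr (_ + _); rewrite gqE // -!scalemxAr mulVmx ?gU // !mxtraceZ mxtrace1.
by rewrite -natr1; field.
Qed.

Lemma curv_Ck a b : Ck_mx 0 U (curv HS g ^~ a ^~ b).
Proof.
have AC c := conn_Ck Uo gU gC c.
have -> : curv HS g ^~ a ^~ b = (fun z => dm a (fun y => conn HS g y b) z
   - dm b (fun y => conn HS g y a) z + (conn HS g z b *m conn HS g z a - conn HS g z a *m conn HS g z b)).
  by apply/funext => z; rewrite curv.unlock.
move=> i j; under eq_fun do rewrite !(addmx_ij, oppmx_ij).
have A0 c := Ck_mxW (AC c).
apply: CkD => //; first apply: CkB => //.
- exact: (Ck_mx_dmx a (AC b)).
- exact: (Ck_mx_dmx b (AC a)).
- by apply: CkB => //; exact: (Ck_mx_mul Uo (A0 _) (A0 _)).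
Qed.

Lemma ricci_Ck : Ck_mx 0 U (ricci HS g).
Proof.
move=> b c; under eq_fun do rewrite ricciE.
by apply: Ck_sum => // a _; exact: curv_Ck.
Qed.

Let HC : Ck_mx 1 U H. Proof. exact: hess_Ck. Qed.
Let giC : Ck_mx 2 U (fun z => invmx (g z)). Proof. exact: Ck_mx_inv. Qed.

Section AtBoundary.
Variable x : V.
Hypotheses (Ux : U x) (x0 : x 0 ord0 = 0).
Local Notation IN := (inner_nbhs U x).
Local Notation Q := (hess_slope g r x).
Local Notation L := (limit_tensor g r x).

Let gcvg i j : g z i j @[z --> IN] --> g x i j. Proof. exact: inner_nbhs_cvg (gC i j) Ux. Qed.
Let gicvg i j : invmx (g z) i j @[z --> IN] --> invmx (g x) i j.
Proof. exact: inner_nbhs_cvg (giC i j) Ux. Qed.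
Let riccvg i j : ricci HS g z i j @[z --> IN] --> ricci HS g x i j.
Proof. exact: inner_nbhs_cvg (ricci_Ck i j) Ux. Qed.
Let Hcvg i j : H z i j @[z --> IN] --> H x i j. Proof. exact: inner_nbhs_cvg (HC i j) Ux. Qed.
Let rcvg : r z @[z --> IN] --> (0 : R).
Proof. by rewrite -(r0 Ux x0); exact: inner_nbhs_cvg rC Ux. Qed.

Lemma defect_limit : (forall z, U z -> z 0 ord0 = 0 -> H z = 0) ->
  forall i j, E z i j @[z --> IN] --> L i j.
Proof.
move=> H0 i j.
have Hr a b : H z a b / r z @[z --> IN] --> Q a b.
  exact: (hess_slope_limit Uo gC rC gp r0 unit_grad Ux x0 H0).
have tr : \tr (invmx (g z) *m ((r z)^-1 *: H z)) @[z --> IN] --> \tr (invmx (g x) *m Q).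
  apply: cvg_mxtrace; apply: cvg_mulmx_ij => // a b.
  by under eq_fun do rewrite scalemx_ij mulrC; exact: Hr.
have K : ricci HS g z i j + ((n%:R - 1) * (H z i j / r z)
   + \tr (invmx (g z) *m ((r z)^-1 *: H z)) * g z i j) @[z --> IN] --> L i j.
  rewrite /limit_tensor addmx_ij [X in _ --> _ + X]addmx_ij ![X in _ --> _ + (X + _)]scalemx_ij.
  rewrite [X in _ --> _ + (_ + X)]scalemx_ij.
  apply: cvgD => //; apply: cvgD; apply: cvgM => //; exact: cvg_cst.
apply: cvg_trans K; apply: near_eq_cvg.
apply: filterS (inner_nbhs_in U x) => z [Uz z0]; rewrite einstein_defectE //.
rewrite !(addmx_ij, scalemx_ij) -scalemxAr mxtraceZ; ring.
Qed.

Lemma scalar_defect_limit : (forall z, U z -> z 0 ord0 = 0 -> H z = 0) ->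
  (scalar_curvature HS gq z + n%:R * (n%:R + 1)) / r z ^+ 2 @[z --> IN]
    --> \tr (invmx (g x) *m L).
Proof.
move=> H0; have K : \tr (invmx (g z) *m E z) @[z --> IN] --> \tr (invmx (g x) *m L).
  by apply: cvg_mxtrace; apply: cvg_mulmx_ij => //; exact: defect_limit.
apply: cvg_trans K; apply: near_eq_cvg.
apply: filterS (inner_nbhs_in U x) => z [Uz z0]; rewrite scalar_defect //.
by rewrite mulrAC mulfV ?mul1r // expf_neq0 // gt_eqF // rpos.
Qed.

Hypothesis n1 : (1 < n)%N.
Hypothesis ricci_ge : forall z, U z -> 0 < z 0 ord0 -> possemidef (E z).
Hypothesis scal0 : (scalar_curvature HS gq z + n%:R * (n%:R + 1)) / r z ^+ 2
    @[z --> IN] --> (0 : R).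

Let trE0 : \tr (invmx (g z) *m E z) @[z --> IN] --> (0 : R).
Proof.
apply: cvg_trans scal0; apply: near_eq_cvg.
apply: filterS (inner_nbhs_in U x) => z [Uz z0]; rewrite scalar_defect //.
by rewrite mulrAC mulfV ?mul1r // expf_neq0 // gt_eqF // rpos.
Qed.

Let IN_proper : ProperFilter IN. Proof. exact: inner_nbhs_proper. Qed.

(** Apart from r Ric_gb, which tends to 0, the product of r and the Einstein defect is
N = (n - 1) H + (tr H) g. So N is nonnegative with trace zero at x, hence tr H = 0,
and N is a positive multiple of H. *)
Lemma hess_vanishes : H x = 0.
Proof.
pose N := (n%:R - 1) *: H x + \tr (invmx (g x) *m H x) *: g x.
have HS' : (H x)^T = H x := hess_sym Uo gC gS (CkW rC) Ux.
have trH : \tr (invmx (g z) *m H z) @[z --> IN] --> \tr (invmx (g x) *m H x).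
  by apply: cvg_mxtrace; apply: cvg_mulmx_ij.
have Nlim i j : (r z *: E z) i j @[z --> IN] --> N i j.
  have K : r z * ricci HS g z i j + ((n%:R - 1) * H z i j
     + \tr (invmx (g z) *m H z) * g z i j) @[z --> IN] --> N i j.
    rewrite -[N i j]add0r -[X in _ --> X + _](mul0r (ricci HS g x i j)) addmx_ij !scalemx_ij.
    apply: cvgD; first exact: cvgM.
    by apply: cvgD; apply: cvgM => //; exact: cvg_cst.
  apply: cvg_trans K; apply: near_eq_cvg.
  apply: filterS (inner_nbhs_in U x) => z [Uz z0]; rewrite einstein_defectE //.
  rewrite !(addmx_ij, scalemx_ij); field.
  by rewrite gt_eqF // rpos.
have Npos : possemidef N.
  move=> v.
  have K : inner (r z *: E z) v v @[z --> IN] --> inner N v v by apply: cvg_inner.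
  apply: (@cvgr_to_ge _ _ IN_proper _ _ _ _ K).
  apply: filterS (inner_nbhs_in U x) => z [Uz z0]; rewrite inner_mxZ mulr_ge0 //.
    by rewrite ltW // rpos.
  exact: ricci_ge.
have trN : \tr (invmx (g x) *m N) = 0.
  have K1 : \tr (invmx (g z) *m (r z *: E z)) @[z --> IN] --> \tr (invmx (g x) *m N).
    by apply: cvg_mxtrace; apply: cvg_mulmx_ij.
  have K2 : \tr (invmx (g z) *m (r z *: E z)) @[z --> IN] --> (0 : R).
    pose proof (cvgM rcvg trE0) as K; rewrite mulr0 in K.
    apply: cvg_trans K; apply: near_eq_cvg; apply: nearW => z.
    by rewrite -scalemxAr mxtraceZ.
  exact: (@cvg_unique _ (@Rhausdorff R) _ (fmap_proper_filter _ IN_proper) _ _ K1 K2).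
have tr0 : \tr (invmx (g x) *m H x) = 0.
  move: trN; rewrite /N mulmxDr -!scalemxAr linearD /= !mxtraceZ mulVmx ?gU // mxtrace1.
  set t := \tr _ => E1.
  (* The trace of g on the (n + 1)-dimensional space adds n + 1 to n - 1. *)
  have : (2 * n%:R) * t = 0 by rewrite -E1 -natr1; ring.
  move=> /eqP; rewrite mulf_eq0 mulf_eq0 pnatr_eq0 /= pnatr_eq0.
  by rewrite -leqn0 leqNgt (ltnW n1) /= => /eqP.
have NE : N = (n%:R - 1) *: H x by rewrite /N tr0 scale0r addr0.
have n0 : 0 < n%:R - 1 :> R by rewrite subr_gt0 ltr1n.
have Hpos : possemidef (H x).
  move=> v; have := Npos v; rewrite NE inner_mxZ pmulr_rge0 //.
exact: (possemidef_trace (gS Ux) (gp Ux) HS' Hpos).2 tr0.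
Qed.

Lemma limit_tensor_vanishes : (forall z, U z -> z 0 ord0 = 0 -> H z = 0) -> L = 0.
Proof.
move=> H0; have Elim := defect_limit H0.
have LS : L^T = L.
  rewrite /limit_tensor.
  move: (hess_slope g r x) (hess_slope_sym Uo gC rC gS gp Ux) => q qS.
  apply/matrixP => i j; rewrite trmx_ij !addmx_ij !scalemx_ij (sym_entry j i qS).
  by rewrite (sym_entry j i (ricci_sym Uo gC gS gU Ux)) (sym_entry j i (gS Ux)).
have Lpos : possemidef L.
  move=> v.
  have K : inner (E z) v v @[z --> IN] --> inner L v v by apply: cvg_inner.
  apply: (@cvgr_to_ge _ _ IN_proper _ _ _ _ K).
  by apply: filterS (inner_nbhs_in U x) => z [Uz z0]; exact: ricci_ge.
apply: (possemidef_trace (gS Ux) (gp Ux) LS Lpos).2.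
have K : \tr (invmx (g z) *m E z) @[z --> IN] --> \tr (invmx (g x) *m L).
  by apply: cvg_mxtrace; apply: cvg_mulmx_ij.
exact: (@cvg_unique _ (@Rhausdorff R) _ (fmap_proper_filter _ IN_proper) _ _ K trE0).
Qed.

End AtBoundary.
End LocalTheorem.

(** * Charts of the manifold *)

(** Fermat's criterion: the difference quotients from the right are nonnegative,
those from the left nonpositive. *)
Lemma interior_min (R : realType) (n : nat) (U : set 'rV[R]_n.+1) (f : 'rV[R]_n.+1 -> R) x a l :
  ropen U -> U x -> 0 < x 0 ord0 -> (forall z, U z -> f x <= f z) ->
  has_partial a f x l -> l = 0.
Proof.
move=> Uo Ux x0 fmin Hf.
have min : \forall h \near steps a x, f x <= f (x + h *: delta_mx 0 a).
  by apply: filterS (steps_in a Uo Ux) => h /fmin.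
apply/le_anti/andP; split; last first.
  have K : h^-1 * (f (x + h *: delta_mx 0 a) - f x) @[h --> (0 : R)^'+] --> l.
    by move=> P HP; exact: (at_right_steps (P := [set h | P (h^-1 * (f (x + h *: delta_mx 0 a) - f x))]) (Uo.1 _ Ux) (Hf _ HP)).
  apply: (cvgr_to_ge K).
  apply: filterS2 (nbhs_right_gt 0) (at_right_steps (Uo.1 _ Ux) min) => h h0 fh.
  by rewrite mulr_ge0 ?invr_ge0 ?(ltW h0) // subr_ge0.
have left (P : R -> Prop) : (\forall h \near steps a x, P h) -> \forall h \near (0 : R)^'-, P h.
  move=> HP.
  have inHS : \forall h \near (0 : R)^'-, halfspace R n (x + h *: delta_mx 0 a).
    have x0' : - x 0 ord0 < 0 by rewrite oppr_lt0.
    apply: filterS (nbhs_left_gt x0') => h hx; rewrite /halfspace /= !mxE.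
    case: (_ && _); rewrite ?mulr1 ?mulr0 ?addr0 ?(ltW x0) //.
    by rewrite -lerBlDl sub0r ltW.
  have HP' : \forall h \near (0 : R)^'-, halfspace R n (x + h *: delta_mx 0 a) -> P h.
    move: HP; rewrite /steps /at_left /dnbhs !near_withinE.
    by apply: filterS => h HP h0; apply: HP; rewrite lt_eqF.
  by apply: filterS2 inHS HP' => h h1 h2; exact: h2.
have K : h^-1 * (f (x + h *: delta_mx 0 a) - f x) @[h --> (0 : R)^'-] --> l.
  by move=> P HP; exact: (left [set h | P (h^-1 * (f (x + h *: delta_mx 0 a) - f x))] (Hf _ HP)).
apply: (cvgr_to_le K).
apply: filterS2 (nbhs_left_lt 0) (left _ min) => h h0 fh.
by rewrite mulr_le0_ge0 ?invr_le0 ?(ltW h0) // subr_ge0.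
Qed.

Section Charts.
Context {R : realType} {n : nat} (X : bmanifold R n).
Local Notation V := 'rV[R]_n.+1.
Local Notation HS := (halfspace R n).

Lemma phi_HS (i : chart X) p : dom X i p -> HS (phi X i p).
Proof.
move=> ip; have [Ob _ E] := bm_image i.
have : (phi X i @` dom X i) (phi X i p) by exists p.
by rewrite E => -[].
Qed.

Lemma psi_near (i : chart X) (B : set X) p : open B -> dom X i p -> B p ->
  \forall z \near phi X i p, (phi X i @` dom X i) z -> B (psi X i z).
Proof.
move=> Bo ip Bp.
have im : (phi X i @` dom X i) (phi X i p) by exists p.
have /subspace_continuousP/(_ (phi X i p) im) K := @bm_psi_continuous _ _ X i.
have NB : nbhs (psi X i (phi X i p)) B by rewrite bm_phiK //; exact: open_nbhs_nbhs.
exact: (K _ NB).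
Qed.

Lemma chart_ropen (i : chart X) (B : set X) : open B -> ropen (phi X i @` (dom X i `&` B)).
Proof.
move=> Bo; split=> [_ [p [ip _] <-]|_ [p [ip Bp] <-]]; first exact: phi_HS.
have [Ob Oo E] := bm_image i.
have Op : Ob (phi X i p).
  by have : (phi X i @` dom X i) (phi X i p) by [exists p]; rewrite E => -[].
apply: filterS2 (open_nbhs_nbhs (conj Oo Op)) (psi_near Bo ip Bp) => z Oz Hz zH.
have : (phi X i @` dom X i) z by rewrite E.
move=> im; have := Hz im; case: im => q iq <-; rewrite bm_phiK // => Bq.
by exists q.
Qed.

Lemma chart_ropenT (i : chart X) : ropen (phi X i @` dom X i).
Proof. by rewrite -(setIT (dom X i)); apply: chart_ropen; exact: openT. Qed.

Lemma phi_near (i : chart X) p (P : V -> Prop) : dom X i p ->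
  (\forall z \near phi X i p, HS z -> P z) -> \forall q \near p, dom X i q -> P (phi X i q).
Proof.
move=> ip HP; have /subspace_continuousP/(_ p ip) K := @bm_phi_continuous _ _ X i.
have {K} := K _ HP; rewrite /fmap /= => K.
have K' : \forall q \near p, dom X i q -> (HS (phi X i q) -> P (phi X i q)) by exact: K.
by apply: filterS K' => q Hq iq; apply: Hq => //; exact: phi_HS.
Qed.

Section DefiningFunction.
Variables (m : nat) (r : X -> R).
Hypothesis m3 : (3 <= m)%N.
Hypothesis rdef : defining_function m r.

(** The definition of the boundary asks for one chart sending p to the edge of the
half-space. In another chart p could not be an interior point: it would be an
interior minimum of r, and dr would vanish there. *)
Lemma bdry_coord (i : chart X) p : bdry p -> dom X i p -> phi X i p 0 ord0 = 0.
Proof.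
move=> bp ip; case: rdef => rC rpos r0 dr0; have dn := dr0 i p bp ip.
have H := phi_HS ip; apply/eqP; apply: contraT => pn.
have pp : 0 < phi X i p 0 ord0 by rewrite lt_def pn; exact: H.
suff : differential r i p = 0 by move=> E; rewrite E eqxx in dn.
apply/rowP => a; rewrite !mxE.
have Ux : (phi X i @` dom X i) (phi X i p) by exists p.
have rC1 : Ck HS (phi X i @` dom X i) 1 (local_fun r i).
  by apply: Ck_leq (rC i); exact: leq_trans m3.
apply: (interior_min (chart_ropenT i) Ux pp _ (Ck_has_partial a rC1 Ux)).
move=> _ [q iq <-]; rewrite /local_fun !bm_phiK // r0 //.
by case: (pselect (bdry q)) => bq; [rewrite r0|rewrite ltW // rpos].
Qed.

Lemma interior_coord (i : chart X) p : ~ bdry p -> dom X i p -> 0 < phi X i p 0 ord0.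
Proof.
move=> bp ip; have H := phi_HS ip; rewrite lt_def; apply/andP; split; last exact: H.
by apply/eqP => E; apply: bp; exists i.
Qed.

End DefiningFunction.
End Charts.

(** * The collar in a boundary chart *)

Section Collar.
Context {R : realType} {n : nat} (X : bmanifold R n).
Local Notation V := 'rV[R]_n.+1.
Local Notation HS := (halfspace R n).
Variables (m : nat) (gp gb : tensor2 X) (r : X -> R) (eps : R) (Phi : X -> R -> X).
Hypothesis m3 : (3 <= m)%N.
Hypothesis hmet : is_metric (~` @bdry R n X) gp.
Hypothesis hr : special_defining_function m gp gb r.
Hypothesis hPhi : gradient_collar m gb r eps Phi.

Let D0 := [set z : X * R | bdry z.1 /\ 0 <= z.2 < eps].
Let F := fun z : X * R => Phi z.1 z.2.
Definition collar : set X := F @` D0.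
Local Notation N := collar.

Let rdef : defining_function m r. Proof. by case: hr. Qed.
Let eps0 : 0 < eps. Proof. by case: hPhi. Qed.
Let Phi0 p : bdry p -> Phi p 0 = p. Proof. by case: hPhi => _ H _ _ _; exact: H. Qed.
Let Nopen : open N. Proof. by case: hPhi => _ _ _ [_ H _] _. Qed.
Let Nunit : unit_gradient_on N gb r. Proof. by case: hPhi => _ _ _ [_ _ H] _. Qed.

Lemma bdry_collar p : bdry p -> N p.
Proof. by move=> bp; exists (p, 0); [split=> //=; rewrite lexx eps0|exact: Phi0]. Qed.

Variable i : chart X.
Definition collar_chart : set V := phi X i @` (dom X i `&` N).
Local Notation U := collar_chart.
Local Notation g := (local_tensor gb i).
Local Notation rl := (local_fun r i).
Local Notation gq := (local_tensor gp i).

Lemma collar_chart_ropen : ropen U. Proof. exact: chart_ropen. Qed.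

Let Usub : U `<=` phi X i @` dom X i.
Proof. by move=> _ [p [ip _] <-]; exists p. Qed.

Lemma collar_chartP p : dom X i p -> N p -> U (phi X i p).
Proof. by move=> ip Np; exists p. Qed.

Lemma chart_metric_Ck : Ck_mx 2 U g.
Proof.
move=> a b; apply: (Ck_subset Usub); case: hr => _ _ /(_ i a b) gC _.
by apply: Ck_leq gC; rewrite -ltnS prednK // (leq_trans _ m3).
Qed.

Lemma chart_defining_Ck : Ck HS U 3 rl.
Proof. by apply: (Ck_subset Usub); case: rdef => /(_ i) rC _ _ _; exact: Ck_leq rC. Qed.

Lemma chart_metric_sym z : U z -> (g z)^T = g z.
Proof.
case=> p [ip Np] <-; rewrite /local_tensor bm_phiK //.
by case: hr => _ [[H _] _] _ _; case: (H i p I ip).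
Qed.

Lemma chart_metric_posdef z : U z -> posdef (g z).
Proof.
case=> p [ip Np] <-; rewrite /local_tensor bm_phiK //.
by case: hr => _ [[H _] _] _ _; case: (H i p I ip).
Qed.

Lemma chart_defining_bdry z : U z -> z 0 ord0 = 0 -> rl z = 0.
Proof.
case=> p [ip Np] <- z0; rewrite /local_fun bm_phiK //; case: rdef => _ _ H _; apply: H.
by exists i.
Qed.

Let not_bdry p : dom X i p -> 0 < phi X i p 0 ord0 -> ~ bdry p.
Proof. by move=> ip z0 bp; move: z0; rewrite (bdry_coord m3 rdef bp ip) ltxx. Qed.

Lemma chart_defining_pos z : U z -> 0 < z 0 ord0 -> 0 < rl z.
Proof.
case=> p [ip Np] <- z0; rewrite /local_fun bm_phiK //; case: rdef => _ H _ _; apply: H.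
exact: not_bdry.
Qed.

Lemma chart_unit_gradient z : U z -> inner (invmx (g z)) (dr rl z) (dr rl z) = 1.
Proof. by case=> p [ip Np] <-; rewrite /local_tensor bm_phiK //; exact: Nunit. Qed.

Lemma chart_conformal z : U z -> 0 < z 0 ord0 -> gq z = (rl z)^-2 *: g z.
Proof.
case=> p [ip Np] <- z0; rewrite /local_tensor /local_fun bm_phiK //.
have bp := not_bdry ip z0.
case: hr => _ [_ ->] // _ _; rewrite scalerA mulVf ?scale1r // expf_neq0 // gt_eqF //.
by case: rdef => _ H _ _; apply: H.
Qed.

Let W := collar_dom eps Phi i i.
Let Ph := collar_coord Phi i i.

Let base x : (phi X i @` dom X i) (hpt 0 (col' ord0 x)) -> exists p,
  [/\ bdry p, dom X i p, phi X i p = hpt 0 (col' ord0 x) & psi X i (hpt 0 (col' ord0 x)) = p].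
Proof.
move=> [p ip E]; exists p; split=> //; last by rewrite -E bm_phiK.
by exists i => //; rewrite E hptE0.
Qed.

Let W_ropen : ropen W.
Proof.
split=> [x [/andP[x0 _] _ _]|x [/andP[x0 xe] im dm]]; first exact: x0.
have [p [bp ip Ep psip]] := base im.
rewrite psip in dm.
have [_ _ [cF _] _ _] := hPhi.
have Dp : D0 (p, x 0 ord0) by split=> //=; rewrite x0.
have Nd : nbhs (F (p, x 0 ord0)) (dom X i).
  by apply: open_nbhs_nbhs; split; [exact: bm_dom_open|exact: dm].
have /subspace_continuousP/(_ _ Dp _ Nd) K := cF.
have {K} K : \forall z \near (p, x 0 ord0), D0 z -> dom X i (F z) by exact: K.
case: K => -[A B] /= [nA nB] AB.
have nA' : \forall z \near phi X i p, (phi X i @` dom X i) z -> A (psi X i z).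
  have im' : (phi X i @` dom X i) (phi X i p) by exists p.
  have /subspace_continuousP/(_ _ im') K := @bm_psi_continuous _ _ X i.
  have nA2 : nbhs (psi X i (phi X i p)) A by rewrite bm_phiK.
  exact: (K _ nA2).
have nim := (chart_ropenT i).2 _ im.
rewrite Ep in nA'.
have : \forall z \near hpt 0 (col' ord0 x), HS z ->
    (phi X i @` dom X i) z /\ A (psi X i z).
  by apply: filterS2 nim nA' => z h1 h2 h3; split; [exact: h1|exact: h2 (h1 h3)].
move=> /nbhs_rowP[e1 e10 He1].
have nt : \forall t \near x 0 ord0, B t /\ t < eps.
  by apply: filterS2 nB (lt_nbhsl xe) => t; split.
have /nbhs_ballP[e2 /= e20 He2] := nt.
apply/nbhs_rowP; exists (Num.min e1 e2); first by rewrite lt_min e10.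
move=> z Hz zH.
have z1 : forall c, `|hpt 0 (col' ord0 z) 0 c - hpt 0 (col' ord0 x) 0 c| < e1.
  move=> c; rewrite !mxE; case: unliftP => [c' _|_]; last by rewrite subrr normr0.
  by rewrite !mxE; apply: lt_le_trans (Hz _) _; rewrite ge_min lexx.
have zH' : HS (hpt 0 (col' ord0 z)) by rewrite /halfspace /= hptE0.
have [zim zA] := He1 _ z1 zH'.
have [Bz ze] : B (z 0 ord0) /\ z 0 ord0 < eps.
  apply: He2; rewrite /ball /= distrC; apply: lt_le_trans (Hz _) _.
  by rewrite ge_min lexx orbT.
split=> //; first by rewrite ze andbT; exact: zH.
have [q [bq _ _ psiq]] := base zim.
rewrite psiq; rewrite psiq in zA.
apply: (AB (q, z 0 ord0)); first by split.
by split=> //=; rewrite ze andbT; exact: zH.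
Qed.

Let W_U x : W x -> U (Ph x).
Proof.
move=> [x0 im dm]; have [p [bp ip _ psip]] := base im.
rewrite /Ph /collar_coord; apply: collar_chartP => //.
by exists (p, x 0 ord0); rewrite /F /= ?psip.
Qed.

Let Ph_Ck c : Ck HS W 2 (fun x => Ph x 0 c).
Proof.
case: hPhi => _ _ [_ /(_ i i c) C] _ _.
by apply: Ck_leq C; rewrite -ltnS prednK // (leq_trans _ m3).
Qed.

(** Every point of the domain has the form (t, y), with y the coordinates of a boundary
point, so the flow equation holds throughout. *)
Let Ph_flow x c : W x ->
  partial HS ord0 (fun w => Ph w 0 c) x = grad_field g rl (Ph x) 0 c.
Proof.
move=> [x0 im dm]; have [p [bp ip Ep psip]] := base im.
case: hPhi => _ _ _ _ /(_ i i p (x 0 ord0) c bp x0 ip).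
rewrite psip in dm => /(_ dm).
rewrite Ep col'_hpt hpt_col' => ->.
by rewrite /gradient /grad_field /Ph /collar_coord psip /local_tensor bm_phiK.
Qed.

Let Ph0 x : W x -> x 0 ord0 = 0 -> Ph x = x.
Proof.
move=> [_ im _] x0; have [p [bp ip Ep psip]] := base im.
by rewrite /Ph /collar_coord psip x0 Phi0 // Ep -x0 hpt_col'.
Qed.

Section Point.
Variable p : X.
Hypotheses (bp : bdry p) (ip : dom X i p).
Local Notation x := (phi X i p).

Lemma bdry_point0 : x 0 ord0 = 0. Proof. exact: (bdry_coord m3 rdef bp ip). Qed.

Lemma bdry_collar_chart : U x. Proof. by apply: collar_chartP => //; exact: bdry_collar. Qed.

Let hx : hpt 0 (col' ord0 x) = x. Proof. by rewrite -{1}bdry_point0 hpt_col'. Qed.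

Let Wx : W x.
Proof.
split; first by rewrite bdry_point0 lexx eps0.
  by rewrite hx; exists p.
by rewrite hx bm_phiK // bdry_point0 Phi0.
Qed.

Let col'_ray t : col' ord0 (x + t *: delta_mx 0 ord0) = col' ord0 x.
Proof. by apply/rowP => a; rewrite !mxE /= mulr0 addr0. Qed.

Let ray0 t : (x + t *: delta_mx 0 ord0) 0 ord0 = t.
Proof. by rewrite !mxE /= bdry_point0 add0r mulr1. Qed.

Let rayE t : hpt t (col' ord0 x) = x + t *: delta_mx 0 ord0.
Proof. by rewrite -(hpt_col' (x + _)) ray0 col'_ray. Qed.

Let W_ray t : W (x + t *: delta_mx 0 ord0) -> dom X i (Phi p t).
Proof. by move=> [_ _]; rewrite col'_ray hx bm_phiK // ray0. Qed.

Let collar_metricE t : W (x + t *: delta_mx 0 ord0) -> collar_metric gb Phi i i t p =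
  pulled_metric g Ph (x + t *: delta_mx 0 ord0).
Proof.
move=> Wt; have it := W_ray Wt.
rewrite /collar_metric rayE /pulled_metric.
have -> : g (Ph (x + t *: delta_mx 0 ord0)) = gb i (Phi p t).
  by rewrite /local_tensor /Ph /collar_coord col'_ray hx bm_phiK // ray0 bm_phiK.
by [].
Qed.

Let W_near : \forall t \near (0 : R)^'+, W (x + t *: delta_mx 0 ord0).
Proof. exact: (at_right_steps (phi_HS ip) (steps_in ord0 W_ropen Wx)). Qed.

Variables (g1 g2 : chart X -> X -> 'M[R]_n).
Hypothesis hexp : collar_expansion gb eps Phi g1 g2.

Let expansion v : exists K : R, \forall t \near (0 : R)^'+,
  `|inner (pulled_metric g Ph (x + t *: delta_mx 0 ord0)) v v - inner (tangential (g x)) v v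
    - (inner (g1 i p) v v * t + inner (g2 i p) v v * t ^+ 2)| <= K * t ^+ 3.
Proof.
case: hexp => C [d [d0 de H]].
exists (C * inner (tangential (gb i p)) v v).
apply: filterS3 (nbhs_right_gt 0) (nbhs_right_lt d0) W_near => t t0 td Wt.
have td' : 0 <= t < d by rewrite (ltW t0).
have := H i i p t v bp td' ip (W_ray Wt); rewrite /= collar_metricE //.
have -> : g x = gb i p by rewrite /local_tensor bm_phiK.
have -> : inner (pulled_metric g Ph (x + t *: delta_mx 0 ord0)
     - (tangential (gb i p) + t *: g1 i p + t ^+ 2 *: g2 i p)) v v =
  inner (pulled_metric g Ph (x + t *: delta_mx 0 ord0)) v v - inner (tangential (gb i p)) v v
    - (inner (g1 i p) v v * t + inner (g2 i p) v v * t ^+ 2).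
  by rewrite -scaleN1r !(inner_mxD, inner_mxZ); ring.
by rewrite mulrAC.
Qed.

Lemma first_coefficient_hess v :
  inner (g1 i p) v v = 2 * inner (tangential (hess g rl x)) v v.
Proof.
have [K HK] := expansion v.
apply: (first_coefficient _ HK).
exact: (metric_slope collar_chart_ropen chart_metric_Ck chart_defining_Ck chart_metric_sym
  chart_metric_posdef W_ropen Ph_Ck W_U Ph_flow Ph0 Wx bdry_point0).
Qed.

Lemma second_coefficient_hess v :
  (forall z, U z -> z 0 ord0 = 0 -> hess g rl z = 0) ->
  inner (g1 i p) v v = 0 /\ inner (g2 i p) v v = inner (tangential (hess_slope g rl x)) v v.
Proof.
move=> H0; have [K HK] := expansion v.
apply: (second_coefficient _ HK).
exact: (metric_curve collar_chart_ropen chart_metric_Ck chart_defining_Ck chart_metric_sym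
  chart_metric_posdef chart_defining_bdry chart_unit_gradient W_ropen Ph_Ck W_U Ph_flow Ph0 Wx bdry_point0 H0).
Qed.

End Point.
End Collar.

(** * From the Ricci tensor to the Schouten tensor *)

Section SchoutenAlgebra.
Context {R : realType} {n : nat}.
Hypothesis n2 : (2 < n)%N.
Variables (Rh q gt : 'M[R]_n).
Hypothesis gtU : gt \in unitmx.
Local Notation tr M := (\tr (invmx gt *m M)).

Let n2' : n%:R - 2 != 0 :> R.
Proof. by rewrite subr_eq0 (eqr_nat R n 2) gtn_eqF. Qed.

Let n1' : n%:R - 1 != 0 :> R.
Proof. by rewrite subr_eq0 (eqr_nat R n 1) gtn_eqF // ltnW. Qed.

Let trD M N : tr (M + N) = tr M + tr N. Proof. by rewrite mulmxDr mxtraceD. Qed.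
Let trZ c M : tr (c *: M) = c * tr M. Proof. by rewrite -scalemxAr mxtraceZ. Qed.
Let trN M : tr (- M) = - tr M. Proof. by rewrite mulmxN raddfN. Qed.
Let trg : tr gt = n%:R. Proof. by rewrite mulVmx // mxtrace1. Qed.

(** Taking the trace gives tr q = - tr Rh / (2 (n - 1)), and then q is determined
because n - 2 is invertible. *)
Lemma schouten_equation : Rh + (n%:R - 2) *: q + tr q *: gt = 0 <->
  q = - ((n%:R - 2)^-1 *: (Rh - (tr Rh / (2 * (n%:R - 1))) *: gt)).
Proof.
split=> E.
  have := congr1 (fun M => tr M) E; rewrite /= !trD !trZ trg mulmx0 mxtrace0 => E1.
  have trq : tr q = - (tr Rh / (2 * (n%:R - 1))).
    have E2 : tr Rh = - (2 * (n%:R - 1)) * tr q.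
      by apply/eqP; rewrite -subr_eq0 -E1; apply/eqP; ring.
    by rewrite E2; field.
  move: E; rewrite trq scaleNr => E.
  rewrite -[q](scalerK n2') -scalerN; congr (_ *: _).
  by apply/eqP; rewrite -subr_eq0 opprK -E; apply/eqP; mx_abel.
have trq : tr q = - (tr Rh / (2 * (n%:R - 1))).
  rewrite E trN trZ trD trN trZ trg; field.
  by rewrite n1' n2'.
rewrite trq {1}E scalerN scalerA divff // scale1r; apply/matrixP => a b.
by rewrite !(addmx_ij, oppmx_ij, scalemx_ij) [RHS]mxE; ring.
Qed.

End SchoutenAlgebra.

(** * Proof of the equivalence *)

(** The gradient of r is transversal to the boundary and lies in the kernel of H, so
the tangential part of H determines H. *)
Lemma hess_bdry_eq0 (R : realType) (n : nat) (U : set 'rV[R]_n.+1)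
    (g : 'rV[R]_n.+1 -> 'M[R]_n.+1) (r : 'rV[R]_n.+1 -> R) x :
  ropen U -> Ck_mx 2 U g -> Ck (halfspace R n) U 3 r ->
  (forall z, U z -> (g z)^T = g z) -> (forall z, U z -> posdef (g z)) ->
  (forall z, U z -> z 0 ord0 = 0 -> r z = 0) ->
  (forall z, U z -> inner (invmx (g z)) (dr r z) (dr r z) = 1) ->
  U x -> x 0 ord0 = 0 -> tangential (hess g r x) = 0 -> hess g r x = 0.
Proof.
move=> Uo gC rC gS gp r0 unit Ux x0 T0.
have HS := hess_sym Uo gC gS (CkW rC) Ux.
have Hv a := hess_gradient Uo gC rC gS gp unit a Ux.
have v0 : (dr r x *m invmx (g x)) 0 ord0 != 0.
  rewrite (dr_bdry Uo r0 Ux x0) -scalemxAl -rowE scalemx_ij mxE.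
  apply/eqP => E; have := normal_unit Uo r0 unit Ux x0.
  by rewrite expr2 -mulrA E mulr0 => /esym/eqP; rewrite oner_eq0.
have tT a b : hess g r x (lift ord0 a) (lift ord0 b) = 0.
  by rewrite -tangential_ij T0 mxE.
have H0a a : hess g r x (lift ord0 a) ord0 = 0.
  have := Hv (lift ord0 a); rewrite big_ord_recl big1 => [|j _]; last by rewrite tT mul0r.
  by rewrite addr0 => /eqP; rewrite mulf_eq0 (negbTE v0) orbF => /eqP.
have H00 : hess g r x ord0 ord0 = 0.
  have := Hv ord0; rewrite big_ord_recl big1 => [|j _].
    by rewrite addr0 => /eqP; rewrite mulf_eq0 (negbTE v0) orbF => /eqP.
  by rewrite (sym_entry _ _ HS) H0a mul0r.
apply/matrixP => a b; rewrite [RHS]mxE.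
case: (unliftP ord0 a) => [a' ->|->]; case: (unliftP ord0 b) => [b' ->|->] //.
by rewrite (sym_entry _ _ HS).
Qed.

Section Main.
Context {R : realType} {n : nat} (X : bmanifold R n).
Local Notation V := 'rV[R]_n.+1.
Local Notation HS := (halfspace R n).
Variables (m : nat) (gp gb : tensor2 X) (r : X -> R) (eps : R) (Phi : X -> R -> X).
Hypothesis n2 : (2 < n)%N.
Hypothesis m3 : (3 <= m)%N.
Hypothesis hmet : is_metric (~` @bdry R n X) gp.
Hypothesis hr : special_defining_function m gp gb r.
Hypothesis hPhi : gradient_collar m gb r eps Phi.
Variables (g1 g2 : chart X -> X -> 'M[R]_n).
Hypothesis hsym : forall (i : chart X) (p : X), bdry p -> dom X i p ->
       (g1 i p)^T = g1 i p /\ (g2 i p)^T = g2 i p.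
Hypothesis hexp : collar_expansion gb eps Phi g1 g2.

Local Notation U := (collar_chart eps Phi).
Local Notation N := (collar eps Phi).
Local Notation g := (local_tensor gb).
Local Notation rl := (local_fun r).
Local Notation gq := (local_tensor gp).
Local Notation S i z := (scalar_curvature HS (gq i) z + n%:R * (n%:R + 1)).

Let rdef : defining_function m r. Proof. by case: hr. Qed.
Let Uo i : ropen (U i). Proof. exact: (collar_chart_ropen hPhi). Qed.
Let gC i : Ck_mx 2 (U i) (g i). Proof. exact: (chart_metric_Ck eps Phi m3 hr i). Qed.
Let rC i : Ck HS (U i) 3 (rl i). Proof. exact: (chart_defining_Ck eps Phi m3 hr i). Qed.
Let gS i z : U i z -> (g i z)^T = g i z. Proof. exact: (chart_metric_sym hr). Qed.
Let gpd i z : U i z -> posdef (g i z). Proof. exact: (chart_metric_posdef hr). Qed.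
Let r0 i z : U i z -> z 0 ord0 = 0 -> rl i z = 0. Proof. exact: (chart_defining_bdry hr). Qed.
Let rpos i z : U i z -> 0 < z 0 ord0 -> 0 < rl i z. Proof. exact: (chart_defining_pos m3 hr). Qed.
Let unit i z : U i z -> inner (invmx (g i z)) (dr (rl i) z) (dr (rl i) z) = 1.
Proof. exact: (chart_unit_gradient hPhi). Qed.
Let gqE i z : U i z -> 0 < z 0 ord0 -> gq i z = (rl i z)^-2 *: g i z.
Proof. exact: (chart_conformal m3 hr). Qed.

Let Ubdry i z : U i z -> z 0 ord0 = 0 -> exists p, [/\ bdry p, dom X i p & z = phi X i p].
Proof. by case=> p [ip Np] <- z0; exists p; split=> //; exists i. Qed.

Let Uint i z : U i z -> 0 < z 0 ord0 -> exists p, [/\ ~ bdry p, dom X i p & z = phi X i p].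
Proof.
case=> p [ip Np] <- z0; exists p; split=> // bp.
by move: z0; rewrite (bdry_coord m3 rdef bp ip) ltxx.
Qed.

Section AtPoint.
Variables (i : chart X) (p : X).
Hypotheses (bp : bdry p) (ip : dom X i p).
Local Notation x := (phi X i p).

Let Ux : U i x. Proof. exact: (bdry_collar_chart hPhi bp ip). Qed.
Let x0 : x 0 ord0 = 0. Proof. exact: (bdry_coord m3 rdef bp ip). Qed.

Lemma g1_zero : g1 i p = 0 <-> tangential (hess (g i) (rl i) x) = 0.
Proof.
have K := first_coefficient_hess m3 hr hPhi bp ip hexp.
have HS' := hess_sym (Uo i) (gC i) (@gS i) (CkW (rC i)) Ux.
split=> E.
  apply: polarization; first exact: tangential_sym.
  move=> v; have := K v; rewrite E inner_row big1 => [|a _].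
    by move=> /esym/eqP; rewrite mulf_eq0 pnatr_eq0 /= => /eqP.
  by apply: big1 => b _; rewrite mxE mulr0 mul0r.
apply: polarization; first by case: (hsym bp ip).
move=> v; rewrite K E inner_row big1 ?mulr0 // => a _.
by apply: big1 => b _; rewrite mxE mulr0 mul0r.
Qed.

Hypothesis H0 : forall z, U i z -> z 0 ord0 = 0 -> hess (g i) (rl i) z = 0.
Local Notation Q := (hess_slope (g i) (rl i) x).
Local Notation L := (limit_tensor (g i) (rl i) x).

Lemma g2_slope : g2 i p = tangential Q.
Proof.
have QS := hess_slope_sym (Uo i) (gC i) (rC i) (@gS i) (@gpd i) Ux.
apply/eqP; rewrite -subr_eq0; apply/eqP; apply: polarization.
  rewrite linearB /= tangential_sym //; congr (_ - _); by case: (hsym bp ip).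
move=> v; rewrite -scaleN1r inner_mxD inner_mxZ.
have [_ ->] := second_coefficient_hess m3 hr hPhi bp ip hexp v H0.
by rewrite mulN1r subrr.
Qed.

Lemma limit_tensor_schouten : tangential L = 0 <-> tangential Q = - bdry_schouten gb i p.
Proof.
have hx : hpt 0 (col' ord0 x) = x by rewrite -{1}x0 hpt_col'.
have E := limit_tensor_tangential (Uo i) (gC i) (rC i) (@gS i) (@gpd i) (@r0 i) (@unit i) Ux x0 H0.
have gtU := posdef_unitmx (posdef_tangential (gpd Ux)).
rewrite E /bdry_schouten /schouten /scalar_curvature /bdry_metric hx.
exact: (schouten_equation n2 _ _ gtU).
Qed.

End AtPoint.

(** The chart in which a point is tested against the curvature condition is arbitrary,
while the limit at the boundary is taken in a chart around the limit point. *)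
Lemma scalar_curvature_chart i j p : ~ bdry p -> N p -> dom X i p -> dom X j p ->
  scalar_curvature HS (gq i) (phi X i p) = scalar_curvature HS (gq j) (phi X j p).
Proof.
move=> bp Np ip jp.
have gqC k : Ck_mx 2 [set z | U k z /\ 0 < z 0 ord0] (gq k).
  have o := ropen_interior (Uo k).
  have sub : [set z | U k z /\ 0 < z 0 ord0] `<=` U k by move=> z [].
  apply: (eq_Ck_mx o (M := fun z => (rl k z)^-2 *: g k z)).
    by move=> z [Uz z0]; rewrite gqE.
  apply: Ck_mx_scale => //; last by move=> a b; exact: Ck_subset sub (gC k a b).
  have rC2 : Ck HS [set z | U k z /\ 0 < z 0 ord0] 2 (rl k).
    by apply: Ck_subset sub _; exact: CkW.
  have rn z : [set z | U k z /\ 0 < z 0 ord0] z -> rl k z ^+ 2 != 0.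
    by move=> [Uz z0]; rewrite expf_neq0 // gt_eqF // rpos.
  exact: (CkV o rn (CkM o rC2 rC2)).
have met k z : U k z /\ 0 < z 0 ord0 -> (gq k z)^T = gq k z /\ posdef (gq k z).
  move=> [Uz z0]; have [q [bq kq ->]] := Uint Uz z0.
  by rewrite /local_tensor bm_phiK //; exact: (hmet.1 k q bq kq).
pose B := dom X j `&` N.
have Bo : open B by apply: openI; [exact: bm_dom_open|case: hPhi => _ _ _ [_ H _] _].
pose Uij : set V := [set z | (phi X i @` (dom X i `&` B)) z /\ 0 < z 0 ord0].
have Uijo : ropen Uij by apply: ropen_interior; exact: chart_ropen.
have subi : Uij `<=` [set z | U i z /\ 0 < z 0 ord0].
  by move=> _ [[q [iq [jq Nq]] <-] z0]; split=> //; exists q.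
have trans z : Uij z -> U j (phi X j (psi X i z)) /\ 0 < phi X j (psi X i z) 0 ord0.
  move=> [[q [iq [jq Nq]] Eq] z0]; rewrite -Eq bm_phiK //; split; first by exists q.
  apply: interior_coord => // bq; move: z0; rewrite -Eq.
  by rewrite (bdry_coord m3 rdef bq iq) ltxx.
have Up : Uij (phi X i p) by split; [exists p|exact: interior_coord].
rewrite (scalar_curvature_pullback (phi := fun z => phi X j (psi X i z)) Uijo
  (ropen_interior (Uo j)) trans _ _ (gqC j) _ _ _ _ _ Up) ?bm_phiK //.
- move=> c; apply: (Ck_subset _ (bm_transition i j 3 c)).
  by move=> _ [[q [iq [jq _]] <-] _]; exists q.
- by move=> a b; exact: Ck_subset subi (gqC i a b).
- by move=> z /subi/met[].
- by move=> z /subi/met[_ /posdef_unitmx].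
- by move=> z /met[].
- by move=> z /met[_ /posdef_unitmx].
- move=> z Uz; have [[q [iq [jq Nq]] Eq] z0] := Uz.
  have bq : ~ bdry q.
    by move=> bq; move: z0; rewrite -Eq (bdry_coord m3 rdef bq iq) ltxx.
  rewrite -Eq /local_tensor !bm_phiK // (hmet.2 i j q bq iq jq).
  have -> // : jac (fun z => phi X j (psi X i z)) (phi X i q) = Defs.jacobian i j q.
  by rewrite jac.unlock.
Qed.

Lemma g1_zero_hess i : (forall p, bdry p -> dom X i p -> g1 i p = 0) ->
  forall z, U i z -> z 0 ord0 = 0 -> hess (g i) (rl i) z = 0.
Proof.
move=> g10 z Uz z0; have [p [bp ip zE]] := Ubdry Uz z0; rewrite zE in Uz z0 *.
apply: (hess_bdry_eq0 (Uo i) (gC i) (rC i) (@gS i) (@gpd i) (@r0 i) (@unit i) Uz z0).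
by apply/(g1_zero bp ip); exact: g10.
Qed.

(** The scalar curvature defect divided by r^2 tends to tr T0, the trace of the
tangential part of T0, and this part vanishes by the hypothesis on the
expansion. *)
Lemma scalar_small_near i p (e : R) : 0 < e -> bdry p -> dom X i p ->
  (forall q, bdry q -> dom X i q -> g1 i q = 0 /\ g2 i q = - bdry_schouten gb i q) ->
  \forall q \near p, dom X i q /\ (~ bdry q -> `|S i (phi X i q)| <= e * r q ^+ 2).
Proof.
move=> e0 bp ip W; have H0 := g1_zero_hess (fun q bq iq => (W q bq iq).1).
have Ux := bdry_collar_chart hPhi bp ip; have x0 := bdry_coord m3 rdef bp ip.
have lim := scalar_defect_limit (Uo i) (gC i) (rC i) (@gS i) (@gpd i) (@r0 i) (@rpos i)
  (@unit i) (@gqE i) Ux x0 H0.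
have tr0 : \tr (invmx (g i (phi X i p)) *m limit_tensor (g i) (rl i) (phi X i p)) = 0.
  rewrite (limit_tensor_trace (Uo i) (gC i) (rC i) (@gS i) (@gpd i) (@r0 i) (@unit i) Ux x0 H0).
  have -> : tangential (limit_tensor (g i) (rl i) (phi X i p)) = 0.
    apply/(limit_tensor_schouten bp ip H0).
    by rewrite -(g2_slope bp ip H0); exact: (W p bp ip).2.
  by rewrite mulmx0 mxtrace0.
rewrite tr0 in lim; have /cvgrPdist_le/(_ e e0) near_x := lim.
have near_x' : \forall z \near phi X i p, HS z ->
    (U i z /\ 0 < z 0 ord0 -> `|0 - S i z / rl i z ^+ 2| <= e).
  have near_x2 : \forall z \near phi X i p, U i z /\ 0 < z 0 ord0 ->
      `|0 - S i z / rl i z ^+ 2| <= e by exact: near_x.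
  by apply: filterS near_x2 => z Hz _; exact: Hz.
have K := phi_near ip near_x'.
have Nn : \forall q \near p, N q.
  apply: open_nbhs_nbhs; split; last exact: (bdry_collar hPhi).
  by case: hPhi => _ _ _ [_ H _] _.
have dn : \forall q \near p, dom X i q by apply: open_nbhs_nbhs; split; [exact: bm_dom_open|].
apply: filterS3 K Nn dn => q Kq Nq iq; split=> // bq.
have rq : 0 < r q by case: rdef => _ H _ _; exact: H.
have := Kq iq (conj (collar_chartP iq Nq) (interior_coord bq iq)).
rewrite sub0r normrN /local_fun bm_phiK // normrM normfV (gtr0_norm (exprn_gt0 2 rq)).
by rewrite ler_pdivrMr // exprn_gt0.
Qed.

(** Hence points where r tends to 0 accumulate only at the boundary. *)
Lemma r_lower_near p : ~ bdry p -> \forall q \near p, r p / 2 < r q.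
Proof.
move=> bp; have [i ip] := bm_cover p.
have rp : 0 < r p by case: rdef => _ H _ _; exact: H.
have im : (phi X i @` dom X i) (phi X i p) by exists p.
case: rdef => /(_ i) rC' _ _ _; have := Ck_cvg rC' im.
rewrite {2}/local_fun bm_phiK // => /cvgr_gt/(_ (r p / 2)) K.
have h2 : r p / 2 < r p by rewrite ltr_pdivrMr // mulr_natr mulr2n ltrDl.
have {K} : \forall z \near phi X i p, (phi X i @` dom X i) z -> r p / 2 < local_fun r i z by exact: K.
move=> K; have K' : \forall z \near phi X i p, HS z -> ((phi X i @` dom X i) z -> r p / 2 < local_fun r i z).
  by apply: filterS K => z Hz _; exact: Hz.
have dn : \forall q \near p, dom X i q by apply: open_nbhs_nbhs; split; [exact: bm_dom_open|].
apply: filterS2 (phi_near ip K') dn => q Hq iq; have := Hq iq.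
by rewrite /local_fun bm_phiK //; apply; exists q.
Qed.

(** If the estimate failed for every d, the points violating it would accumulate as r
tends to 0. A cluster point exists by compactness; it lies on the boundary since r
is bounded below near interior points, and [scalar_small_near] excludes it. *)
Lemma wpe_scalar : (forall i p, bdry p -> dom X i p ->
     g1 i p = 0 /\ g2 i p = - bdry_schouten gb i p) ->
  forall e : R, 0 < e -> exists2 d : R, 0 < d &
     forall i p, ~ bdry p -> dom X i p -> r p < d -> `|S i (phi X i p)| <= e * r p ^+ 2.
Proof.
move=> W e e0; apply: contrapT => nd.
pose bad := [set q : X | exists i, [/\ ~ bdry q, dom X i q & ~ `|S i (phi X i q)| <= e * r q ^+ 2]].
have bad_ex d : 0 < d -> exists q, bad q /\ r q < d.
  move=> d0; apply: contrapT => H; apply: nd; exists d => // i p bp ip rp.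
  by apply: contrapT => np; apply: H; exists p; split=> //; exists i.
(* The filter of the violating points along which r tends to 0. *)
pose FF : set_system X := [set B | exists2 d : R, 0 < d & forall q, bad q -> r q < d -> B q].
have FFp : ProperFilter FF.
  apply: Build_ProperFilter_ex => [B [d d0 HB]|].
    by have [q [bq rq]] := bad_ex d d0; exists q; exact: HB.
  split; first by exists 1.
  - move=> A B [d1 d10 H1] [d2 d20 H2]; exists (Num.min d1 d2); first by rewrite lt_min d10.
    by move=> q bq; rewrite lt_min => /andP[rq1 rq2]; split; [exact: H1|exact: H2].
  - by move=> A B AB [d d0 H]; exists d => // q bq rq; apply: AB; exact: H.
have [p0 [_ clp]] := @bm_compact _ _ X FF FFp (filterT : FF setT).
case: (pselect (bdry p0)) => bp0.
  have [i ip] := bm_cover p0.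
  have small := scalar_small_near e0 bp0 ip (W i).
  have Nn : \forall q \near p0, N q.
    apply: open_nbhs_nbhs; split; last exact: (bdry_collar hPhi).
    by case: hPhi => _ _ _ [_ H _] _.
  have F1 : FF bad by exists 1.
  have [q [[j [bq jq nS]] [[iq Sq] Nq]]] := clp _ _ F1 (filterI small Nn).
  by apply: nS; rewrite -(scalar_curvature_chart bq Nq iq jq); exact: Sq.
have rp0 : 0 < r p0 by case: rdef => _ H _ _; exact: H.
have F1 : FF [set q | r q < r p0 / 2] by exists (r p0 / 2) => //; rewrite divr_gt0.
have [q [/= rq1 rq2]] := clp _ _ F1 (r_lower_near bp0).
by have := lt_trans rq1 rq2; rewrite ltxx.
Qed.

Hypothesis hRic : forall (i : chart X) (p : X) (v : 'rV[R]_n.+1),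
       ~ bdry p -> dom X i p ->
       0 <= inner (ricci HS (gq i) (phi X i p) + n%:R *: gp i p) v v.

(** First H = 0 on the whole boundary part of the chart, then T0 = 0: the existence of
T0 at a point needs the vanishing of H around it. *)
Lemma scalar_wpe :
  (forall e : R, 0 < e -> exists2 d : R, 0 < d &
     forall i p, ~ bdry p -> dom X i p -> r p < d -> `|S i (phi X i p)| <= e * r p ^+ 2) ->
  forall i p, bdry p -> dom X i p -> g1 i p = 0 /\ g2 i p = - bdry_schouten gb i p.
Proof.
move=> small i.
have ricpos z : U i z -> 0 < z 0 ord0 -> possemidef (einstein_defect (gq i) z).
  move=> Uz z0 v; have [q [bq iq zE]] := Uint Uz z0; have := hRic v bq iq.
  by rewrite zE /einstein_defect {3}/local_tensor bm_phiK.
have scal0 x : U i x -> x 0 ord0 = 0 -> S i z / rl i z ^+ 2 @[z --> inner_nbhs (U i) x] --> (0 : R).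
  move=> Ux x0; apply/cvgrPdist_le => e e0; have [d d0 Hd] := small e e0.
  have rlim : rl i z @[z --> inner_nbhs (U i) x] --> (0 : R).
    by rewrite -(r0 Ux x0); exact: inner_nbhs_cvg (rC i) Ux.
  have rd : \forall z \near inner_nbhs (U i) x, rl i z < d by exact: (cvgr_lt 0 rlim _ d0).
  have FI := inner_nbhs_filter (U i) x.
  have near_x := inner_nbhs_in (U i) x.
  apply: filterS2 rd near_x => z rz [Uz z0].
  have [q [bq iq zE]] := Uint Uz z0.
  have rzp := rpos Uz z0; rewrite sub0r normrN normrM normfV (gtr0_norm (exprn_gt0 2 rzp)).
  rewrite ler_pdivrMr ?exprn_gt0 //.
  have rzE : rl i z = r q by rewrite zE /local_fun bm_phiK.
  by rewrite rzE zE; apply: Hd => //; rewrite -rzE.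
have H0 z : U i z -> z 0 ord0 = 0 -> hess (g i) (rl i) z = 0.
  move=> Uz z0; exact: (hess_vanishes (Uo i) (gC i) (rC i) (@gS i) (@gpd i) (@r0 i) (@rpos i)
    (@unit i) (@gqE i) Uz z0 (ltnW n2) ricpos (scal0 z Uz z0)).
move=> p bp ip; have Ux := bdry_collar_chart hPhi bp ip; have x0 := bdry_coord m3 rdef bp ip.
have L0 := limit_tensor_vanishes (Uo i) (gC i) (rC i) (@gS i) (@gpd i) (@r0 i) (@rpos i)
  (@unit i) (@gqE i) Ux x0 ricpos (scal0 _ Ux x0) H0.
have t0 : tangential (0 : 'M[R]_n.+1) = 0 by apply/matrixP => a b; rewrite tangential_ij !mxE.
split; first by apply/(g1_zero bp ip); rewrite H0.
rewrite (g2_slope bp ip H0); apply/(limit_tensor_schouten bp ip H0).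
by rewrite L0.
Qed.

End Main.

Theorem theorem1p1 (R : realType) (n : nat) (hn : (3 < n.+1)%N)
    (m : nat) (hm : (3 <= m)%N) (alpha : R) (halpha : 0 < alpha < 1)
    (X : bmanifold R n) (hbdry : @bdry R n X !=set0)
    (gp : tensor2 X) (hAH : asymptotically_hyperbolic m alpha gp)
    (hRic : forall (i : chart X) (p : X) (v : 'rV[R]_n.+1),
       ~ bdry p -> dom X i p ->
       0 <= inner (ricci (halfspace R n) (local_tensor gp i) (phi X i p)
                   + n%:R *: gp i p) v v)
    (gb : tensor2 X) (r : X -> R)
    (hr : special_defining_function m gp gb r)
    (eps : R) (Phi : X -> R -> X) (hPhi : gradient_collar m gb r eps Phi)
    (g1 g2 : chart X -> X -> 'M[R]_n)
    (hsym : forall (i : chart X) (p : X), bdry p -> dom X i p ->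
       (g1 i p)^T = g1 i p /\ (g2 i p)^T = g2 i p)
    (hexp : collar_expansion gb eps Phi g1 g2) :
  (forall (i : chart X) (p : X), bdry p -> dom X i p ->
     g1 i p = 0 /\ g2 i p = - bdry_schouten gb i p)
  <->
  (forall e : R, 0 < e -> exists2 d : R, 0 < d &
     forall (i : chart X) (p : X), ~ bdry p -> dom X i p -> r p < d ->
       `|scalar_curvature (halfspace R n) (local_tensor gp i) (phi X i p)
         + n%:R * (n%:R + 1)| <= e * r p ^+ 2).
Proof.
have hmet : is_metric (~` @bdry R n X) gp by case: hAH.
split; first exact: (wpe_scalar hn hm hmet hr hPhi hsym hexp).
exact: (scalar_wpe hn hm hr hPhi hsym hexp hRic).
Qed.
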